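(* Let $d\ge 1$, and let $a:[0,\infty)\to\mathbb{R}$ satisfy $a_0\le a(t)\le a_1$ for all $t\ge0$ with constants $0<a_0\le a_1$. Suppose that at least one of the following (i), (ii), (iii) holds. (i) There exist a constant $a_\infty>0$ and a positive monotone increasing function $\Theta$ on $[0,\infty)$ with $\sup_{t\ge0}\Theta(t)<\infty$ such that $$\int_0^t|a(s)-a_\infty|\,ds\le\Theta(t)\quad\text{for all }t\ge0 .$$ (ii) $a\in C^1([0,\infty))$, and there exist a constant $C_1>0$ and a positive monotone increasing function $\Xi$ on $[0,\infty)$ with $\Xi^{-1}\in L^1([0,\infty))$ such that $|a'(t)|\le C_1\Xi(t)^{-1}$ for all $t\ge0$. (iii) There exist an integer $m\ge2$ and positive monotone increasing functions $\Theta,\Xi$ on $[0,\infty)$ such that $a\in C^m([0,\infty))$ and all of the following hold: - there is a constant $a_\infty>0$ with $\int_0^t|a(s)-a_\infty|\,ds\le\Theta(t)$ for all $t\ge0$; - there are constants $C_k>0$ with $|a^{(k)}(t)|\le C_k\,\Xi(t)^{-k}$ for all $t\ge0$ and $k=1,\dots,m$; - there is a constant $C_0>0$ with $\Theta(t)\le C_0\,\Xi(t)$ for all $t\ge0$; - $\Xi^{-m}\in L^1([0,\infty))$ and $\displaystyle\sup_{t\ge0}\Big\{\Theta(t)^{m-1}\int_t^\infty\Xi(s)^{-m}\,ds\Big\}<\infty$. Then the generalized energy conservation holds for the initial value problem of the semi-discrete wave equation $$u''(t)[k]-a(t)^2\sum_{j=1}^d\big(u(t)[k+e_j]-2u(t)[k]+u(t)[k-e_j]\big)=0\quad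 (t\ge 0,\ k\in\mathbb{Z}^d),\qquad u(0)=u_0,\ u'(0)=u_1,$$ that is, $E(t)\simeq E(0)$: there is a constant $C\ge1$, independent of $t$ and of the initial data, such that $C^{-1}E(0)\le E(t)\le C\,E(0)$ for all $t\ge0$.
   Context: $\{e_1,\dots,e_d\}$ is the standard basis of $\mathbb{R}^d$. The initial data are $u_0=\{u_0[k]\}_{k\in\mathbb{Z}^d}$, $u_1=\{u_1[k]\}_{k\in\mathbb{Z}^d}\in l^2(\mathbb{Z}^d)$, and $u$ is the solution with $u,u'$ continuous in $t$ with values in $l^2(\mathbb{Z}^d)$ (when $a$ is only assumed measurable, $u'$ is absolutely continuous on bounded intervals and the equation holds for a.e. $t$). For $f=\{f[k]\}_{k\in\mathbb{Z}^d}$, $D_j^+f[k]:=f[k+e_j]-f[k]$. The total energy is $$E(t):=\sum_{k\in\mathbb{Z}^d}|u'(t)[k]|^2+a(t)^2\sum_{j=1}^d\sum_{k\in\mathbb{Z}^d}|D_j^+u(t)[k]|^2 .$$ *)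

(* Defs.v *)
From HB Require Import structures.
From mathcomp Require Import all_boot all_order all_algebra.
From mathcomp Require Import all_classical all_reals all_analysis.
From mathcomp Require Import complex.

Set Implicit Arguments.
Unset Strict Implicit.
Unset Printing Implicit Defensive.

Import Order.TTheory GRing.Theory Num.Theory.
Import numFieldNormedType.Exports.

Local Open Scope classical_set_scope.
Local Open Scope ring_scope.

Section HalfLine.
Variable R : realType.
Implicit Types (f : R -> R) (t : R).

(* Functions on [0, oo[ are total functions on R whose values at negative
   arguments are irrelevant. *)
Definition halfline : set R := `[0, +oo[%classic.

(* Punctured neighbourhoods of t in [0, oo[: one-sided at t = 0. *)
Definition punctured t := within halfline (t^').

Definition diff_quotient f t (s : R) : R := (f s - f t) / (s - t).

Definition derivable_hl f t := cvg (diff_quotient f t @ punctured t).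

Definition derive_hl f : R -> R := fun t => lim (diff_quotient f t @ punctured t).

Definition deriven_hl (k : nat) f : R -> R := iter k derive_hl f.

Definition Cn_hl (m : nat) f : Prop :=
  (forall k, (k < m)%N -> forall t : R, 0 <= t -> derivable_hl (deriven_hl k f) t) /\
  {within halfline, continuous (deriven_hl m f)}.

(* "Monotone increasing" is taken in the non-strict sense. *)
Definition positive_increasing f : Prop :=
  (forall t : R, 0 <= t -> 0 < f t) /\
  (forall s t : R, 0 <= s -> s <= t -> f s <= f t).

End HalfLine.

Arguments halfline : clear implicits.

Section SquareSummable.
Variables (R : realType) (d : nat).
Implicit Types (f : 'rV[int]_d -> R[i]).

Definition l2sqnorm f : \bar R :=
  \esum_(k in [set: 'rV[int]_d]) (ComplexField.Normc.normc (f k) ^+ 2)%:E.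

Definition l2norm f : \bar R := sqrte (l2sqnorm f).

Definition in_l2 f : Prop := (l2norm f < +oo)%E.

Definition fwd_diff (j : 'I_d) f : 'rV[int]_d -> R[i] :=
  fun k => f (k + delta_mx 0 j) - f k.

Definition laplacian f : 'rV[int]_d -> R[i] :=
  fun k => \sum_(j < d) (f (k + delta_mx 0 j) - 2 * f k + f (k - delta_mx 0 j)).

Implicit Types (w : R -> 'rV[int]_d -> R[i]).

Definition l2_continuous w : Prop :=
  forall t : R, 0 <= t ->
    l2norm (fun k => w s k - w t k) @[s --> within (halfline R) (nbhs t)] --> 0%E.

(* The function z is the derivative of w at t for the norm of l^2. *)
Definition l2_derivative w (t : R) (z : 'rV[int]_d -> R[i]) : Prop :=
  in_l2 z /\
  l2norm (fun k => ((s - t)^-1)%:C%C * (w s k - w t k) - z k)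
    @[s --> punctured t] --> 0%E.

Definition l2_abs_continuous w : Prop :=
  forall T e : R, 0 < T -> 0 < e -> exists2 delta : R, 0 < delta &
    forall (n : nat) (x y : 'I_n -> R),
      (forall i, 0 <= x i /\ x i < y i /\ y i <= T) ->
      trivIset [set: 'I_n] (fun i => `]x i, y i[%classic) ->
      \sum_(i < n) (y i - x i) < delta ->
      (\sum_(i < n) l2norm (fun k => w (y i) k - w (x i) k)%R < e%:E)%E.

(* u is a solution and v = u'. If a is continuous then u' is automatically C^1
   and the equation holds for every t >= 0. *)
Definition is_solution (a : R -> R) (u0 u1 : 'rV[int]_d -> R[i])
    (u v : R -> 'rV[int]_d -> R[i]) : Prop :=
  (forall t : R, 0 <= t -> in_l2 (u t) /\ in_l2 (v t)) /\
  l2_continuous u /\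
  l2_continuous v /\
  (forall t : R, 0 <= t -> l2_derivative u t (v t)) /\
  l2_abs_continuous v /\
  {ae (@lebesgue_measure R), forall t : R, 0 <= t ->
     exists2 w, l2_derivative v t w &
       forall k, w k - (a t ^+ 2)%:C%C * laplacian (u t) k = 0} /\
  (forall k, u 0 k = u0 k) /\
  (forall k, v 0 k = u1 k).

Definition energy (a : R -> R) (u v : R -> 'rV[int]_d -> R[i]) (t : R) : \bar R :=
  (l2sqnorm (v t) +
   (a t ^+ 2)%:E * \sum_(j < d) l2sqnorm (fwd_diff j (u t)))%E.

End SquareSummable.

Section Conditions.
Variable R : realType.
Implicit Types (a Theta Xi : R -> R).

Local Notation mu := (@lebesgue_measure R).

Definition stabilization a (ainf : R) Theta : Prop :=
  forall t : R, 0 <= t ->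
    (\int[mu]_(s in `[0%R, t]) `|a s - ainf|%:E <= (Theta t)%:E)%E.

(* measurable_fun is Borel measurability. A Lebesgue measurable function is one
   that agrees almost everywhere with a Borel function, and its Lebesgue
   integrals are those of any such representative. *)
Definition borel_representative a (b : R -> R) : Prop :=
  measurable_fun (halfline R) b /\ {ae mu, forall t : R, 0 <= t -> a t = b t}.

Definition condition_i a : Prop :=
  exists2 b : R -> R, borel_representative a b &
    exists (ainf : R) Theta,
      0 < ainf /\ positive_increasing Theta /\
      has_ubound [set Theta t | t in halfline R] /\
      stabilization b ainf Theta.

Definition condition_ii a : Prop :=
  Cn_hl 1 a /\
  exists (C1 : R) Xi,
    0 < C1 /\ positive_increasing Xi /\
    mu.-integrable (halfline R) (fun t => ((Xi t)^-1)%:E) /\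
    forall t : R, 0 <= t -> `|derive_hl a t| <= C1 * (Xi t)^-1.

Definition condition_iii a : Prop :=
  exists (m : nat) Theta Xi,
    (2 <= m)%N /\ positive_increasing Theta /\ positive_increasing Xi /\
    Cn_hl m a /\
    (exists ainf : R, 0 < ainf /\ stabilization a ainf Theta) /\
    (forall k, (1 <= k <= m)%N -> exists Ck : R, 0 < Ck /\
       forall t : R, 0 <= t -> `|deriven_hl k a t| <= Ck * Xi t ^- k) /\
    (exists C0 : R, 0 < C0 /\ forall t : R, 0 <= t -> Theta t <= C0 * Xi t) /\
    mu.-integrable (halfline R) (fun t => (Xi t ^- m)%:E) /\
    (ereal_sup [set (Theta t ^+ m.-1)%:E *
                    \int[mu]_(s in `[t, +oo[) (Xi s ^- m)%:E
               | t in halfline R] < +oo)%E.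

End Conditions.

(* Main.v *)
Require Import Defs.
From HB Require Import structures.
From mathcomp Require Import all_boot all_order all_algebra.
From mathcomp Require Import all_classical all_reals all_analysis.
From mathcomp Require Import measurable_realfun complex.
From mathcomp Require Import ring lra.

Set Implicit Arguments.
Unset Strict Implicit.
Unset Printing Implicit Defensive.

Import Order.TTheory GRing.Theory Num.Theory.
Import numFieldNormedType.Exports.

Local Open Scope classical_set_scope.
Local Open Scope ring_scope.

(** Fourier transform turns the equation into the scalar oscillators
    y'' + a(t)^2 lam^2 y = 0 with 0 <= lam^2 <= 4d, and the claim is an energy
    bound for them that is uniform in lam.  Frequencies are bounded, and this is
    what makes an estimate of the order of a - ainf, without derivatives of a,
    possible at all.

    The scalar bound comes from quadratic forms Q(t) in (p, q) = (y', y), uniformly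
    comparable with p^2 + lam^2 q^2, which decrease (or increase, for the lower
    bound) along the oscillator.  Each is an approximate invariant times the
    exponential of the accumulated error ([weighted_sdissipative]):
    - p^2 + ainf^2 lam^2 q^2, with error rate O(lam |a - ainf|).  This settles
      [condition_i], and [condition_iii] as long as lam Theta(t) < N;
    - p^2 + a^2 lam^2 q^2, with error rate O(|a'|).  This settles [condition_ii];
    - |p - z q|^2 / Im z, where z = i lam (z_0 + z_1/(i lam) + ...) is a truncated
      WKB solution of the Riccati equation z' + z^2 + a^2 lam^2 = 0.  With m terms
      (z_j uses j derivatives of a, so z_j = O(Xi^-j)) the residual is
      O(lam^(2-m) Xi^-m) and the error rate O(lam^(1-m) Xi^-m).  Its integral over
      the times with lam Theta(t) >= N is bounded exactly by the last hypothesis of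
      [condition_iii].
    In [condition_iii] the two regimes meet at a time depending on lam, where the
    form is allowed to jump in the favourable direction ([glue_slyapunov]).

    The switching time depends on lam, so the scalar forms must be applied to
    spectral pieces of the solution.  Instead of a spectral measure, the proof uses
    Bernstein polynomials.  Let P be minus the Laplacian divided by 4d.  Both
    P and 1 - P are sums of operators A^* A, so that the polynomials
    C(n,k) P^k (1-P)^(n-k) are positive operators; they sum to 1, and on the k-th
    one P acts as k/n up to an error of order n^(-1/2) ([window_variance]).
    Applying to the k-th piece the scalar form of frequency lam^2 = 4d k/n, summing
    over k and letting n tend to infinity gives [energy_transfer].

    Since u' is only absolutely continuous and solves the equation almost
    everywhere, and the forms may jump, monotonicity is derived from an
    elementary covering argument, [ae_growth], rather than from differentiability
    everywhere. *)

(** * Growth of absolutely continuous interval functions *)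

Section AlmostEverywhere.
Variable R : realType.
Local Notation mu := (@lebesgue_measure R).
Let ae_filter := @ae_filter_ringOfSetsType _ _ R (@lebesgue_measure R).

Lemma ae_mono (P Q : R -> Prop) :
  (forall t, P t -> Q t) -> {ae mu, forall t, P t} -> {ae mu, forall t, Q t}.
Proof. by move=> PQ H; exact: (filterS (F := almost_everywhere mu) PQ H). Qed.

Lemma ae_and (P Q : R -> Prop) : {ae mu, forall t, P t} ->
  {ae mu, forall t, Q t} -> {ae mu, forall t, P t /\ Q t}.
Proof. by move=> HP HQ; exact: (filterI (F := almost_everywhere mu) HP HQ). Qed.

Lemma ae_all (I : finType) (P : I -> R -> Prop) :
  (forall i, {ae mu, forall t, P i t}) -> {ae mu, forall t, forall i, P i t}.
Proof. by move=> H; exact: (@filter_forall _ _ _ _ ae_filter). Qed.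

Lemma ae_notin_subsingleton (Z : R -> Prop) :
  (forall s t, Z s -> Z t -> s = t) -> {ae mu, forall t, ~ Z t}.
Proof.
move=> ZZ; have [[t Zt]|nZ] := pselect (exists t, Z t); last first.
  by apply: aeW => t Zt; apply: nZ; exists t.
exists [set t]; split => //; first exact: lebesgue_measure_set1.
by move=> s /= /contrapT Zs; exact: ZZ.
Qed.

End AlmostEverywhere.

Section Growth.
Variable R : realType.
Local Notation mu := (@lebesgue_measure R).
Implicit Types (a b r t x y z e : R) (psi : R -> R -> R).

(** Cousin's lemma in the form of an induction principle for properties of
    intervals: let c be the supremum of the endpoints reached from [a]; a small
    interval around c reaches beyond it. *)
Lemma interval_gluing (P : R -> R -> Prop) a b : a <= b ->
  (forall x y z, x <= y -> y <= z -> P x y -> P y z -> P x z) ->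
  (forall t, a <= t <= b -> exists2 delta : R, 0 < delta &
     forall x y, a <= x <= t -> t <= y <= b -> y - x < delta -> P x y) ->
  P a b.
Proof.
move=> ab Ptrans Ploc.
pose S := [set y | a <= y <= b /\ P a y].
have Sa : S a.
  have [|d d0 H] := Ploc a; first by rewrite lexx.
  split; first by rewrite lexx.
  by apply: H; rewrite ?subrr ?lexx.
have Sb : has_ubound S by exists b => y [/andP[]].
have supS : has_sup S by split => //; exists a.
pose c := sup S.
have ac : a <= c by exact: ub_le_sup.
have cb : c <= b by apply: ge_sup; [exists a|move=> y [/andP[]]].
have [|d d0 H] := Ploc c; first by rewrite ac.
have [x [/andP[ax xb] Pax] cx] := sup_adherent (divr_gt0 d0 (@ltr0Sn _ 1)) supS.
have {}cx : c - d / 2 < x := cx.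
have xc : x <= c by apply: ub_le_sup => //; split => //; rewrite ax.
have step y : c <= y <= b -> y - x < d -> P a y.
  move=> /andP[cy yb] yx; apply: (Ptrans _ x) => //; first exact: le_trans cy.
  by apply: H => //; rewrite ?ax ?cy.
have [bd|bd] := ltP (b - c) (d / 2); first by apply: step; rewrite ?cb ?lexx//; lra.
have : S (c + d / 4).
  split; first by apply/andP; split; lra.
  by apply: step; [apply/andP; split; lra|lra].
by move=> /(ub_le_sup Sb); rewrite -/c => ?; exfalso; lra.
Qed.

(** A left-to-right list of disjoint intervals; unlike an indexed disjoint
    family, chains of adjacent intervals can be concatenated. *)
Fixpoint chain x y (s : seq (R * R)) : Prop :=
  if s is p :: s' then [/\ x <= p.1, p.1 < p.2 & chain p.2 y s'] else x <= y.

Lemma chain_cat x y z s1 s2 :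
  chain x y s1 -> chain y z s2 -> chain x z (s1 ++ s2).
Proof.
have weaken u w s : u <= w -> chain w z s -> chain u z s.
  by case: s => [|p s] /= uw; [exact: le_trans|case=> /(le_trans uw)].
by elim: s1 x => [|p s1 IH] x //= => [xy|[? ? c1] c2]; [exact: weaken|split; auto].
Qed.

Lemma chain_le x y s : chain x y s -> x <= y.
Proof.
elim: s x => //= p s IH x [xp pp /IH]; apply: le_trans.
by apply: le_trans (ltW pp).
Qed.

Lemma chain_mem (x y : R) (s : seq (R * R)) (p : R * R) : chain x y s -> p \in s ->
  x <= p.1 /\ p.1 < p.2 /\ p.2 <= y.
Proof.
elim: s x => [|r s IH] x //= [xr rr cs]; rewrite inE => /predU1P[->|ps].
  by split => //; split => //; exact: chain_le cs.
have [h1 h2] := IH _ cs ps; split => //; exact: le_trans (le_trans xr (ltW rr)) h1.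
Qed.

Lemma chain_trivIset (x y : R) (s : seq (R * R)) : chain x y s ->
  trivIset [set: 'I_(size s)]
    (fun i : 'I_(size s) => `](nth (0, 0) s i).1, (nth (0, 0) s i).2[%classic).
Proof.
move=> cs.
have ord i j : (i < j < size s)%N -> (nth (0, 0) s i).2 <= (nth (0, 0) s j).1.
  elim: s x cs i j => [|p s IH] x; first by move=> _ i j /=; rewrite ltn0 andbF.
  move=> /= [xp pp cs] [|i] [|j]//=.
    by rewrite ltnS => js; have [] := chain_mem cs (mem_nth (0, 0) js).
  by move=> ij; exact: IH cs _ _ ij.
move=> i j _ _ [r /=]; rewrite !in_itv /= => -[/andP[ir1 ir2] /andP[jr1 jr2]].
apply/val_inj; have [ij|ji|//] := ltngtP i j.
  have := ord i j; rewrite ij ltn_ord => /(_ isT) h.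
  by have := lt_le_trans ir2 (le_trans h (ltW jr1)); rewrite ltxx.
have := ord j i; rewrite ji ltn_ord => /(_ isT) h.
by have := lt_le_trans jr2 (le_trans h (ltW ir1)); rewrite ltxx.
Qed.

(** One-sided, so that downward jumps are allowed. *)
Definition abs_cont psi a b := forall e, 0 < e -> exists2 delta : R, 0 < delta &
  forall s, chain a b s -> \sum_(p <- s) (p.2 - p.1) < delta ->
    \sum_(p <- s) psi p.1 p.2 <= e.

Lemma negligible_outer_open (Z : set R) e : mu.-negligible Z -> 0 < e ->
  exists U : set R, [/\ open U, Z `<=` U & (mu U < e%:E)%E].
Proof.
move=> [A [mA A0 ZA]] e0; have {}A0 : mu A = 0%E := A0.
have Aoo : (mu A < +oo)%E by rewrite A0 ltry.
have [|U [oU AU Ue]] := @lebesgue_regularity_outer R A e mA _ e0.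
  exact: Aoo.
exists U; split => //; first exact: subset_trans AU.
have mU : measurable U by exact: open_measurable.
have E := measureDI mu mU mA; rewrite setIidr// in E.
have {}E : mu U = (mu (U `\` A) + mu A)%E := E.
by rewrite E A0 adde0.
Qed.

(** Cover the exceptional null set by an open set of small measure.  By
    [interval_gluing] the interval splits into pieces that satisfy the local bound
    and pieces inside the open set; absolute continuity makes the contribution of
    the latter small.  Here [psi x y] is typically an increment or the norm of
    one. *)
Lemma ae_growth psi a b r : a <= b -> 0 <= r ->
  (forall x, psi x x = 0) ->
  (forall x y z, a <= x -> x <= y -> y <= z -> z <= b ->
     psi x z <= psi x y + psi y z) ->
  abs_cont psi a b ->
  {ae mu, forall t, a <= t <= b -> forall e, 0 < e ->
     exists2 delta : R, 0 < delta &
     forall x y, a <= x <= t -> t <= y <= b -> y - x < delta ->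
       psi x y <= (r + e) * (y - x)} ->
  psi a b <= r * (b - a).
Proof.
move=> ab r0 psi0 sub ac aeloc.
suff main e : 0 < e -> psi a b <= (r + e) * (b - a) + e.
  apply/ler_addgt0Pr => e e0.
  have c0 : 0 < b - a + 1 by lra.
  have := main (e / (b - a + 1)) (divr_gt0 e0 c0).
  suff -> : (r + e / (b - a + 1)) * (b - a) + e / (b - a + 1) = r * (b - a) + e by [].
  by field; rewrite lt0r_neq0.
move=> e0; have [d d0 acd] := ac e e0.
have [U [oU ZU Ud]] := negligible_outer_open aeloc d0.
have mU : measurable U by exact: open_measurable.
(* [s] lists the pieces that lie in [U]. *)
pose P x y := a <= x -> y <= b -> exists s, [/\ chain x y s,
  psi x y <= (r + e) * (y - x) + \sum_(p <- s) psi p.1 p.2 &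
  ((\sum_(p <- s) (p.2 - p.1))%:E <= mu (U `&` `]x, y]))%E].
suff /(_ (lexx _) (lexx _)) [s [cs ps ls]] : P a b.
  apply: le_trans ps _; rewrite lerD2l; apply: acd => //.
  rewrite -lte_fin; apply: le_lt_trans ls _; apply: le_lt_trans Ud.
  by apply: le_measure; rewrite ?inE//; exact: measurableI.
apply: interval_gluing => //.
- move=> x y z xy yz Pxy Pyz ax zb.
  have [s1 [c1 p1 l1]] := Pxy ax (le_trans yz zb).
  have [s2 [c2 p2 l2]] := Pyz (le_trans ax xy) zb.
  exists (s1 ++ s2); split; first exact: chain_cat c2.
  + by rewrite big_cat /=; have := sub x y z ax xy yz zb; lra.
  + rewrite big_cat /= EFinD; apply: le_trans (leeD l1 l2) _.
    rewrite -measureU//; [|exact: measurableI|exact: measurableI|].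
      rewrite -setIUr; apply: le_measure; rewrite ?inE//.
      * by apply: measurableI => //; exact: measurableU.
      * exact: measurableI.
      apply: setIS => u /=; rewrite !in_itv /= => -[] /andP[h1 h2].
        by rewrite h1 (le_trans h2 yz).
      by rewrite h2 (le_lt_trans xy h1).
    rewrite -subset0 => u [[_ /=]]; rewrite in_itv /= => /andP[_ uy] [_ /=].
    by rewrite in_itv /= ltNge uy.
- move=> t tab.
  have [Ut|Ut] := pselect (U t).
    have [d1 /= d10 HU] : exists2 d1 : R, 0 < d1 & ball t d1 `<=` U.
      by have /nbhs_ballP[d1 ? ?] := oU _ Ut; exists d1.
    exists d1 => // x y /andP[ax xt] /andP[ty yb] yx _ _.
    have [xy|xy] := ltP x y; last first.
      have -> : x = y by apply/eqP; rewrite eq_le xy (le_trans xt ty).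
      exists [::]; split; rewrite /= ?big_nil// psi0 subrr mulr0 addr0//.
    exists [:: (x, y)]; split; rewrite ?big_seq1 //=.
      by rewrite lerDr mulr_ge0//; lra.
    have -> : U `&` `]x, y] = `]x, y]%classic.
      apply: setIidr => u /=; rewrite in_itv /= => /andP[xu uy].
      apply: HU; rewrite /ball /= ltr_norml; apply/andP; split; lra.
    by rewrite lebesgue_measure_itv /= lte_fin xy -EFinB.
  have Zt : forall e, 0 < e ->
     exists2 delta : R, 0 < delta &
     forall x y, a <= x <= t -> t <= y <= b -> y - x < delta ->
       psi x y <= (r + e) * (y - x).
    by apply: contrapT => nt; apply/Ut/ZU => /(_ tab).
  have [d1 d10 H1] := Zt _ e0; exists d1 => // x y xt ty yx _ _.
  exists [::]; split; rewrite /= ?big_nil// ?addr0; last first.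
    exact: H1.
  by move: xt ty => /andP[_ xt] /andP[ty _]; exact: le_trans ty.
Qed.

End Growth.

(** * Moments of Bernstein polynomials *)

Section BernsteinPolynomials.
Variable R : realType.
Implicit Types n k : nat.

Definition bernstein n k : {poly R} :=
  'C(n, k)%:R *: ('X^k * (1 - 'X) ^+ (n - k)).

Lemma sum_bernstein n : \sum_(k < n.+1) bernstein n k = 1.
Proof.
transitivity (((1 - 'X) + 'X : {poly R}) ^+ n); last by rewrite subrK expr1n.
rewrite exprDn; apply: eq_bigr => k _.
by rewrite /bernstein scaler_nat mulrC.
Qed.

Lemma bernsteinS n k :
  k.+1%:R *: bernstein n.+1 k.+1 = n.+1%:R *: ('X * bernstein n k).
Proof.
rewrite /bernstein subSS -scalerAr !scalerA -!natrM mul_bin_diag.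
by rewrite mulrA exprS.
Qed.

Lemma sum_bernstein_deg1 n :
  \sum_(k < n.+1) k%:R *: bernstein n k = n%:R *: 'X.
Proof.
case: n => [|n]; first by rewrite big_ord1 !scale0r.
rewrite big_ord_recl scale0r add0r.
rewrite (eq_bigr (fun k : 'I_n.+1 => n.+1%:R *: ('X * bernstein n k))); last first.
  by move=> k _; rewrite bernsteinS.
by rewrite -scaler_sumr -mulr_sumr sum_bernstein mulr1.
Qed.

Lemma sum_bernstein_deg2 n :
  \sum_(k < n.+1) (k%:R * (k%:R - 1)) *: bernstein n k =
  (n%:R * (n%:R - 1)) *: 'X^2.
Proof.
case: n => [|n]; first by rewrite big_ord1 !mul0r !scale0r.
rewrite big_ord_recl mul0r scale0r add0r.
rewrite (eq_bigr (fun k : 'I_n.+1 =>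
    n.+1%:R *: ('X * (k%:R *: bernstein n k)))); last first.
  move=> k _; rewrite lift0.
  rewrite -[in LHS]natr1 addrK mulrC natr1 -scalerA bernsteinS.
  by move: (bernstein n k) => b; rewrite -scalerAr !scalerA mulrC.
rewrite -scaler_sumr -mulr_sumr sum_bernstein_deg1 -scalerAr scalerA.
by rewrite -[n.+1%:R]natr1 addrK.
Qed.

(** The variance of the binomial law: this makes k/n a good approximation of 'X on
    the k-th Bernstein polynomial. *)
Lemma bernstein_variance n : (0 < n)%N ->
  \sum_(k < n.+1) ('X - (k%:R / n%:R)%:P) ^+ 2 * bernstein n k =
  n%:R^-1 *: ('X * (1 - 'X)).
Proof.
move=> n0; have n0' : n%:R != 0 :> R by rewrite pnatr_eq0 -lt0n.
rewrite (eq_bigr (fun k : 'I_n.+1 => 'X^2 * bernstein n k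
   + (- 2 / n%:R) *: ('X * (k%:R *: bernstein n k))
   + (n%:R ^+ 2)^-1 *: (k%:R *: bernstein n k)
   + (n%:R ^+ 2)^-1 *: ((k%:R * (k%:R - 1)) *: bernstein n k))); last first.
  move=> k _; rewrite -!mul_polyC.
  have -> : (k%:R / n%:R : R)%:P = k%:R%:P * (n%:R^-1)%:P by rewrite -polyCM.
  have -> : (n%:R ^+ 2)^-1%:P = (n%:R^-1)%:P ^+ 2 :> {poly R}.
    by rewrite -exprVn rmorphXn.
  rewrite !polyCM polyCN !polyCB; move: (n%:R^-1)%:P => y.
  by rewrite polyC1 (_ : 2%:P = 2) ?rmorph_nat//; ring.
rewrite !big_split /= -mulr_sumr sum_bernstein mulr1.
rewrite -!scaler_sumr -mulr_sumr sum_bernstein_deg1 sum_bernstein_deg2.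
rewrite -scalerAr !scalerA divfK//.
have -> : ((n%:R ^+ 2)^-1 * n%:R : R) = n%:R^-1 by field.
have -> : ((n%:R ^+ 2)^-1 * (n%:R * (n%:R - 1)) : R) = 1 - n%:R^-1 by field.
rewrite -!mul_polyC polyCB polyCN polyC1 (_ : 2%:P = 2) ?rmorph_nat//.
by move: (_%:P) => y; ring.
Qed.

End BernsteinPolynomials.

(** * Semi-inner products and vector-valued derivatives *)

Section SemiInnerProducts.
Variables (R : realType) (V : lmodType R).
Implicit Types (B : V -> V -> R) (f g h : V) (c t : R).

Definition quad (A B G p q : R) := A * p ^+ 2 + 2 * B * p * q + G * q ^+ 2.

(** Degeneracy must be allowed: the spectral windows below are degenerate. *)
Definition semi_ip B := [/\ forall f g, B f g = B g f,
  forall f g h, B (f + g) h = B f h + B g h,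
  forall c f g, B (c *: f) g = c * B f g & forall f, 0 <= B f f].

Section Theory.
Variable B : V -> V -> R.
Hypothesis hB : semi_ip B.

Lemma semi_ipC f g : B f g = B g f. Proof. by case: hB. Qed.
Lemma semi_ipDl f g h : B (f + g) h = B f h + B g h. Proof. by case: hB. Qed.
Lemma semi_ipZl c f g : B (c *: f) g = c * B f g. Proof. by case: hB. Qed.
Lemma semi_ip_ge0 f : 0 <= B f f. Proof. by case: hB. Qed.
Lemma semi_ipDr f g h : B f (g + h) = B f g + B f h.
Proof. by rewrite semi_ipC semi_ipDl !(semi_ipC f). Qed.
Lemma semi_ipZr c f g : B f (c *: g) = c * B f g.
Proof. by rewrite semi_ipC semi_ipZl semi_ipC. Qed.
Lemma semi_ipNl f g : B (- f) g = - B f g.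
Proof. by rewrite -scaleN1r semi_ipZl mulN1r. Qed.
Lemma semi_ipNr f g : B f (- g) = - B f g.
Proof. by rewrite semi_ipC semi_ipNl semi_ipC. Qed.
Lemma semi_ip0l f : B 0 f = 0.
Proof. by rewrite -(scale0r f) semi_ipZl mul0r. Qed.

Definition semi_ipE :=
  (semi_ipDl, semi_ipDr, semi_ipNl, semi_ipNr, semi_ipZl, semi_ipZr).

Lemma semi_ip_CS f g : B f g ^+ 2 <= B f f * B g g.
Proof.
have ge0 x y : 0 <= x ^+ 2 * B f f + 2 * x * y * B f g + y ^+ 2 * B g g.
  rewrite [X in _ <= X](_ : _ = B (x *: f + y *: g) (x *: f + y *: g)) ?semi_ip_ge0//.
  by rewrite !semi_ipE (semi_ipC g f); ring.
have [gg0|gg0] := eqVneq (B g g) 0; last first.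
  have gg : 0 < B g g by rewrite lt_def gg0 semi_ip_ge0.
  rewrite -subr_ge0 -(pmulr_rge0 _ gg).
  by rewrite [X in _ <= X](_ : _ = (B g g) ^+ 2 * B f f + 2 * B g g * (- B f g) * B f g + (- B f g) ^+ 2 * B g g) ?ge0//; ring.
have ff := semi_ip_ge0 f; rewrite gg0 mulr0.
have [->|fg0] := eqVneq (B f g) 0; first by rewrite expr0n.
have := ge0 1 (- (B f f + 1) / B f g).
suff -> : 1 ^+ 2 * B f f + 2 * 1 * (- (B f f + 1) / B f g) * B f g +
  (- (B f f + 1) / B f g) ^+ 2 * B g g = - (B f f + 2).
  by move=> ?; exfalso; lra.
by rewrite gg0; field.
Qed.

Lemma semi_ip_young (e : R) f g : 0 < e -> 2 * B f g <= e * B f f + e^-1 * B g g.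
Proof.
move=> e0; have := semi_ip_ge0 (e *: f - g).
rewrite !semi_ipE (semi_ipC g f) => H.
rewrite -(ler_pM2l e0) mulrDr (mulrA e e^-1) mulfV ?lt0r_neq0// mul1r.
by rewrite -subr_ge0; apply: le_trans H _; rewrite le_eqVlt; apply/orP; left; apply/eqP; ring.
Qed.

(** Completing the square uses only operations available in a semi-inner
    product, so scalar inequalities between forms pass to vectors. *)
Lemma quad_semi_ip_ge0 (a b c : R) f g : (forall p q, 0 <= quad a b c p q) ->
  0 <= a * B f f + 2 * b * B f g + c * B g g.
Proof.
move=> H.
have a0 : 0 <= a by rewrite (_ : a = quad a b c 1 0) ?H// /quad; ring.
have c0 : 0 <= c by rewrite (_ : c = quad a b c 0 1) ?H// /quad; ring.
have gg := semi_ip_ge0 g.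
have [a00|ann] := eqVneq a 0.
  have -> : b = 0.
    have := H (- (c + 1) / b) 1; rewrite /quad a00.
    have [//|b0] := eqVneq b 0.
    have -> : 0 * (- (c + 1) / b) ^+ 2 + 2 * b * (- (c + 1) / b) * 1 + c * 1 ^+ 2
      = - (c + 2) by field.
    by move=> ?; exfalso; lra.
  by rewrite a00 mulr0 !mul0r !add0r mulr_ge0.
have ap : 0 < a by rewrite lt_def ann.
rewrite -(pmulr_rge0 _ ap).
have disc : 0 <= a * c - b ^+ 2.
  rewrite -(pmulr_rge0 _ ap).
  by rewrite [X in _ <= X](_ : _ = quad a b c (- b) a) ?H// /quad; ring.
have := addr_ge0 (semi_ip_ge0 (a *: f + b *: g)) (mulr_ge0 disc gg).
rewrite [X in _ <= X](_ : _ = a * (a * B f f + 2 * b * B f g + c * B g g)) //.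
by rewrite !semi_ipE (semi_ipC g f); ring.
Qed.

Definition seminorm f := Num.sqrt (B f f).

Lemma seminorm_ge0 f : 0 <= seminorm f. Proof. exact: sqrtr_ge0. Qed.

Lemma seminorm_sqr f : seminorm f ^+ 2 = B f f.
Proof. by rewrite sqr_sqrtr ?semi_ip_ge0. Qed.

Lemma semi_ip_norm f g : `|B f g| <= seminorm f * seminorm g.
Proof.
rewrite -ler_sqr ?nnegrE ?mulr_ge0 ?seminorm_ge0//.
by rewrite exprMn !seminorm_sqr real_normK ?num_real// semi_ip_CS.
Qed.

Lemma seminormD f g : seminorm (f + g) <= seminorm f + seminorm g.
Proof.
rewrite -ler_sqr ?nnegrE ?addr_ge0 ?seminorm_ge0//.
rewrite sqrrD !seminorm_sqr !semi_ipE (semi_ipC g f).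
have := le_trans (ler_norm _) (semi_ip_norm f g); lra.
Qed.

Lemma seminormZ c f : seminorm (c *: f) = `|c| * seminorm f.
Proof. by rewrite /seminorm semi_ipZl semi_ipZr mulrA -expr2 sqrtrM ?sqr_ge0// sqrtr_sqr. Qed.

Lemma seminormN f : seminorm (- f) = seminorm f.
Proof. by rewrite -scaleN1r seminormZ normrN1 mul1r. Qed.

Lemma seminormB f g : seminorm (f - g) <= seminorm f + seminorm g.
Proof. by rewrite (le_trans (seminormD _ _))// seminormN. Qed.

Lemma seminorm0 : seminorm 0 = 0.
Proof. by rewrite -(scale0r 0) seminormZ normr0 mul0r. Qed.

End Theory.

Lemma seminorm_le B1 B2 f : B1 f f <= B2 f f -> seminorm B1 f <= seminorm B2 f.
Proof. by move=> ?; rewrite /seminorm ler_wsqrtr. Qed.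

End SemiInnerProducts.

Section VectorDerivative.
Variables (R : realType) (V : lmodType R) (ip : V -> V -> R).
Hypothesis hip : semi_ip ip.
Local Notation nrm := (seminorm ip).
Implicit Types (w u v : R -> V) (z : V) (t e : R).

Definition has_derivative w t z := forall e, 0 < e -> exists2 delta : R, 0 < delta &
  forall s, `|s - t| < delta -> nrm (w s - w t - (s - t) *: z) <= e * `|s - t|.

(** The epsilon form compares directly with [has_derivative] and with the local
    hypothesis of [ae_growth]. *)
Lemma is_derive_epsP (f : R -> R) t l : is_derive t 1 f l <->
  forall e, 0 < e -> exists2 delta : R, 0 < delta &
  forall s, `|s - t| < delta -> `|f s - f t - (s - t) * l| <= e * `|s - t|.
Proof.
split.
  move=> [dl Dl] e e0; move: dl; rewrite /derivable => /cvg_ex [l' Hl].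
  have El : l' = l by rewrite -Dl; apply/esym; exact: (cvg_lim _ Hl).
  move: Hl; rewrite {}El => /cvgrPdist_le /(_ _ e0).
  move=> [d /= d0 H]; exists d => // s sd.
  have [->|st] := eqVneq s t; first by rewrite !subrr mul0r subr0 !normr0 mulr0.
  have st0 : s - t != 0 by rewrite subr_eq0.
  have := H (s - t); rewrite /ball_ /= sub0r normrN => /(_ sd st0).
  rewrite /GRing.scale /= mulr1 subrK => Hs.
  rewrite -(ler_pM2r (_ : 0 < `|s - t|^-1)) ?invr_gt0 ?normr_gt0// mulfK ?normr_eq0//.
  rewrite -normfV -normrM; apply: le_trans Hs.
  by rewrite distrC le_eqVlt; apply/orP; left; apply/eqP; congr `|_|; field.
move=> H.
have cv : h^-1 *: (f (h *: 1 + t) - f t) @[h --> 0^'] --> l.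
  apply/cvgrPdist_le => e e0; have [d d0 Hd] := H e e0.
  exists d => //= h /=; rewrite sub0r normrN => hd h0.
  have := Hd (h + t); rewrite addrK => /(_ hd) Hh.
  rewrite /GRing.scale /= mulr1.
  rewrite -(ler_pM2r (_ : 0 < `|h|)) ?normr_gt0// -normrM.
  apply: le_trans Hh; rewrite -normrN le_eqVlt; apply/orP; left; apply/eqP.
  by congr `|_|; field.
apply: DeriveDef; last exact: cvg_lim.
by apply/cvg_ex; exists l.
Qed.

Lemma has_derivative_lip w t z : has_derivative w t z ->
  exists2 delta : R, 0 < delta & forall s, `|s - t| < delta ->
    nrm (w s - w t) <= (nrm z + 1) * `|s - t|.
Proof.
move=> /(_ 1 ltr01) [d d0 H]; exists d => // s sd.
have -> : w s - w t = (w s - w t - (s - t) *: z) + (s - t) *: z by rewrite subrK.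
apply: le_trans (seminormD hip _ _) _; rewrite (seminormZ hip).
by have := H s sd; lra.
Qed.

Lemma has_derivative_straddle w t z e : has_derivative w t z -> 0 < e ->
  exists2 delta : R, 0 < delta & forall x y, x <= t <= y -> y - x < delta ->
    nrm (w y - w x) <= (nrm z + e) * (y - x).
Proof.
move=> hw e0; have [d d0 H] := hw e e0; exists d => // x y /andP[xt ty] yx.
have Hy : nrm (w y - w t - (y - t) *: z) <= e * (y - t).
  by have := H y; rewrite ger0_norm ?subr_ge0//; apply; lra.
have Hx : nrm (w x - w t - (x - t) *: z) <= e * (t - x).
  by have := H x; rewrite distrC ger0_norm ?subr_ge0//; apply; lra.
have -> : w y - w x = (w y - w t - (y - t) *: z) - (w x - w t - (x - t) *: z)
   + (y - x) *: z.
  have -> : y - x = (y - t) - (x - t) by ring.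
  rewrite (scalerBl (y - t)) [RHS]addrACA -opprD !subrK.
  by rewrite opprB addrA subrK.
apply: le_trans (seminormD hip _ _) _; rewrite (seminormZ hip) ger0_norm; last lra.
by have := seminormB hip (w y - w t - (y - t) *: z) (w x - w t - (x - t) *: z); lra.
Qed.

Lemma is_derive_semi_ip (B : V -> V -> R) u v t du dv :
  semi_ip B -> (forall f, B f f <= ip f f) ->
  has_derivative u t du -> has_derivative v t dv ->
  is_derive t 1 (fun s => B (u s) (v s)) (B du (v t) + B (u t) dv).
Proof.
move=> hB Ble hu hv; apply/is_derive_epsP => e e0.
have Bn f g : `|B f g| <= nrm f * nrm g.
  apply: le_trans (semi_ip_norm hB f g) _.
  by apply: ler_pM; rewrite ?seminorm_ge0 ?seminorm_le.
pose M := nrm (u t) + nrm (v t) + nrm du + nrm dv + 1.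
have [nu nv ndu ndv] := And4 (seminorm_ge0 ip (u t)) (seminorm_ge0 ip (v t))
  (seminorm_ge0 ip du) (seminorm_ge0 ip dv).
have M1 : 1 <= M by rewrite /M; lra.
have M0 : 0 < M by lra.
pose e1 := e / (4 * M).
have e10 : 0 < e1 by rewrite divr_gt0// mulr_gt0.
have e1M : e1 * M = e / 4 by rewrite /e1; field; rewrite lt0r_neq0.
have [d1 d10 H1] := hu e1 e10; have [d2 d20 H2] := hv e1 e10.
have [d3 d30 H3] := has_derivative_lip hv.
pose d4 := e / (4 * M ^+ 2).
have d40 : 0 < d4 by rewrite divr_gt0// mulr_gt0// exprn_gt0.
have d4M : d4 * M ^+ 2 = e / 4 by rewrite /d4; field; rewrite lt0r_neq0.
exists (Num.min (Num.min d1 d2) (Num.min (Num.min d3 d4) 1)).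
  by rewrite !lt_min d10 d20 d30 d40 ltr01.
move=> s; rewrite !lt_min => /andP[/andP[s1 s2] /andP[/andP[s3 s4] s5]].
have {}H1 := H1 s s1; have {}H2 := H2 s s2; have {}H3 := H3 s s3.
set r := `|s - t| in s1 s2 s3 s4 s5 H1 H2 H3 *.
have r0 : 0 <= r by exact: normr_ge0.
set X := u s - u t - _ in H1; set Y := v s - v t - _ in H2.
have vs : nrm (v s) <= 2 * M.
  have -> : v s = v t + (v s - v t) by rewrite addrC subrK.
  apply: le_trans (seminormD hip _ _) _.
  have : (nrm dv + 1) * r <= (nrm dv + 1) * 1.
    by apply: ler_wpM2l; [lra|exact: ltW].
  by rewrite /M; lra.
have -> : B (u s) (v s) - B (u t) (v t) - (s - t) * (B du (v t) + B (u t) dv) =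
   B X (v s) + (s - t) * B du (v s - v t) + B (u t) Y.
  by rewrite /X /Y !(semi_ipE hB); ring.
have b1 : `|B X (v s)| <= e1 * r * (2 * M).
  by apply: le_trans (Bn _ _) _; apply: ler_pM; rewrite ?seminorm_ge0.
have b2 : `|(s - t) * B du (v s - v t)| <= r * (M * (M * d4)).
  rewrite normrM -/r; apply: ler_wpM2l => //.
  apply: le_trans (Bn _ _) _; apply: ler_pM; rewrite ?seminorm_ge0//.
    by rewrite /M; lra.
  apply: le_trans H3 _; apply: ler_pM; rewrite ?addr_ge0 ?seminorm_ge0//; last exact: ltW.
  by rewrite /M; lra.
have b3 : `|B (u t) Y| <= M * (e1 * r).
  by apply: le_trans (Bn _ _) _; apply: ler_pM; rewrite ?seminorm_ge0// /M; lra.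
apply: le_trans (ler_normD _ _) _; apply: le_trans (lerD (ler_normD _ _) (lexx _)) _.
have E1 : e1 * r * (2 * M) = r * (e / 2).
  by rewrite (_ : e1 * r * (2 * M) = r * (2 * (e1 * M))); [rewrite e1M; field|ring].
have E2 : r * (M * (M * d4)) = r * (e / 4) by rewrite -d4M; ring.
have E3 : M * (e1 * r) = r * (e / 4) by rewrite -e1M; ring.
rewrite E1 in b1; rewrite E2 in b2; rewrite E3 in b3; lra.
Qed.

End VectorDerivative.

(** * Approximate spectral windows of a positive contraction *)

Section PolynomialCalculus.
Variables (R : realType) (V : lmodType R) (ip : V -> V -> R).
Hypothesis hip : semi_ip ip.
Variable P : {linear V -> V}.
Hypothesis P_selfadj : forall f g, ip (P f) g = ip f (P g).
Implicit Types (f g h : V) (p q b : {poly R}) (n k : nat).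

(** The number <p(P) f, g>; only this scalar, linear in [p], is ever needed, and
    not p(P) itself. *)
Definition ipoly f g p : R := \sum_(i < size p) p`_i * ip (iter i P f) g.

Lemma ipoly_widen n f g p : (size p <= n)%N ->
  ipoly f g p = \sum_(i < n) p`_i * ip (iter i P f) g.
Proof.
move=> pn; rewrite /ipoly (big_ord_widen n (fun i => p`_i * ip (iter i P f) g) pn).
rewrite big_mkcond /=; apply: eq_bigr => i _.
by case: ltnP => // ?; rewrite nth_default ?mul0r.
Qed.

Lemma ipolyD f g p q : ipoly f g (p + q) = ipoly f g p + ipoly f g q.
Proof.
pose n := maxn (size p) (size q).
rewrite !(@ipoly_widen n) ?size_polyD ?leq_maxl ?leq_maxr// -big_split /=.
by apply: eq_bigr => i _; rewrite coefD mulrDl.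
Qed.

Lemma ipolyZ f g (c : R) p : ipoly f g (c *: p) = c * ipoly f g p.
Proof.
rewrite !(@ipoly_widen (size p)) ?size_scale_leq// mulr_sumr.
by apply: eq_bigr => i _; rewrite coefZ mulrA.
Qed.

Lemma ipoly0 f g : ipoly f g 0 = 0.
Proof. by rewrite /ipoly size_poly0 big_ord0. Qed.

Lemma ipoly_sum f g I (r : seq I) (F : I -> {poly R}) :
  ipoly f g (\sum_(i <- r) F i) = \sum_(i <- r) ipoly f g (F i).
Proof.
by elim/big_rec2: _ => [|i x y _ <-]; rewrite ?ipoly0 ?ipolyD.
Qed.

Lemma ipolyN f g p : ipoly f g (- p) = - ipoly f g p.
Proof. by rewrite -scaleN1r ipolyZ mulN1r. Qed.

Lemma ipoly1 f g : ipoly f g 1 = ip f g.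
Proof. by rewrite /ipoly size_poly1 big_ord1 /= coef1 mul1r. Qed.

Lemma ipolyXM f g p : ipoly f g ('X * p) = ipoly (P f) g p.
Proof.
rewrite (@ipoly_widen (size p).+1); last first.
  by rewrite (leq_trans (size_polyMleq _ _))// size_polyX.
rewrite big_ord_recl coefXM eqxx mul0r add0r; apply: eq_bigr => i _.
by rewrite lift0 coefXM /= -iterS iterSr.
Qed.

Lemma ipolyX f g : ipoly f g 'X = ip (P f) g.
Proof. by rewrite -['X]mulr1 ipolyXM ipoly1. Qed.

Lemma iter_selfadj i f g : ip (iter i P f) g = ip f (iter i P g).
Proof. by elim: i g => //= i IH g; rewrite P_selfadj IH -iterSr. Qed.

Lemma ipolyC f g p : ipoly f g p = ipoly g f p.
Proof.
by apply: eq_bigr => i _; rewrite iter_selfadj (semi_ipC hip).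
Qed.

Lemma ipoly_addl f g h p : ipoly (f + g) h p = ipoly f h p + ipoly g h p.
Proof.
rewrite /ipoly -big_split; apply: eq_bigr => i _ /=.
have -> : iter i P (f + g) = iter i P f + iter i P g.
  by elim: (i : nat) => //= j ->; rewrite linearD.
by rewrite (semi_ipDl hip) mulrDr.
Qed.

Lemma ipoly_scalel (c : R) f g p : ipoly (c *: f) g p = c * ipoly f g p.
Proof.
rewrite /ipoly mulr_sumr; apply: eq_bigr => i _ /=.
have -> : iter i P (c *: f) = c *: iter i P f.
  by elim: (i : nat) => //= j ->; rewrite linearZ.
by rewrite (semi_ipZl hip) mulrCA.
Qed.

Lemma ipoly_sqr f (c : R) b :
  ipoly f f (('X - c%:P) ^+ 2 * b) = ipoly (c *: f - P f) (c *: f - P f) b.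
Proof.
have -> : ('X - c%:P) ^+ 2 * b =
    'X * ('X * b) + (- 2 * c) *: ('X * b) + c ^+ 2 *: b.
  rewrite -!mul_polyC polyCM polyCN rmorphXn /= (_ : 2%:P = 2) ?rmorph_nat//.
  by ring.
have addr f1 g1 h1 : ipoly f1 (g1 + h1) b = ipoly f1 g1 b + ipoly f1 h1 b.
  by rewrite ipolyC ipoly_addl !(ipolyC _ f1).
have scaler d f1 g1 : ipoly f1 (d *: g1) b = d * ipoly f1 g1 b.
  by rewrite ipolyC ipoly_scalel ipolyC.
rewrite -(scaleN1r (P f)) !(ipoly_addl, addr, ipoly_scalel, scaler) (ipolyC f (P f)).
have PP : ipoly (P f) (P f) b = ipoly (P (P f)) f b.
  by rewrite -ipolyXM ipolyC ipolyXM.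
by rewrite !ipolyD !ipolyZ !ipolyXM PP; ring.
Qed.

Hypothesis monomials_ge0 :
  forall k n f, 0 <= ipoly f f ('X^k * (1 - 'X) ^+ n).

(** The part of the inner product carried by frequencies near k/n. *)
Definition window n k f g := ipoly f g (bernstein R n k).

Lemma window_semi_ip n k : semi_ip (window n k).
Proof.
split.
- by move=> f g; exact: ipolyC.
- by move=> f g h; exact: ipoly_addl.
- by move=> c f g; exact: ipoly_scalel.
- by move=> f; rewrite /window ipolyZ mulr_ge0.
Qed.

Lemma sum_window n f g : \sum_(k < n.+1) window n k f g = ip f g.
Proof. by rewrite -ipoly1 -(sum_bernstein R n) ipoly_sum. Qed.

Lemma sum_window_freq n f g : (0 < n)%N ->
  \sum_(k < n.+1) k%:R / n%:R * window n k f g = ip (P f) g.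
Proof.
move=> n0; rewrite -ipolyX.
have -> : 'X = n%:R^-1 *: (n%:R *: 'X) :> {poly R}.
  by rewrite scalerA mulVf ?scale1r// pnatr_eq0 -lt0n.
rewrite -sum_bernstein_deg1 ipolyZ ipoly_sum mulr_sumr.
by apply: eq_bigr => k _; rewrite ipolyZ mulrA (mulrC n%:R^-1).
Qed.

Lemma window_le n k f : (k < n.+1)%N -> window n k f f <= ip f f.
Proof.
move=> kn; rewrite -(sum_window n) (bigD1 (Ordinal kn)) //= lerDl sumr_ge0// => j _.
exact: (semi_ip_ge0 (window_semi_ip _ _)).
Qed.

(** 1 - X^2 = (1 - X) + X (1 - X) is a sum of positive monomials. *)
Lemma ip_contraction f : ip (P f) (P f) <= ip f f.
Proof.
rewrite -P_selfadj -!ipolyX -ipolyXM -[X in _ <= X]ipoly1 -subr_ge0 -ipolyN -ipolyD.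
have := addr_ge0 (monomials_ge0 0 1 f) (monomials_ge0 1 1 f).
rewrite -ipolyD; congr (0 <= ipoly _ _ _).
by rewrite expr0 !expr1; ring.
Qed.

(** Summed over the windows, replacing P by k/n costs O(n^(-1/2)) in norm. *)
Lemma window_variance n f : (0 < n)%N ->
  \sum_(k < n.+1) window n k ((k%:R / n%:R) *: f - P f) ((k%:R / n%:R) *: f - P f)
  <= n%:R^-1 * ip f f.
Proof.
move=> n0.
rewrite (eq_bigr (fun k : 'I_n.+1 =>
    ipoly f f (('X - (k%:R / n%:R)%:P) ^+ 2 * bernstein R n k))); last first.
  by move=> k _; rewrite ipoly_sqr.
rewrite -ipoly_sum bernstein_variance// ipolyZ ler_wpM2l ?invr_ge0//.
rewrite -[X in _ <= X]ipoly1 -subr_ge0 -ipolyN -ipolyD.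
have := addr_ge0 (monomials_ge0 0 1 f) (monomials_ge0 2 0 f).
rewrite -ipolyD; congr (0 <= ipoly _ _ _).
by rewrite !expr0 !expr1; ring.
Qed.

End PolynomialCalculus.

(** * From scalar Lyapunov forms to the operator equation *)

Section Transfer.
Variable R : realType.
Local Notation mu := (@lebesgue_measure R).

(** The coefficients of the form obtained by differentiating
    A p^2 + 2 B p q + G q^2 along p' = - w q, q' = p. *)
Definition rate (w A B G dA dB dG p q : R) : R :=
  quad (dA + 2 * B) (dB + G - A * w) (dG - 2 * B * w) p q.

Definition dissipative (a : R -> R) (ell : R) (A B G : R -> R) (t : R) : Prop :=
  exists dA dB dG : R, [/\ is_derive t 1 A dA, is_derive t 1 B dB,
    is_derive t 1 G dG & forall p q,
    rate (a t ^+ 2 * ell) (A t) (B t) (G t) dA dB dG p q <= 0].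

(** Here [ell] is the squared frequency.  The constants [c1] and [c2] may be
    negative, so that the same notion expresses increasing forms.  The Lipschitz
    bound is one-sided to admit downward jumps, and t = 0 is left out so that only
    two-sided derivatives occur. *)
Definition lyapunov (a : R -> R) (ell c1 c2 : R) (A B G : R -> R) : Prop :=
  [/\ forall t p q : R, 0 < t ->
        c1 * (p ^+ 2 + ell * q ^+ 2) <= quad (A t) (B t) (G t) p q <=
        c2 * (p ^+ 2 + ell * q ^+ 2),
      exists K, forall s t p q : R, 0 < s -> s <= t ->
        quad (A t) (B t) (G t) p q - quad (A s) (B s) (G s) p q <=
        K * (t - s) * (p ^+ 2 + q ^+ 2) &
      {ae mu, forall t : R, 0 < t -> dissipative a ell A B G t}].

Lemma lip_abs_cont (psi : R -> R -> R) (a b K : R) :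
  (forall x y, a <= x -> x <= y -> y <= b -> psi x y <= K * (y - x)) ->
  abs_cont psi a b.
Proof.
move=> H e e0; exists (e / (`|K| + 1)); first by rewrite divr_gt0// ltr_wpDl.
move=> s cs; rewrite ltr_pdivlMr ?ltr_wpDl// => le.
have [l0 bound] : 0 <= \sum_(p <- s) (p.2 - p.1) /\
    \sum_(p <- s) psi p.1 p.2 <= K * \sum_(p <- s) (p.2 - p.1).
  suff aux x : a <= x -> chain x b s -> 0 <= \sum_(p <- s) (p.2 - p.1) /\
    \sum_(p <- s) psi p.1 p.2 <= K * \sum_(p <- s) (p.2 - p.1) by exact: (aux a).
  elim: s x {le cs} => [|p s IH] x ax /=; first by rewrite !big_nil mulr0.
  move=> [xp pp cs]; rewrite !big_cons.
  have [h1 h2] := IH p.2 (le_trans (le_trans ax xp) (ltW pp)) cs.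
  have := H p.1 p.2 (le_trans ax xp) (ltW pp) (chain_le cs).
  by split; lra.
apply: le_trans bound _; apply: le_trans (ltW le); rewrite mulrC ler_wpM2l//.
by rewrite (le_trans (ler_norm K))// lerDl.
Qed.

Lemma lyapunov_bound a ell c1 c2 A B G (Lam : R) :
  0 <= ell <= Lam -> lyapunov a ell c1 c2 A B G -> forall t, 0 < t ->
  let K := (`|c1| + `|c2|) * (1 + Lam) in [/\ `|A t| <= K, `|B t| <= K & `|G t| <= K].
Proof.
move=> /andP[l0 lL] [H _ _] t t0; set c := `|c1| + `|c2| => K.
have c0 : 0 <= c by rewrite addr_ge0.
have Q p q : `|quad (A t) (B t) (G t) p q| <= c * (p ^+ 2 + ell * q ^+ 2).
  have /andP[h1 h2] := H t p q t0.
  have e0 : 0 <= p ^+ 2 + ell * q ^+ 2 by rewrite addr_ge0 ?sqr_ge0// mulr_ge0 ?sqr_ge0.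
  set E := p ^+ 2 + _ in h1 h2 e0 *.
  have : - (`|c1| * E) <= c1 * E by rewrite -mulNr ler_wpM2r//; have := ler_norm (- c1); rewrite normrN; lra.
  have : c2 * E <= `|c2| * E by rewrite ler_wpM2r// ler_norm.
  have : 0 <= `|c1| * E by rewrite mulr_ge0.
  have : 0 <= `|c2| * E by rewrite mulr_ge0.
  by rewrite ler_norml /c; move=> *; apply/andP; split; lra.
have cl : 0 <= c * ell by rewrite mulr_ge0.
have cL : c * ell <= c * Lam by rewrite ler_wpM2l.
split.
- have := Q 1 0; rewrite /quad expr1n expr0n /= !mulr0 !addr0 !mulr1.
  by rewrite /K; lra.
- have := Q 1 1; have := Q 1 (-1); rewrite /quad sqrrN !expr1n !mulr1 mulrN1.
  rewrite !ler_norml => /andP[? ?] /andP[? ?]; apply/andP; rewrite /K; split; lra.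
- have := Q 0 1; rewrite /quad expr1n expr0n /= !mulr0 mul0r !add0r !mulr1.
  by rewrite /K; lra.
Qed.

Variables (V : lmodType R) (ip : V -> V -> R).
Hypothesis hip : semi_ip ip.
Variable P : {linear V -> V}.
Hypothesis P_selfadj : forall f g, ip (P f) g = ip f (P g).
Hypothesis monomials_ge0 :
  forall k n f, 0 <= ipoly ip P f f ('X^k * (1 - 'X) ^+ n).
Local Notation nrm := (seminorm ip).
Local Notation W n k := (window ip P n k).

Variables (a : R -> R) (a1 Lam : R) (u v : R -> V).
Hypothesis a_bound : forall t : R, 0 < t -> `|a t| <= a1.
Hypothesis Lam_ge0 : 0 <= Lam.
Hypothesis u_derive : forall t : R, 0 < t -> has_derivative ip u t (v t).
Hypothesis v_abs_cont : forall T : R, 0 < T -> abs_cont (fun x y => nrm (v y - v x)) 0 T.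
Hypothesis v_derive : {ae mu, forall t : R, 0 < t ->
  has_derivative ip v t (- (a t ^+ 2 * Lam) *: P (u t))}.

Let energy t := ip (v t) (v t) + Lam * ip (P (u t)) (u t).

Lemma trajectory_bounded (s T : R) : 0 < s -> s <= T ->
  exists2 M : R, 0 <= M & forall t : R, s <= t <= T -> nrm (u t) <= M /\ nrm (v t) <= M.
Proof.
move=> s0 sT.
pose bounded_on x y := exists M, forall t, x <= t <= y ->
  nrm (u t) <= M /\ nrm (v t) <= M.
suff [M HM] : bounded_on s T.
  exists M => //.
  have [|h _] := HM s; first by rewrite lexx.
  exact: le_trans (seminorm_ge0 _ _) h.
apply: (@interval_gluing _ bounded_on) => //.
  move=> x y z xy yz [M1 H1] [M2 H2]; exists (Num.max M1 M2) => t /andP[xt tz].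
  have [ty|yt] := leP t y.
    by have [|h1 h2] := H1 t; rewrite ?xt// !le_max h1 h2.
  have [|h1 h2] := H2 t; first by rewrite tz ltW.
  by rewrite !le_max h1 h2 !orbT.
move=> t /andP[st tT]; have t0 : 0 < t by exact: lt_le_trans st.
have [d1 d10 H1] := has_derivative_lip hip (u_derive t0).
have [d2 d20 H2] := v_abs_cont (lt_le_trans s0 sT) ltr01.
have bv x y : 0 <= x -> x <= y -> y <= T -> y - x < d2 -> nrm (v y - v x) <= 1.
  move=> x0 xy yT yx; have [xy'|yx'] := ltP x y; last first.
    have -> : x = y by apply/eqP; rewrite eq_le xy.
    by rewrite subrr seminorm0.
  by have := H2 [:: (x, y)]; rewrite !big_seq1 /=; apply.
exists (Num.min d1 d2); first by rewrite lt_min d10.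
move=> x y /andP[sx xt] /andP[ty yT]; rewrite lt_min => /andP[yx1 yx2].
exists (Num.max (nrm (u t) + (nrm (v t) + 1) * d1) (nrm (v t) + 1)) => r /andP[xr ry].
have rt : `|r - t| < d1 by rewrite ltr_norml; apply/andP; split; lra.
split; rewrite le_max.
  apply/orP; left; rewrite -[u r](subrK (u t)) addrC.
  apply: le_trans (seminormD hip _ _) _; rewrite lerD2l.
  apply: le_trans (H1 r rt) _; rewrite ler_wpM2l ?addr_ge0 ?seminorm_ge0//.
  exact: ltW.
apply/orP; right; rewrite -[v r](subrK (v t)) addrC.
apply: le_trans (seminormD hip _ _) _; rewrite lerD2l.
have [rt'|tr'] := leP r t.
  rewrite -(seminormN hip) opprB; apply: bv => //; lra.
by apply: bv; lra.
Qed.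

(** The operator is bounded, hence so is v' wherever it exists; [ae_growth] turns
    this into a Lipschitz bound, and from here on absolute continuity is
    automatic. *)
Lemma trajectory_lipschitz (s T M : R) : 0 < s -> s <= T -> 0 <= M ->
  (forall t : R, s <= t <= T -> nrm (u t) <= M /\ nrm (v t) <= M) ->
  exists2 L : R, 0 <= L & forall x y : R, s <= x -> x <= y -> y <= T ->
    nrm (u y - u x) <= L * (y - x) /\ nrm (v y - v x) <= L * (y - x).
Proof.
move=> s0 sT M0 HM.
have tri (w : R -> V) x y z : nrm (w z - w x) <= nrm (w y - w x) + nrm (w z - w y).
  have -> : w z - w x = (w y - w x) + (w z - w y) by rewrite [RHS]addrC addrA subrK.
  exact: seminormD.
have Lu x y : s <= x -> x <= y -> y <= T -> nrm (u y - u x) <= M * (y - x).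
  move=> sx xy yT; apply/ler_addgt0Pr => e e0.
  have c0 : 0 < y - x + 1 by lra.
  apply: (@le_trans _ _ ((M + e / (y - x + 1)) * (y - x))); last first.
    rewrite mulrDl lerD2l mulrAC ler_pdivrMr// ler_wpM2l ?(ltW e0)//; lra.
  set e' := e / _; have e'0 : 0 < e' by rewrite divr_gt0.
  apply: (@interval_gluing _ (fun x y => nrm (u y - u x) <= (M + e') * (y - x))) => //.
    by move=> x1 y1 z1 _ _ h1 h2; apply: le_trans (tri u x1 y1 z1) _; lra.
  move=> t /andP[xt ty].
  have [d d0 H] := has_derivative_straddle hip (u_derive (lt_le_trans s0 (le_trans sx xt))) e'0.
  exists d => // x1 y1 /andP[xx1 x1t] /andP[ty1 y1y] yx.
  apply: le_trans (H x1 y1 _ yx) _; first by rewrite x1t.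
  rewrite ler_wpM2r; [by []|lra|].
  by rewrite lerD2r; apply: (HM t _).2; apply/andP; split; lra.
pose L := a1 ^+ 2 * Lam * M.
have a10 : 0 <= a1 by exact: le_trans (normr_ge0 _) (a_bound s0).
have L0 : 0 <= L by rewrite !mulr_ge0// exprn_ge0.
have Lv x y : s <= x -> x <= y -> y <= T -> nrm (v y - v x) <= L * (y - x).
  move=> sx xy yT.
  apply: (@ae_growth _ (fun x y => nrm (v y - v x))) => //.
  - by move=> z; rewrite subrr seminorm0.
  - move=> e e0; have [d d0 H] := v_abs_cont (lt_le_trans s0 sT) e0.
    exists d => // c cc; apply: H.
    have widen z1 z2 b1 b2 c1 : z2 <= z1 -> b1 <= b2 -> chain z1 b1 c1 -> chain z2 b2 c1.
      elim: c1 z1 z2 => [|p c1 IH] z1 z2 /= zz bb; first by move=> ?; lra.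
      by move=> [? ? h]; split; [lra|by []|exact: (IH p.2)].
    by apply: widen cc; lra.
  - apply: ae_mono v_derive => t Ht /andP[xt ty] e e0.
    have t0 : 0 < t by lra.
    have [d d0 H] := has_derivative_straddle hip (Ht t0) e0.
    exists d => // x1 y1 /andP[xx1 x1t] /andP[ty1 y1y] yx.
    apply: le_trans (H x1 y1 _ yx) _; first by rewrite x1t.
    rewrite ler_wpM2r//; first lra.
    rewrite lerD2r (seminormZ hip) normrN normrM normrX (ger0_norm Lam_ge0).
    rewrite ler_pM ?mulr_ge0 ?seminorm_ge0 ?exprn_ge0//.
      by rewrite ler_wpM2r// lerXn2r ?nnegrE// a_bound.
    apply: le_trans (HM t _).1; last by apply/andP; split; lra.
    by rewrite /seminorm ler_wsqrtr// ip_contraction.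
exists (M + L); first exact: addr_ge0.
move=> x y sx xy yT; have xy0 : 0 <= y - x by rewrite subr_ge0.
split; rewrite mulrDl.
  by apply: le_trans (Lu _ _ sx xy yT) _; rewrite lerDl mulr_ge0.
by apply: le_trans (Lv _ _ sx xy yT) _; rewrite lerDr mulr_ge0.
Qed.

(** Used with n = (j+1)^2 windows, whose error is of order 1/(j+1). *)
Lemma bounded_by_averages (x C : R) :
  (forall j : nat, x <= C / j.+1%:R) -> x <= 0.
Proof.
move=> H; apply/ler_addgt0Pr => e e0; rewrite add0r.
pose j := Num.truncn (`|C| / e).
have Cj : `|C| / e < j.+1%:R by rewrite truncnS_gt.
apply: le_trans (H j) _; rewrite ler_pdivrMr ?ltr0n//.
apply: le_trans (ler_norm _) _.
by rewrite mulrC -ler_pdivrMr// ltW.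
Qed.

Section Family.
Variables (c1 c2 s T : R) (n : nat).
Hypotheses (s0 : 0 < s) (sT : s <= T) (n0 : (0 < n)%N).
Let x (k : 'I_n.+1) : R := k%:R / n%:R.
Variables A B G : 'I_n.+1 -> R -> R.
Hypothesis lyap : forall k, lyapunov a (Lam * x k) c1 c2 (A k) (B k) (G k).

Let x01 k : 0 <= x k <= 1.
Proof.
by rewrite /x divr_ge0//= ler_pdivrMr ?ltr0n// mul1r ler_nat -ltnS.
Qed.

Definition lyapunov_term k t : R := A k t * W n k (v t) (v t) +
  2 * B k t * W n k (v t) (u t) + G k t * W n k (u t) (u t).

(** The k-th scalar form evaluated on the k-th window, at squared frequency
    Lam k/n. *)
Definition lyapunov_sum t := \sum_(k < n.+1) lyapunov_term k t.

Let energyE c t : c * energy t =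
  \sum_(k < n.+1) (c * W n k (v t) (v t) + 2 * 0 * W n k (v t) (u t)
    + c * (Lam * x k) * W n k (u t) (u t)).
Proof.
under eq_bigr => k _ do rewrite mulr0 mul0r addr0 -!mulrA.
rewrite big_split /= -!mulr_sumr -mulrDr; congr (_ * (_ + _ * _)).
  by rewrite sum_window.
by rewrite -(sum_window_freq _ _ _ _ n0); apply: eq_bigr => k _; rewrite mulrA.
Qed.

Lemma lyapunov_sum_ge (t : R) : 0 < t -> c1 * energy t <= lyapunov_sum t.
Proof.
move=> t0; rewrite energyE; apply: ler_sum => k _; rewrite /lyapunov_term; have [H _ _] := lyap k.
have := @quad_semi_ip_ge0 _ _ _ (window_semi_ip hip P_selfadj monomials_ge0 n k)
  (A k t - c1) (B k t) (G k t - c1 * (Lam * x k)) (v t) (u t).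
have posq p q : 0 <= quad (A k t - c1) (B k t) (G k t - c1 * (Lam * x k)) p q.
  by have /andP[h _] := H t p q t0; move: h; rewrite /quad; lra.
by move=> /(_ posq); lra.
Qed.

Lemma lyapunov_sum_le (t : R) : 0 < t -> lyapunov_sum t <= c2 * energy t.
Proof.
move=> t0; rewrite energyE; apply: ler_sum => k _; rewrite /lyapunov_term; have [H _ _] := lyap k.
have := @quad_semi_ip_ge0 _ _ _ (window_semi_ip hip P_selfadj monomials_ge0 n k)
  (c2 - A k t) (- B k t) (c2 * (Lam * x k) - G k t) (v t) (u t).
have posq p q : 0 <= quad (c2 - A k t) (- B k t) (c2 * (Lam * x k) - G k t) p q.
  by have /andP[_ h] := H t p q t0; move: h; rewrite /quad; lra.
by move=> /(_ posq); lra.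
Qed.

Variable M : R.
Hypotheses (M0 : 0 <= M)
  (HM : forall t : R, s <= t <= T -> nrm (u t) <= M /\ nrm (v t) <= M).
Let K0 : R := (`|c1| + `|c2|) * (1 + Lam).

Let K00 : 0 <= K0. Proof. by rewrite mulr_ge0 ?addr_ge0. Qed.

Let coef_bound k (t : R) : 0 < t ->
  [/\ `|A k t| <= K0, `|B k t| <= K0 & `|G k t| <= K0].
Proof.
move=> t0; have /andP[h1 h2] := x01 k.
have ell01 : 0 <= Lam * x k <= Lam by rewrite mulr_ge0//= ler_piMr.
exact: (lyapunov_bound ell01 (lyap k) t0).
Qed.

Let window_norm (k : 'I_n.+1) f g : `|W n k f g| <= nrm f * nrm g.
Proof.
have hW := window_semi_ip hip P_selfadj monomials_ge0 n k.
apply: le_trans (semi_ip_norm hW f g) _.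
apply: ler_pM; rewrite ?seminorm_ge0// seminorm_le//;
  exact: (window_le hip P_selfadj monomials_ge0 _ (ltn_ord k)).
Qed.

Lemma lyapunov_sum_lip : exists K, forall y z : R, s <= y -> y <= z -> z <= T ->
  lyapunov_sum z - lyapunov_sum y <= K * (z - y).
Proof.
have [L L0 HL] := trajectory_lipschitz s0 sT M0 HM.
suff /choice[K HK] : forall k, exists K, forall y z : R, s <= y -> y <= z -> z <= T ->
    lyapunov_term k z - lyapunov_term k y <= K * (z - y).
  exists (\sum_k K k) => y z sy yz zT; rewrite -sumrB mulr_suml.
  by apply: ler_sum => k _; exact: HK.
move=> k; rewrite /lyapunov_term.
have [_ [K HK] _] := lyap k; have hW := window_semi_ip hip P_selfadj monomials_ge0 n k.
exists (`|K| * (2 * M ^+ 2) + 8 * (K0 * L * M)) => y z sy yz zT.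
have y0 : 0 < y := lt_le_trans s0 sy.
have zy : 0 <= z - y by lra.
have [bA bB bG] := coef_bound k y0.
have [uz vz] : nrm (u z) <= M /\ nrm (v z) <= M by apply: HM; apply/andP; split; lra.
have [uy vy] : nrm (u y) <= M /\ nrm (v y) <= M by apply: HM; apply/andP; split; lra.
have [Lu Lv] := HL y z sy yz zT.
have WM f g Mf Mg : nrm f <= Mf -> nrm g <= Mg -> `|W n k f g| <= Mf * Mg.
  move=> hf hg; apply: le_trans (window_norm k f g) _.
  by apply: ler_pM; rewrite ?seminorm_ge0.
have diff c f1 g1 f2 g2 : `|c| <= K0 -> nrm f1 <= M -> nrm g2 <= M ->
    nrm (f2 - f1) <= L * (z - y) -> nrm (g2 - g1) <= L * (z - y) ->
    c * (W n k f2 g2 - W n k f1 g1) <= K0 * (2 * (L * (z - y) * M)).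
  move=> cK h1 h2 h3 h4; apply: le_trans (ler_norm _) _; rewrite normrM.
  apply: ler_pM => //.
  have -> : W n k f2 g2 - W n k f1 g1 = W n k (f2 - f1) g2 + W n k f1 (g2 - g1).
    by rewrite !(semi_ipE hW); ring.
  apply: le_trans (ler_normD _ _) _.
  have := WM _ _ _ _ h3 h2; have := WM _ _ _ _ h1 h4; lra.
have d1 := diff _ _ _ _ _ bA vy vz Lv Lv.
have d2 := diff _ _ _ _ _ bB vy uz Lv Lu.
have d3 := diff _ _ _ _ _ bG uy uz Lu Lu.
have jump : (A k z - A k y) * W n k (v z) (v z) +
    2 * (B k z - B k y) * W n k (v z) (u z) +
    (G k z - G k y) * W n k (u z) (u z) <= `|K| * (z - y) * (2 * M ^+ 2).
  have posq p q : 0 <= quad (K * (z - y) - (A k z - A k y)) (- (B k z - B k y))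
      (K * (z - y) - (G k z - G k y)) p q.
    by have := HK y z p q y0 yz; rewrite /quad; lra.
  have := quad_semi_ip_ge0 hW (v z) (u z) posq.
  have Wv : W n k (v z) (v z) <= M ^+ 2.
    by rewrite expr2 (le_trans (ler_norm _))// WM.
  have Wu : W n k (u z) (u z) <= M ^+ 2.
    by rewrite expr2 (le_trans (ler_norm _))// WM.
  have : K * (z - y) * (W n k (v z) (v z) + W n k (u z) (u z)) <=
      `|K| * (z - y) * (2 * M ^+ 2).
    apply: (@le_trans _ _ (`|K| * (z - y) * (W n k (v z) (v z) + W n k (u z) (u z)))).
      rewrite ler_wpM2r ?addr_ge0 ?(semi_ip_ge0 hW)// ler_wpM2r// ler_norm//.
    by rewrite ler_wpM2l ?mulr_ge0//; lra.
  lra.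
lra.
Qed.

(** On the k-th window v' = - a^2 Lam (k/n) u + g_k with
    g_k = a^2 Lam (k/n - P) u.  The form is dissipative for the first term; the
    second is handled by Young's inequality with parameter [e], and the sum of the
    |g_k|^2 by [window_variance]. *)
Lemma lyapunov_sum_derive : {ae mu, forall t, s <= t <= T -> forall e : R, 0 < e ->
  exists2 D : R, is_derive t 1 lyapunov_sum D &
    D <= e * (4 * K0 ^+ 2 * M ^+ 2) + e^-1 * ((a1 ^+ 2 * Lam) ^+ 2 * (n%:R^-1 * M ^+ 2))}.
Proof.
have aeD := ae_all (fun k => let: And3 _ _ h := lyap k in h).
apply: ae_mono (ae_and aeD v_derive) => t [Ht Hv] /andP[st tT] e e0.
have t0 : 0 < t := lt_le_trans s0 st.
have [ut vt] : nrm (u t) <= M /\ nrm (v t) <= M by apply: HM; rewrite st.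
have {}Hv := Hv t0; have Hu := u_derive t0.
have ipM f : nrm f <= M -> ip f f <= M ^+ 2.
  by move=> h; rewrite -(seminorm_sqr hip) lerXn2r ?nnegrE ?seminorm_ge0.
pose w := a t ^+ 2 * Lam.
pose dv := - w *: P (u t).
have wb : w ^+ 2 <= (a1 ^+ 2 * Lam) ^+ 2.
  have w0 : 0 <= w by rewrite mulr_ge0 ?sqr_ge0.
  have w1 : 0 <= a1 ^+ 2 * Lam by rewrite mulr_ge0 ?sqr_ge0.
  rewrite lerXn2r ?nnegrE//; apply: ler_wpM2r => //.
  rewrite -[X in X <= _]real_normK ?num_real// lerXn2r ?nnegrE//; last exact: a_bound.
  by rewrite (le_trans _ (a_bound t0)).
pose err (k : 'I_n.+1) := e * W n k (A k t *: v t + B k t *: u t) (A k t *: v t + B k t *: u t)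
   + e^-1 * (w ^+ 2 * W n k (x k *: u t - P (u t)) (x k *: u t - P (u t))).
have /choice[D HD] : forall k, exists D : R,
    is_derive t 1 (lyapunov_term k) D /\ D <= err k.
  move=> k; rewrite /lyapunov_term.
  have [dA [dB [dG [DA DB DG diss]]]] := Ht k t0.
  have hW := window_semi_ip hip P_selfadj monomials_ge0 n k.
  have Wle f := window_le hip P_selfadj monomials_ge0 f (ltn_ord k).
  have Dvv := is_derive_semi_ip hip hW Wle Hv Hv.
  have Dvu := is_derive_semi_ip hip hW Wle Hv Hu.
  have Duu := is_derive_semi_ip hip hW Wle Hu Hu.
  eexists; split.
    exact: is_derive_eq.
  rewrite /GRing.scale /=.
  have posq p q : 0 <= quad (- (dA + 2 * B k t)) (- (dB + G k t - A k t * (w * x k)))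
      (- (dG - 2 * B k t * (w * x k))) p q.
    by have := diss p q; rewrite /rate /quad /w; lra.
  have main := quad_semi_ip_ge0 hW (v t) (u t) posq.
  have young := semi_ip_young hW (A k t *: v t + B k t *: u t)
     (w *: (x k *: u t - P (u t))) e0.
  rewrite -/w -/dv.
  rewrite [X in _ <= _ + _ * X](_ : _ =
    w ^+ 2 * W n k (x k *: u t - P (u t)) (x k *: u t - P (u t))) in young; last first.
    by rewrite (semi_ipZl hW) (semi_ipZr hW); ring.
  apply: le_trans young.
  rewrite -subr_ge0; apply: le_trans main _; rewrite -subr_ge0 le_eqVlt; apply/orP; left.
  rewrite eq_sym; apply/eqP; rewrite /dv !(semi_ipE hW) (semi_ipC hW (P (u t))).
  rewrite (semi_ipC hW (u t) (v t)) (semi_ipC hW (P (u t)) (u t)); ring.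
exists (\sum_(k < n.+1) D k).
  have -> : lyapunov_sum = \sum_(k < n.+1) lyapunov_term k.
    by apply/funext => r; rewrite fct_sumE.
  by apply: is_derive_sum => k; exact: (HD k).1.
apply: le_trans (ler_sum _ (fun k _ => (HD k).2)) _.
rewrite big_split /= -!mulr_sumr; apply: lerD.
  apply: ler_wpM2l; first exact: ltW.
  have -> : 4 * K0 ^+ 2 * M ^+ 2 = 2 * K0 ^+ 2 * (M ^+ 2 + M ^+ 2) by ring.
  apply: (@le_trans _ _ (2 * K0 ^+ 2 * (ip (v t) (v t) + ip (u t) (u t)))); last first.
    apply: ler_wpM2l; first by rewrite mulr_ge0 ?sqr_ge0.
    by rewrite lerD// ipM.
  rewrite -!(sum_window ip P n) -big_split /= mulr_sumr; apply: ler_sum => k _.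
  have hW := window_semi_ip hip P_selfadj monomials_ge0 n k.
  have [bA bB _] := coef_bound k t0.
  have := semi_ip_ge0 hW (A k t *: v t - B k t *: u t).
  rewrite !(semi_ipE hW) (semi_ipC hW (u t)).
  have sq c : `|c| <= K0 -> c ^+ 2 <= K0 ^+ 2.
    by move=> h; rewrite -[X in X <= _]real_normK ?num_real// lerXn2r ?nnegrE.
  have := ler_wpM2r (semi_ip_ge0 hW (v t)) (sq _ bA).
  have := ler_wpM2r (semi_ip_ge0 hW (u t)) (sq _ bB).
  rewrite !expr2; lra.
apply: ler_wpM2l; first by rewrite invr_ge0 ltW.
apply: ler_pM => //.
- exact: sqr_ge0.
- apply: sumr_ge0 => k _.
  exact: (semi_ip_ge0 (window_semi_ip hip P_selfadj monomials_ge0 n k)).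
apply: le_trans (window_variance hip P_selfadj monomials_ge0 (u t) n0) _.
by rewrite ler_wpM2l ?invr_ge0// ipM.
Qed.

End Family.

(** With e = 1/(j+1) and n = (j+1)^2 both error terms of [lyapunov_sum_derive] are
    of order 1/(j+1). *)
Theorem energy_transfer (c1 c2 s T : R) : 0 < s -> s <= T ->
  (forall x : R, 0 <= x <= 1 -> exists A B G, lyapunov a (Lam * x) c1 c2 A B G) ->
  c1 * energy T <= c2 * energy s.
Proof.
move=> s0 sT H; rewrite -subr_le0.
have [M M0 HM] := trajectory_bounded s0 sT.
pose K0 : R := (`|c1| + `|c2|) * (1 + Lam).
pose C : R := 4 * K0 ^+ 2 * M ^+ 2 + (a1 ^+ 2 * Lam) ^+ 2 * M ^+ 2.
apply: (@bounded_by_averages _ (C * (T - s))) => j.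
pose n := (j.+1 ^ 2)%N.
have n0 : (0 < n)%N by rewrite expn_gt0.
have /choice[F HF] : forall k : 'I_n.+1, exists F : (R -> R) * (R -> R) * (R -> R),
    lyapunov a (Lam * (k%:R / n%:R)) c1 c2 F.1.1 F.1.2 F.2.
  move=> k.
  have [|A [B [G h]]] := H (k%:R / n%:R); last by exists (A, B, G).
  by rewrite divr_ge0//= ler_pdivrMr ?ltr0n// mul1r ler_nat -ltnS.
pose Phi := lyapunov_sum (fun k => (F k).1.1) (fun k => (F k).1.2) (fun k => (F k).2).
have lo : c1 * energy T <= Phi T by exact: (lyapunov_sum_ge n0 HF (lt_le_trans s0 sT)).
have up : Phi s <= c2 * energy s by exact: (lyapunov_sum_le n0 HF s0).
suff grow : Phi T - Phi s <= C / j.+1%:R * (T - s).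
  by rewrite mulrAC; apply: le_trans grow; apply: lerB.
apply: (@ae_growth _ (fun y z => Phi z - Phi y)) => //.
- apply: divr_ge0 => //; apply: addr_ge0; apply: mulr_ge0; rewrite ?sqr_ge0//.
  by rewrite mulr_ge0 ?sqr_ge0.
- by move=> y; rewrite subrr.
- by move=> y z r *; lra.
- by have [K HK] := lyapunov_sum_lip s0 sT n0 HF M0 HM; exact: lip_abs_cont HK.
apply: ae_mono (lyapunov_sum_derive s0 n0 HF M0 HM) => t Ht st e e0.
have j0 : 0 < j.+1%:R^-1 :> R by rewrite invr_gt0 ltr0n.
have [D HD Dle] := Ht st _ j0.
move/is_derive_epsP : HD => /(_ e e0) [d d0 Hd]; exists d => // y z /andP[sy yt] /andP[tz zT] zy.
have h1 : Phi z - Phi t - (z - t) * D <= e * (z - t).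
  rewrite -[X in _ <= e * X]ger0_norm; last lra.
  by apply: le_trans (ler_norm _) _; apply: Hd; rewrite ger0_norm; lra.
have h2 : - (Phi y - Phi t - (y - t) * D) <= e * (t - y).
  rewrite -[X in _ <= e * X]ger0_norm; last lra.
  rewrite distrC; apply: le_trans (ler_norm _) _; rewrite normrN.
  by apply: Hd; rewrite distrC ger0_norm; lra.
have DC : D <= C / j.+1%:R.
  apply: le_trans Dle _; rewrite le_eqVlt; apply/orP; left; apply/eqP.
  rewrite /C /n natrX -/K0; field.
  by rewrite addrC natr1 pnatr_eq0.
have : (z - y) * D <= (z - y) * (C / j.+1%:R) by rewrite ler_wpM2l//; lra.
move: h1 h2; move: (Phi y) (Phi z) (Phi t) (C / j.+1%:R) => *; lra.
Qed.

End Transfer.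

(** * Lyapunov forms with Lipschitz coefficients *)

Section BoundedLipschitz.
Variable R : realType.
Implicit Types (I : R -> Prop) (f g h : R -> R) (c K : R).

(** Bounded and Lipschitz on [I]: a class closed under products, inverses away
    from zero and exponentials, which bounded or Lipschitz functions alone are
    not. *)
Definition blip I f := exists K : R, 0 <= K /\
  forall s t : R, I s -> I t -> `|f t| <= K /\ `|f t - f s| <= K * `|t - s|.

Lemma blip_cst I c : blip I (fun=> c).
Proof.
exists `|c|; split => // s t _ _; split => //.
by rewrite subrr normr0 mulr_ge0.
Qed.

Lemma blipD I f g : blip I f -> blip I g -> blip I (fun t => f t + g t).
Proof.
move=> [K [K0 H]] [L [L0 J]]; exists (K + L); split; first exact: addr_ge0.
move=> s t Is It; have [h1 h2] := H s t Is It; have [j1 j2] := J s t Is It.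
split; first by apply: le_trans (ler_normD _ _) _; exact: lerD.
have -> : f t + g t - (f s + g s) = (f t - f s) + (g t - g s) by ring.
by rewrite mulrDl; apply: le_trans (ler_normD _ _) _; exact: lerD.
Qed.

Lemma blipM I f g : blip I f -> blip I g -> blip I (fun t => f t * g t).
Proof.
move=> [K [K0 H]] [L [L0 J]]; exists (2 * (K * L)); split.
  by rewrite !mulr_ge0.
move=> s t Is It; have [h1 h2] := H s t Is It; have [j1 j2] := J s t Is It.
have [h3 _] := H t s It Is.
have KL : 0 <= K * L by rewrite mulr_ge0.
split.
  by rewrite normrM; apply: (@le_trans _ _ (K * L)); [exact: ler_pM|lra].
have -> : f t * g t - f s * g s = (f t - f s) * g t + f s * (g t - g s) by ring.
apply: le_trans (ler_normD _ _) _; rewrite !normrM.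
have : `|f t - f s| * `|g t| <= (K * `|t - s|) * L by apply: ler_pM.
have : `|f s| * `|g t - g s| <= K * (L * `|t - s|) by apply: ler_pM.
lra.
Qed.

Lemma blipN I f : blip I f -> blip I (fun t => - f t).
Proof.
move=> hf; have := blipM (blip_cst I (-1)) hf.
by congr (blip I _); apply/funext => t; rewrite mulN1r.
Qed.

Lemma blip_inv I f c : 0 < c -> (forall t, I t -> c <= f t) -> blip I f ->
  blip I (fun t => (f t)^-1).
Proof.
move=> c0 fc [K [K0 H]]; have c1 : 0 <= c^-1 by rewrite invr_ge0 ltW.
have K2 : 0 <= K * c^-1 ^+ 2 by rewrite mulr_ge0 ?sqr_ge0.
exists (c^-1 + K * c^-1 ^+ 2); split; first exact: addr_ge0.
move=> s t Is It; have [_ h2] := H s t Is It.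
have fpos r : I r -> 0 < f r by move=> /fc; exact: lt_le_trans.
have bound r : I r -> `|(f r)^-1| <= c^-1.
  by move=> Ir; rewrite gtr0_norm ?invr_gt0 ?fpos// lef_pV2 ?posrE ?fpos ?fc.
split; first by apply: le_trans (bound t It) _; rewrite lerDl.
have -> : (f t)^-1 - (f s)^-1 = - (f t - f s) * ((f t)^-1 * (f s)^-1).
  by field; rewrite !gt_eqF ?fpos.
rewrite normrM normrN (normrM (f t)^-1).
apply: (@le_trans _ _ (K * `|t - s| * (c^-1 * c^-1))).
  apply: ler_pM => //.
  by apply: ler_pM => //; exact: bound.
by rewrite mulrDl -expr2 mulrAC lerDr mulr_ge0.
Qed.

Lemma expR_lipschitz (x y K : R) : x <= K -> y <= K ->
  `|expR x - expR y| <= expR K * `|x - y|.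
Proof.
wlog yx : x y / y <= x.
  move=> W xK yK; have [/W->//|/ltW /W] := leP y x.
  by rewrite distrC (distrC x); apply.
move=> xK yK; rewrite !ger0_norm ?subr_ge0 ?ler_expR//.
have := expR_ge1Dx (y - x); rewrite expRB => e1.
have e0 : 0 < expR x := expR_gt0 x.
have : expR x * (x - y) <= expR K * (x - y).
  by rewrite ler_wpM2r ?subr_ge0 ?ler_expR.
have : expR x * (1 + (y - x)) <= expR y.
  by move: e1; rewrite ler_pdivlMr// mulrC.
lra.
Qed.

Lemma blip_expR I f : blip I f -> blip I (fun t => expR (f t)).
Proof.
move=> [K [K0 H]]; exists (expR K * (1 + K)); split.
  by rewrite mulr_ge0 ?expR_ge0 ?addr_ge0.
move=> s t Is It; have [h1 h2] := H s t Is It; have [h3 _] := H t s It Is.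
have fK r : `|f r| <= K -> f r <= K by exact/le_trans/ler_norm.
have eK : 0 <= expR K := expR_ge0 K.
split.
  rewrite ger0_norm ?expR_ge0//; apply: (@le_trans _ _ (expR K)).
    by rewrite ler_expR fK.
  by rewrite mulrDr mulr1 lerDl mulr_ge0.
apply: le_trans (expR_lipschitz (fK _ h1) (fK _ h3)) _.
rewrite -mulrA ler_wpM2l//; apply: le_trans h2 _.
by rewrite ler_wpM2r// lerDr.
Qed.

Lemma blip_min I f K c : 0 <= K -> 0 <= c -> (forall t, I t -> 0 <= f t) ->
  (forall s t, I s -> I t -> `|f t - f s| <= K * `|t - s|) ->
  blip I (fun t => Num.min (f t) c).
Proof.
move=> K0 c0 f0 H; exists (K + c); split; first exact: addr_ge0.
move=> s t Is It; have fs := f0 s Is; have ft := f0 t It.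
split.
  rewrite ger0_norm; last by rewrite le_min ft.
  by rewrite ge_min; apply/orP; right; rewrite lerDr.
apply: (@le_trans _ _ `|f t - f s|); last first.
  by apply: le_trans (H s t Is It) _; rewrite ler_wpM2r// lerDl.
have n1 := ler_norm (f t - f s); have n2 := ler_norm (- (f t - f s)).
rewrite normrN in n2; rewrite ler_norml.
by case: (leP (f t) c) => ?; case: (leP (f s) c) => ?; apply/andP; split; lra.
Qed.

Lemma blip_quad I (A B G : R -> R) : blip I A -> blip I B -> blip I G ->
  exists K : R, forall s t p q : R, I s -> I t -> s <= t ->
    `|quad (A t) (B t) (G t) p q - quad (A s) (B s) (G s) p q|
    <= K * (t - s) * (p ^+ 2 + q ^+ 2).
Proof.
move=> [K [K0 HA]] [L [L0 HB]] [M [M0 HG]]; exists (K + L + M) => s t p q Is It st.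
have [_ a1] := HA s t Is It; have [_ b1] := HB s t Is It; have [_ g1] := HG s t Is It.
have ts : 0 <= t - s by rewrite subr_ge0.
rewrite (ger0_norm ts) in a1 b1 g1.
have -> : quad (A t) (B t) (G t) p q - quad (A s) (B s) (G s) p q =
   (A t - A s) * p ^+ 2 + (B t - B s) * (2 * p * q) + (G t - G s) * q ^+ 2.
  by rewrite /quad; ring.
apply: le_trans (ler_normD _ _) _; apply: le_trans (lerD (ler_normD _ _) (lexx _)) _.
have p0 := sqr_ge0 p; have q0 := sqr_ge0 q.
have pq : `|2 * p * q| <= p ^+ 2 + q ^+ 2.
  have := sqr_ge0 (p + q); have := sqr_ge0 (p - q); rewrite sqrrB sqrrD ler_norml.
  by move=> *; apply/andP; split; lra.
rewrite (normrM (A t - A s)) (normrM (B t - B s)) (normrM (G t - G s)).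
rewrite (ger0_norm p0) (ger0_norm q0).
have : `|A t - A s| * p ^+ 2 <= K * (t - s) * (p ^+ 2 + q ^+ 2).
  by apply: ler_pM => //; lra.
have : `|B t - B s| * `|2 * p * q| <= L * (t - s) * (p ^+ 2 + q ^+ 2).
  by apply: ler_pM.
have : `|G t - G s| * q ^+ 2 <= M * (t - s) * (p ^+ 2 + q ^+ 2).
  by apply: ler_pM => //; lra.
lra.
Qed.

Lemma blip_vacuous (I : R -> Prop) (f : R -> R) : (forall t, ~ I t) -> blip I f.
Proof. by move=> nI; exists 0; split => // s t /nI. Qed.

Lemma blip_sum (I : R -> Prop) n (F : 'I_n -> R -> R) :
  (forall j, blip I (F j)) -> blip I (fun t => \sum_(j < n) F j t).
Proof.
move=> HF; elim: n F HF => [|n IH] F HF.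
  have -> : (fun t => \sum_(j < 0) F j t) = (fun=> 0 : R).
    by apply/funext => t; rewrite big_ord0.
  exact: blip_cst.
have -> : (fun t => \sum_(j < n.+1) F j t) =
    (fun t => F ord0 t + \sum_(j < n) F (lift ord0 j) t).
  by apply/funext => t; rewrite big_ord_recl.
by apply: blipD => //; apply: IH.
Qed.

Lemma blip_sub (I J : R -> Prop) (f : R -> R) :
  (forall t, I t -> J t) -> blip J f -> blip I f.
Proof. by move=> IJ [K [K0 H]]; exists K; split => // s t /IJ Js /IJ Jt; exact: H. Qed.

End BoundedLipschitz.

Section SignedLyapunov.
Variable R : realType.
Local Notation mu := (@lebesgue_measure R).
Implicit Types (a A B G h : R -> R) (sg ell c C t : R).

Definition sign sg := sg = 1 \/ sg = -1.

(** [sg = 1] is for decreasing and [sg = -1] for increasing forms; both directions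
    use the same positive form, with opposite exponents. *)
Definition sdissipative a ell sg A B G t : Prop :=
  exists dA dB dG : R, [/\ is_derive t 1 A dA, is_derive t 1 B dB,
    is_derive t 1 G dG & forall p q,
    sg * rate (a t ^+ 2 * ell) (A t) (B t) (G t) dA dB dG p q <= 0].

Definition slyapunov a ell sg c C A B G : Prop :=
  [/\ forall t p q : R, 0 < t ->
        c * (p ^+ 2 + ell * q ^+ 2) <= quad (A t) (B t) (G t) p q <=
        C * (p ^+ 2 + ell * q ^+ 2),
      exists K : R, forall s t p q : R, 0 < s -> s <= t ->
        sg * (quad (A t) (B t) (G t) p q - quad (A s) (B s) (G s) p q) <=
        K * (t - s) * (p ^+ 2 + q ^+ 2) &
      {ae mu, forall t : R, 0 < t -> sdissipative a ell sg A B G t}].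

Lemma slyapunov_decreasing a ell c C A B G :
  slyapunov a ell 1 c C A B G -> lyapunov a ell c C A B G.
Proof.
move=> [H [K J] D]; split => //.
  by exists K => s t p q s0 st; have := J s t p q s0 st; rewrite mul1r.
apply: ae_mono D => t H2 t0; have [dA [dB [dG [h1 h2 h3 h4]]]] := H2 t0.
by exists dA, dB, dG; split => // p q; have := h4 p q; rewrite mul1r.
Qed.

Lemma slyapunov_increasing a ell c C A B G :
  slyapunov a ell (-1) c C A B G ->
  lyapunov a ell (- C) (- c) (fun t => - A t) (fun t => - B t) (fun t => - G t).
Proof.
have quadN x y z p q : quad (- x) (- y) (- z) p q = - quad x y z p q :> R.
  by rewrite /quad; ring.
move=> [H [K J] D]; split.
- by move=> t p q t0; have := H t p q t0; rewrite quadN !mulNr !lerN2 andbC.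
- exists K => s t p q s0 st; have := J s t p q s0 st.
  by rewrite !quadN; set x := quad _ _ _ _ _; set y := quad _ _ _ _ _; lra.
apply: ae_mono D => t H2 t0; have [dA [dB [dG [h1 h2 h3 h4]]]] := H2 t0.
exists (- dA), (- dB), (- dG); split.
- exact: (is_deriveN h1).
- exact: (is_deriveN h2).
- exact: (is_deriveN h3).
by move=> p q; have := h4 p q; rewrite /rate /quad; lra.
Qed.

(** Gronwall's lemma at the level of forms: if the logarithmic derivative of the
    form is at most h' in absolute value, multiplying by exp (- sg h) makes the
    sign of its derivative definite. *)
Lemma weighted_sdissipative a ell sg A B G h t (dA dB dG dh : R) : sign sg ->
  is_derive t 1 A dA -> is_derive t 1 B dB -> is_derive t 1 G dG ->
  is_derive t 1 h dh ->
  (forall p q, `|rate (a t ^+ 2 * ell) (A t) (B t) (G t) dA dB dG p q| <=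
     dh * quad (A t) (B t) (G t) p q) ->
  sdissipative a ell sg (fun t => expR (- sg * h t) * A t)
    (fun t => expR (- sg * h t) * B t) (fun t => expR (- sg * h t) * G t) t.
Proof.
move=> hsg hA hB hG hh bound; set w := a t ^+ 2 * ell.
pose E := expR (- sg * h t).
have sg2 : sg * sg = 1 by case: hsg => ->; ring.
have hE : is_derive t 1 (fun t => expR (- sg * h t)) (E * (- sg * dh)).
  have hs : is_derive t 1 (fun t => - sg * h t) (- sg * dh).
    exact: (is_deriveZ (- sg) hh).
  have := @is_derive1_comp R expR (fun t => - sg * h t) t (E) (- sg * dh) _ hs.
  by apply; rewrite /E; exact: is_derive_expR.
have prod (f : R -> R) (df : R) : is_derive t 1 f df ->
    is_derive t 1 (fun t => expR (- sg * h t) * f t)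
      (E * df + f t * (E * (- sg * dh))).
  by move=> hf; exact: (is_deriveM hE hf).
exists (E * dA + A t * (E * (- sg * dh))), (E * dB + B t * (E * (- sg * dh))),
  (E * dG + G t * (E * (- sg * dh))).
split; [exact: prod hA|exact: prod hB|exact: prod hG|].
move=> p q.
have -> : rate w (expR (- sg * h t) * A t) (expR (- sg * h t) * B t)
    (expR (- sg * h t) * G t) (E * dA + A t * (E * (- sg * dh)))
    (E * dB + B t * (E * (- sg * dh))) (E * dG + G t * (E * (- sg * dh))) p q =
  E * (rate w (A t) (B t) (G t) dA dB dG p q - sg * dh * quad (A t) (B t) (G t) p q).
  by rewrite -/E /rate /quad; ring.
rewrite mulrCA pmulr_rle0 ?expR_gt0// mulrBr !mulrA sg2 mul1r subr_le0.
apply: le_trans (bound p q); rewrite -/w.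
set r := rate _ _ _ _ _ _ _ _ _.
by case: hsg => ->; rewrite ?mul1r ?mulN1r ?ler_norm// -normrN ler_norm.
Qed.

Lemma sdissipative_scale (a : R -> R) (ell sg : R) (A B G : R -> R) (t k : R) :
  0 <= k -> sdissipative a ell sg A B G t ->
  sdissipative a ell sg (fun t => k * A t) (fun t => k * B t) (fun t => k * G t) t.
Proof.
move=> k0 [dA [dB [dG [hA hB hG H]]]]; exists (k * dA), (k * dB), (k * dG); split.
- exact: (is_deriveZ k hA).
- exact: (is_deriveZ k hB).
- exact: (is_deriveZ k hG).
move=> p q; have := mulr_ge0_le0 k0 (H p q); rewrite /rate /quad; lra.
Qed.

End SignedLyapunov.

(** * Primitives and tails of bounded functions *)

Section Primitives.
Variable R : realType.
Local Notation mu := (@lebesgue_measure R).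
Implicit Types (g : R -> R) (K t : R).

Section Primitive.
Variables (g : R -> R) (K : R).
Hypotheses (mg : measurable_fun (`]0%R, +oo[%classic : set R) g) (g0K : forall t : R, 0 < t -> 0 <= g t <= K).

Let f := g \_ (`]0%R, +oo[%classic : set R).

Let fE t : 0 < t -> f t = g t.
Proof. by move=> t0; rewrite /f patchE mem_set//= in_itv /= t0. Qed.

Let K0 : 0 <= K.
Proof. by have /andP[] := g0K ltr01; exact: le_trans. Qed.

Let f0K t : 0 <= f t <= K.
Proof.
rewrite /f patchE; case: ifPn => [|_]; last by rewrite lexx.
by rewrite inE /= in_itv /= andbT => /g0K.
Qed.

Let mf : measurable_fun setT f.
Proof. exact: (measurable_restrictT _ _).1. Qed.

Let finite_itv (b1 b2 : bool) (x y : R) :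
  (mu [set` Interval (BSide b1 x) (BSide b2 y)] < +oo)%E.
Proof.
by rewrite lebesgue_measure_itv /=; case: ifPn => // _; rewrite -EFinB ltry.
Qed.

Let f_itv (b1 b2 : bool) (x y : R) :
  mu.-integrable [set` Interval (BSide b1 x) (BSide b2 y)] (EFin \o f).
Proof.
apply: measurable_bounded_integrable => //.
- exact: finite_itv.
- exact: measurable_funS mf.
- exists K; split; first exact: num_real.
  move=> M KM z _ /=; have /andP[z0 zK] := f0K z.
  by rewrite ger0_norm// (le_trans zK)// ltW.
Qed.

Definition primitive t := (\int[mu]_(x in `]0%R, t]) f x)%R.

Lemma primitive_ge0 t : 0 <= primitive t.
Proof. by apply: Rintegral_ge0 => x _; have /andP[] := f0K x. Qed.

Lemma primitive_incr s t : 0 < s -> s <= t ->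
  0 <= primitive t - primitive s <= K * (t - s).
Proof.
move=> s0 st.
rewrite /primitive (@Rintegral_itvB _ f (BRight 0) (BRight t) s)//; last first.
  by rewrite bnd_simp ltW.
apply/andP; split; first by apply: Rintegral_ge0 => x _; have /andP[] := f0K x.
have -> : K * (t - s) = (\int[mu]_(x in `]s, t]) K)%R.
  transitivity (K * fine (mu `]s, t])); last exact/esym/Rintegral_cst.
  rewrite lebesgue_measure_itv /= lte_fin.
  have [_|ts] := ltP s t; first by rewrite -EFinB.
  have -> : s = t by apply/eqP; rewrite eq_le st.
  by rewrite subrr.
apply: le_Rintegral => //.
  apply: measurable_bounded_integrable => //.
    exact: finite_itv.
  exists K; split; first exact: num_real.
  by move=> M KM z _ /=; rewrite ger0_norm// ltW.
by move=> x _; have /andP[] := f0K x.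
Qed.

Lemma primitive_lipschitz s t : 0 < s -> 0 < t ->
  `|primitive t - primitive s| <= K * `|t - s|.
Proof.
wlog st : s t / s <= t.
  move=> W s0 t0; have [/W|/ltW/W] := leP s t; first exact.
  by rewrite distrC (distrC s); apply.
move=> s0 t0; have /andP[h1 h2] := primitive_incr s0 st.
by rewrite (ger0_norm h1) ger0_norm ?subr_ge0.
Qed.

Lemma primitiveE t : (primitive t)%:E = (\int[mu]_(x in `]0%R, t]) (g x)%:E)%E.
Proof.
rewrite /primitive /Rintegral fineK; last exact: integrable_fin_num.
apply: eq_integral => x; rewrite inE /= in_itv /= => /andP[x0 _].
by rewrite fE.
Qed.

Lemma primitive_derive :
  {ae mu, forall t : R, 0 < t -> is_derive t 1 primitive (g t)}.
Proof.
have locf : locally_integrable [set: R] f.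
  split => //; first exact: openT.
  move=> A _ cA; have mA : measurable A by exact: compact_measurable.
  apply: (@le_lt_trans _ _ (\int[mu]_(x in A) K%:E)%E).
    apply: ge0_le_integral => //.
    - apply/measurable_EFinP; apply: measurableT_comp => //.
      exact: measurable_funS mf.
    - move=> x _; rewrite lee_fin; have /andP[x0 xK] := f0K x.
      by rewrite ger0_norm.
  rewrite integral_cst// lte_mul_pinfty ?lee_fin//.
  exact: compact_finite_measure.
have := FTC1 (f := f) (a := BRight 0) (fun y => f_itv false false 0 y) locf.
apply: ae_mono => t Ht t0; have [|d1 d2] := Ht; first exact: t0.
by rewrite -(fE t0) -d2; split; [exact: d1|rewrite derive1E].
Qed.

End Primitive.

(** The tail, and not the primitive, is what the last hypothesis of
    [condition_iii] controls from a given time on. *)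
Lemma tail_primitive g K : mu.-integrable (halfline R) (EFin \o g) ->
  (forall t : R, 0 < t -> 0 <= g t <= K) ->
  exists T : R -> R, [/\
    forall t : R, 0 < t -> (T t)%:E = (\int[mu]_(s in `[t, +oo[) (g s)%:E)%E,
    exists2 H : R, 0 <= H & forall t : R, 0 < t -> 0 <= T t <= H,
    forall s t : R, 0 < s -> 0 < t -> `|T t - T s| <= K * `|t - s| &
    {ae mu, forall t : R, 0 < t -> is_derive t 1 T (- g t)}].
Proof.
move=> intg g0K.
have into : mu.-integrable `]0%R, +oo[ (EFin \o g).
  have sub : `]0%R, +oo[%classic `<=` halfline R.
    by move=> x; rewrite /halfline /= !in_itv /= !andbT => /ltW.
  by apply: integrableS intg; [exact: measurable_itv|exact: measurable_itv|exact: sub].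
have mg : measurable_fun (`]0%R, +oo[%classic : set R) g.
  by apply/measurable_EFinP; exact: measurable_int into.
pose I := (\int[mu]_(x in `]0%R, +oo[) g x)%R.
pose G := primitive g.
have TE (t : R) : 0 < t -> (I - G t)%:E = (\int[mu]_(s in `[t, +oo[) (g s)%:E)%E.
  move=> t0; have GE : G t = (\int[mu]_(x in `]0%R, t]) g x)%R.
    by apply: EFin_inj; rewrite (primitiveE mg g0K) /Rintegral fineK//;
       apply: integrable_fin_num => //; apply: integrableS into => // x /=;
       rewrite !in_itv /= andbT => /andP[].
  have inte : mu.-integrable `]t, +oo[ (EFin \o g).
    apply: integrableS into => // x /=; rewrite !in_itv /= !andbT.
    exact: lt_trans.
  rewrite GE (@Rintegral_itvB _ g (BRight 0) +oo%O t)//; last by rewrite bnd_simp ltW.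
  rewrite Rintegral_itv_obnd_cbnd// /Rintegral fineK//.
  apply: integrable_fin_num => //; apply: integrableS into => // x /=.
  by rewrite !in_itv /= !andbT; exact: lt_le_trans.
exists (fun t => I - G t); split => //.
- exists I; first by apply: Rintegral_ge0 => x /=; rewrite in_itv /= andbT => /g0K/andP[].
  move=> t t0; apply/andP; split.
    rewrite -lee_fin TE//; apply: integral_ge0 => x /=; rewrite in_itv /= andbT => tx.
    by have /andP[] := g0K x (lt_le_trans t0 tx); rewrite lee_fin.
  by rewrite lerBlDr lerDl; exact: (primitive_ge0 g0K).
- move=> s t s0 t0; have -> : I - G t - (I - G s) = - (G t - G s) by ring.
  by rewrite normrN; exact: primitive_lipschitz.
apply: ae_mono (primitive_derive mg g0K) => t Ht t0.
have := is_deriveB (is_derive_cst I t 1) (Ht t0).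
by rewrite sub0r.
Qed.

End Primitives.

(** * Switching between two forms *)

Section Gluing.
Variable R : realType.
Local Notation mu := (@lebesgue_measure R).

(** Across the switch the increment of the glued form from s to t is at most that of
    the first form (up to the sign [sg]), because at t the second form lies below the
    first.  Nothing has to be continuous at the switch, which is one exceptional
    time for the derivative. *)
Lemma glue_slyapunov (Z : R -> Prop) (a : R -> R) (ell sg c C : R)
    (A1 B1 G1 A2 B2 G2 : R -> R) :
  (forall s t : R, 0 < s -> s <= t -> Z t -> Z s) ->
  (forall t p q : R, 0 < t -> Z t ->
     c * (p ^+ 2 + ell * q ^+ 2) <= quad (A1 t) (B1 t) (G1 t) p q <=
     C * (p ^+ 2 + ell * q ^+ 2)) ->
  (forall t p q : R, 0 < t -> ~ Z t ->
     c * (p ^+ 2 + ell * q ^+ 2) <= quad (A2 t) (B2 t) (G2 t) p q <=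
     C * (p ^+ 2 + ell * q ^+ 2)) ->
  (forall t p q : R, 0 < t -> ~ Z t ->
     sg * quad (A2 t) (B2 t) (G2 t) p q <= sg * quad (A1 t) (B1 t) (G1 t) p q) ->
  `|sg| <= 1 ->
  (let I t := 0 < t : Prop in [/\ blip I A1, blip I B1 & blip I G1]) ->
  (let I t := 0 < t /\ ~ Z t in [/\ blip I A2, blip I B2 & blip I G2]) ->
  {ae mu, forall t : R, 0 < t -> Z t -> sdissipative a ell sg A1 B1 G1 t} ->
  {ae mu, forall t : R, 0 < t -> ~ Z t -> sdissipative a ell sg A2 B2 G2 t} ->
  exists A B G, slyapunov a ell sg c C A B G.
Proof.
move=> Zdown b1 b2 jump sg1 [lA1 lB1 lG1] [lA2 lB2 lG2] D1 D2.
pose glue (f1 f2 : R -> R) t := if `[< Z t >] then f1 t else f2 t.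
have glue1 f1 f2 t : Z t -> glue f1 f2 t = f1 t by rewrite /glue => /asboolP ->.
have glue2 f1 f2 t : ~ Z t -> glue f1 f2 t = f2 t by rewrite /glue => /asboolPn/negPf ->.
exists (glue A1 A2), (glue B1 B2), (glue G1 G2); split.
- move=> t p q t0; have [Zt|Zt] := pselect (Z t).
    by rewrite !glue1//; exact: b1.
  by rewrite !glue2//; exact: b2.
- have [K1 H1] := blip_quad lA1 lB1 lG1; have [K2 H2] := blip_quad lA2 lB2 lG2.
  exists (`|K1| + `|K2|) => s t p q s0 st.
  have t0 : 0 < t := lt_le_trans s0 st.
  have nn : 0 <= (t - s) * (p ^+ 2 + q ^+ 2).
    by apply: mulr_ge0; rewrite ?subr_ge0// addr_ge0 ?sqr_ge0.
  have sgle (x K L : R) : `|x| <= K * (t - s) * (p ^+ 2 + q ^+ 2) ->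
      `|K| <= L -> sg * x <= L * (t - s) * (p ^+ 2 + q ^+ 2).
    move=> hx KL; apply: le_trans (ler_norm _) _; rewrite normrM.
    apply: (@le_trans _ _ `|x|); first by rewrite ler_piMl.
    apply: le_trans hx _; rewrite -!mulrA ler_wpM2r//.
    by apply: le_trans KL; exact: ler_norm.
  have [Zt|Zt] := pselect (Z t).
    have Zs := Zdown s t s0 st Zt; rewrite !glue1//.
    by apply: sgle (H1 s t p q s0 t0 st) _; rewrite lerDl.
  rewrite !(glue2 _ _ t)//; have [Zs|Zs] := pselect (Z s); last first.
    rewrite !glue2//; apply: sgle (H2 s t p q _ _ st) _ => //.
    by rewrite lerDr.
  rewrite !glue1//; apply: (@le_trans _ _ (sg *
      (quad (A1 t) (B1 t) (G1 t) p q - quad (A1 s) (B1 s) (G1 s) p q))).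
    by rewrite !mulrBr lerD2r; exact: jump.
  by apply: sgle (H1 s t p q s0 t0 st) _; rewrite lerDl.
have N1 : {ae mu, forall t : R, ~ (0 < t /\ Z t /\ forall r, t < r -> ~ Z r)}.
  apply: ae_notin_subsingleton => s t [_ [Zs Hs]] [_ [Zt Ht]].
  have [st|ts|//] := ltgtP s t.
  - by case: (Hs _ st).
  - by case: (Ht _ ts).
have N2 : {ae mu, forall t : R, ~ (~ Z t /\ forall r, 0 < r -> r < t -> Z r) \/ t <= 0}.
  have : {ae mu, forall t : R, ~ (0 < t /\ ~ Z t /\ forall r, 0 < r -> r < t -> Z r)}.
    apply: ae_notin_subsingleton => s t [s0 [Zs Hs]] [t0 [Zt Ht]].
    have [st|ts|//] := ltgtP s t.
    - by case: Zs; exact: Ht.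
    - by case: Zt; exact: Hs.
  apply: ae_mono => t Ht; have [t0|t0] := leP t 0; [by right|left].
  by move=> h; exact: Ht.
apply: ae_mono (ae_and (ae_and D1 D2) (ae_and N1 N2)) => t [[h1 h2] [n1 n2]] t0.
have [Zt|Zt] := pselect (Z t).
  have [r tr Zr] : exists2 r, t < r & Z r.
    apply: contrapT => nr; apply: n1; split => //; split => // r tr Zr.
    by apply: nr; exists r.
  have near1 f1 f2 : \near t, f1 t = glue f1 f2 t.
    near=> s; rewrite glue1//; apply: (Zdown s r) => //.
      by near: s; exact: lt_nbhsr.
    by near: s; exact: lt_le_nbhsl.
  have [dA [dB [dG [hA hB hG diss]]]] := h1 t0 Zt.
  exists dA, dB, dG; rewrite !glue1//; split => //;
    exact: (near_eq_is_derive (near1 _ _)).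
have [r /andP[r0 rt] Zr] : exists2 r, 0 < r < t & ~ Z r.
  apply: contrapT => nr; case: n2 => [n2|]; last by rewrite leNgt t0.
  apply: n2; split => // r r0 rt; apply: contrapT => Zr.
  by apply: nr; exists r; rewrite ?r0.
have near2 f1 f2 : \near t, f2 t = glue f1 f2 t.
  near=> s; rewrite glue2// => Zs; apply: Zr; apply: (Zdown r s) => //.
  by near: s; apply: filterS (lt_nbhsr rt) => s; exact: ltW.
have [dA [dB [dG [hA hB hG diss]]]] := h2 t0 Zt.
exists dA, dB, dG; rewrite !glue2//; split => //;
  exact: (near_eq_is_derive (near2 _ _)).
Unshelve. all: by end_near.
Qed.

(** Comparability with the same reference form suffices for gluing: multiply
    the first form by a constant, large if [sg = 1] and small if [sg = -1]. *)
Lemma glue_scaled (Z : R -> Prop) (a : R -> R) (ell sg c1 C1 c2 C2 : R)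
    (A1 B1 G1 A2 B2 G2 : R -> R) : sign sg -> 0 <= ell ->
  0 < c1 -> c1 <= C1 -> 0 < c2 -> c2 <= C2 ->
  (forall s t : R, 0 < s -> s <= t -> Z t -> Z s) ->
  (forall t p q : R, 0 < t ->
     c1 * (p ^+ 2 + ell * q ^+ 2) <= quad (A1 t) (B1 t) (G1 t) p q <=
     C1 * (p ^+ 2 + ell * q ^+ 2)) ->
  (forall t p q : R, 0 < t -> ~ Z t ->
     c2 * (p ^+ 2 + ell * q ^+ 2) <= quad (A2 t) (B2 t) (G2 t) p q <=
     C2 * (p ^+ 2 + ell * q ^+ 2)) ->
  (let I t := 0 < t : Prop in [/\ blip I A1, blip I B1 & blip I G1]) ->
  (let I t := 0 < t /\ ~ Z t in [/\ blip I A2, blip I B2 & blip I G2]) ->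
  {ae mu, forall t : R, 0 < t -> Z t -> sdissipative a ell sg A1 B1 G1 t} ->
  {ae mu, forall t : R, 0 < t -> ~ Z t -> sdissipative a ell sg A2 B2 G2 t} ->
  exists A B G, slyapunov a ell sg (c2 * c1 / C1) (C2 * C1 / c1) A B G.
Proof.
move=> hsg ell0 c10 cC1 c20 cC2 Zdown b1 b2 [lA lB lG] l2 D1 D2.
have C10 : 0 < C1 := lt_le_trans c10 cC1.
have C20 : 0 < C2 := lt_le_trans c20 cC2.
have quadZ k x y z p q : quad (k * x) (k * y) (k * z) p q = k * quad x y z p q :> R.
  by rewrite /quad; ring.
have e0 (p q : R) : 0 <= p ^+ 2 + ell * q ^+ 2.
  by apply: addr_ge0; rewrite ?sqr_ge0// mulr_ge0 ?sqr_ge0.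
have lo : c2 * c1 / C1 <= c2 by rewrite ler_pdivrMr// ler_pM2l.
have hi : C2 <= C2 * C1 / c1 by rewrite ler_pdivlMr// ler_pM2l.
have sgn : `|sg| <= 1 by case: hsg => ->; rewrite ?normrN normr1.
have [k [k0 kc kC kjump]] : exists k : R, [/\ 0 < k, c2 * c1 / C1 <= k * c1,
    k * C1 <= C2 * C1 / c1 & forall X Y E : R, 0 <= E -> c1 * E <= X -> X <= C1 * E ->
    c2 * E <= Y -> Y <= C2 * E -> sg * Y <= sg * (k * X)].
  case: hsg => ->.
    exists (C2 / c1); split.
    - by rewrite divr_gt0.
    - by rewrite divfK ?gt_eqF// (le_trans lo).
    - by rewrite mulrAC.
    move=> X Y E E0 h1 h2 h3 h4; rewrite !mul1r; apply: le_trans h4 _.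
    have -> : C2 * E = C2 / c1 * (c1 * E) by field; rewrite gt_eqF.
    by rewrite ler_wpM2l// divr_ge0// ltW.
  exists (c2 / C1); split.
  - by rewrite divr_gt0.
  - by rewrite mulrAC.
  - by rewrite divfK ?gt_eqF// (le_trans cC2).
  move=> X Y E E0 h1 h2 h3 h4; rewrite !mulN1r lerN2; apply: le_trans h3.
  have -> : c2 * E = c2 / C1 * (C1 * E) by field; rewrite gt_eqF.
  by rewrite ler_wpM2l// divr_ge0// ltW.
apply: (@glue_slyapunov Z a ell sg _ _ (fun t => k * A1 t) (fun t => k * B1 t)
  (fun t => k * G1 t) A2 B2 G2) => //.
- move=> t p q t0 _; have /andP[h1 h2] := b1 t p q t0; rewrite quadZ.
  apply/andP; split.
    apply: (@le_trans _ _ (k * c1 * (p ^+ 2 + ell * q ^+ 2))); first by rewrite ler_wpM2r.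
    by rewrite -mulrA ler_pM2l.
  apply: (@le_trans _ _ (k * C1 * (p ^+ 2 + ell * q ^+ 2))); last by rewrite ler_wpM2r.
  by rewrite -mulrA ler_pM2l.
- move=> t p q t0 Zt; have /andP[h1 h2] := b2 t p q t0 Zt.
  apply/andP; split; [apply: le_trans h1|apply: (le_trans h2)]; by rewrite ler_wpM2r.
- move=> t p q t0 Zt; have /andP[h1 h2] := b1 t p q t0.
  have /andP[h3 h4] := b2 t p q t0 Zt; rewrite quadZ.
  exact: kjump (e0 p q) _ _ _ _.
- by move=> I; split; apply: blipM => //; exact: blip_cst.
by apply: ae_mono D1 => t H t0 Zt; apply: sdissipative_scale; [exact: ltW|exact: H].
Qed.

End Gluing.

(** * Derivatives on the half-line *)

Section HalfLineCalculus.
Variable R : realType.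
Local Notation mu := (@lebesgue_measure R).
Implicit Types (f : R -> R) (t : R).

Lemma derive_hlP f t : 0 < t -> derivable_hl f t -> is_derive t 1 f (derive_hl f t).
Proof.
move=> t0 cvf; apply/is_derive_epsP => e e0.
have Fp : Filter (punctured t) by exact: within_filter.
have /cvgrPdist_le/(_ _ e0) : diff_quotient f t s @[s --> punctured t] --> derive_hl f t.
  exact: cvf.
move=> [d /= d0 H]; exists (Num.min d t); first by rewrite lt_min d0.
move=> s; rewrite lt_min => /andP[sd st].
have [->|snt] := eqVneq s t; first by rewrite !subrr mul0r subr0 !normr0 mulr0.
have s0 : halfline R s.
  by rewrite /halfline /= in_itv /= andbT; move: st; rewrite ltr_norml; lra.
have := H s; rewrite /ball_ /= distrC => /(_ sd snt s0).
rewrite /diff_quotient => Hs.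
have st0 : s - t != 0 by rewrite subr_eq0.
have -> : f s - f t - (s - t) * derive_hl f t =
    - (derive_hl f t - (f s - f t) / (s - t)) * (s - t) by field.
by rewrite normrM normrN ler_wpM2r.
Qed.

Lemma derive_bounded_lipschitz f (df : R -> R) (K : R) :
  (forall t : R, 0 < t -> is_derive t 1 f (df t)) ->
  (forall t : R, 0 < t -> `|df t| <= K) ->
  forall s t : R, 0 < s -> 0 < t -> `|f t - f s| <= K * `|t - s|.
Proof.
move=> Df dfK s t; wlog st : s t / s < t.
  move=> W s0 t0; have [st|ts|->] := ltgtP s t.
  - exact: W.
  - by rewrite distrC (distrC t); exact: W.
  - by rewrite !subrr normr0 mulr0.
move=> s0 t0; have pos x : x \in `[s, t] -> 0 < x.
  by rewrite in_itv /= => /andP[sx _]; exact: lt_le_trans sx.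
have [] := @MVT R f df s t st.
- by move=> x xst; apply: Df; apply: pos; exact: subset_itv_oo_cc.
- apply: derivable_within_continuous => x /pos x0.
  by have [] := Df x x0.
move=> c cst ->; rewrite normrM ler_wpM2r// dfK//; apply: pos.
exact: subset_itv_oo_cc.
Qed.

End HalfLineCalculus.
(** * The form of the limit oscillator *)

Section Stabilization.
Variable R : realType.
Local Notation mu := (@lebesgue_measure R).
Implicit Types (a b : R -> R).

Definition uniformly_lyapunov a (Lam : R) := exists c C : R, [/\ 0 < c, 0 < C &
  forall ell sg : R, 0 <= ell <= Lam -> sign sg ->
    exists A B G, slyapunov a ell sg c C A B G].

(** Truncating |b - ainf| at a1 + ainf changes it on a null set only, and makes
    its primitive Lipschitz. *)
Lemma deviation_primitive a b (a1 ainf : R) (Theta : R -> R) : 0 < ainf ->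
  (forall t : R, 0 <= t -> 0 < a t <= a1) ->
  borel_representative a b -> stabilization b ainf Theta ->
  exists G : R -> R, [/\ forall t : R, 0 < t -> 0 <= G t <= Theta t,
    exists2 K : R, 0 <= K & forall s t : R, 0 < s -> 0 < t -> `|G t - G s| <= K * `|t - s| &
    {ae mu, forall t : R, 0 < t -> is_derive t 1 G `|a t - ainf|}].
Proof.
move=> ainf0 ha [mb ab] stab.
pose K := a1 + ainf; pose g t := Num.min `|b t - ainf| K.
have K0 : 0 <= K.
  by have /andP[h1 h2] := ha 0 (lexx 0); rewrite addr_ge0 ?(ltW ainf0)// (le_trans (ltW h1)).
have mdev (D : set R) : D `<=` halfline R -> measurable D ->
    measurable_fun D (fun t => `|b t - ainf|).
  move=> Dh mD; apply: measurableT_comp => //; apply: measurable_funB => //.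
  by apply: measurable_funS mb => //; exact: measurable_itv.
have pos_sub : (`]0%R, +oo[%classic : set R) `<=` halfline R.
  by move=> x; rewrite /halfline /= !in_itv /= !andbT => /ltW.
have mg : measurable_fun (`]0%R, +oo[%classic : set R) g.
  by apply: measurable_minr => //; exact: mdev.
have g0K t : 0 < t -> 0 <= g t <= K.
  by move=> _; rewrite /g le_min normr_ge0 K0/= ge_min lexx orbT.
exists (primitive g); split.
- move=> t t0; rewrite (primitive_ge0 g0K)/=; rewrite -lee_fin (primitiveE mg g0K).
  apply: le_trans (stab t (ltW t0)).
  have cc_sub : (`[0%R, t]%classic : set R) `<=` halfline R.
    by move=> x; rewrite /halfline /= !in_itv /= andbT => /andP[].
  have oc_sub : (`]0%R, t]%classic : set R) `<=` `[0%R, t]%classic.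
    by move=> x /=; rewrite !in_itv /= => /andP[/ltW -> ->].
  apply: (@le_trans _ _ (\int[mu]_(s in `]0%R, t]) (`|b s - ainf|%:E))%E).
    apply: ge0_le_integral => //.
    - by move=> x _; rewrite lee_fin /g le_min normr_ge0.
    - apply/measurable_EFinP; apply: measurable_funS mg => //.
      by move=> x /=; rewrite !in_itv /= andbT => /andP[].
    - apply/measurable_EFinP; apply: mdev => //.
      exact: subset_trans cc_sub.
    - by move=> x _; rewrite lee_fin /g ge_min lexx.
  apply: ge0_subset_integral => //.
  - by apply/measurable_EFinP; exact: mdev.
- by exists K => // s t s0 t0; exact: primitive_lipschitz.
apply: ae_mono (ae_and (primitive_derive mg g0K) ab) => t [Ht abt] t0.
have := Ht t0; rewrite /g -abt ?ltW// min_l//.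
have /andP[h1 h2] := ha t (ltW t0).
by rewrite ler_norml /K; apply/andP; split; lra.
Qed.

Lemma min_derive (G : R -> R) (N t dG : R) : is_derive t 1 G dG -> G t < N ->
  is_derive t 1 (fun s => Num.min (G s) N) dG.
Proof.
move=> hG GN; have [/derivable1_diffP/differentiable_continuous cG _] := hG.
apply: near_eq_is_derive hG.
have : \forall s \near t, G s < N by exact: (cG [set x | x < N]) (lt_nbhsl GN).
by apply: filterS => s /ltW h; rewrite min_l.
Qed.

Section StabilizedForm.
Variables (a G : R -> R) (a1 ainf K N ell sg : R).
Hypotheses (ainf0 : 0 < ainf) (ha : forall t : R, 0 <= t -> 0 < a t <= a1)
  (G_ge0 : forall t : R, 0 < t -> 0 <= G t) (K0 : 0 <= K)
  (G_lip : forall s t : R, 0 < s -> 0 < t -> `|G t - G s| <= K * `|t - s|)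
  (G_derive : {ae mu, forall t : R, 0 < t -> is_derive t 1 G `|a t - ainf|})
  (N0 : 0 <= N) (ell0 : 0 <= ell) (hsg : sign sg).
Let lam := Num.sqrt ell.
Let k0 := (a1 + ainf) / ainf.

(** Along an oscillator with speed a, the logarithmic derivative of
    p^2 + ainf^2 lam^2 q^2 is at most k0 lam |a - ainf|.  The truncation at [N]
    keeps the weight bounded for all times; it is inactive where the form is
    used. *)
Definition stabilized_weight t := k0 * Num.min (lam * G t) N.
Definition stabilized_factor t := expR (- sg * stabilized_weight t).

Let lam0 : 0 <= lam. Proof. exact: sqrtr_ge0. Qed.
Let lam2 : lam ^+ 2 = ell. Proof. by rewrite sqr_sqrtr. Qed.
Let k00 : 0 <= k0.
Proof.
rewrite divr_ge0 ?(ltW ainf0)// addr_ge0 ?(ltW ainf0)//.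
by have /andP[/ltW h1 h2] := ha (lexx 0); exact: le_trans h2.
Qed.

Lemma stabilized_weight_bound (t : R) : 0 < t -> 0 <= stabilized_weight t <= k0 * N.
Proof.
move=> t0; rewrite mulr_ge0//=; last by rewrite le_min N0 mulr_ge0 ?G_ge0.
by rewrite ler_wpM2l// ge_min lexx orbT.
Qed.

Lemma stabilized_blip (x : R) : blip (fun t : R => 0 < t) (fun t => stabilized_factor t * x).
Proof.
apply: blipM; last exact: blip_cst.
apply: blip_expR; apply: blipM; first exact: blip_cst.
apply: blipM; first exact: blip_cst.
apply: (@blip_min _ _ _ (lam * K)) => //.
- exact: mulr_ge0.
- by move=> t t0; rewrite mulr_ge0 ?G_ge0.
move=> s t s0 t0; rewrite -mulrBr normrM (ger0_norm lam0) -mulrA ler_wpM2l//.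
exact: G_lip.
Qed.

Lemma stabilized_dissipative : {ae mu, forall t : R, 0 < t -> lam * G t < N ->
  sdissipative a ell sg (fun t => stabilized_factor t * 1)
    (fun t => stabilized_factor t * 0) (fun t => stabilized_factor t * (ainf ^+ 2 * ell)) t}.
Proof.
apply: ae_mono G_derive => t Ht t0 GN.
have hmin : is_derive t 1 (fun s => Num.min (lam * G s) N) (lam * `|a t - ainf|).
  by apply: (@min_derive (fun s => lam * G s)) GN; exact: (is_deriveZ lam (Ht t0)).
have hh : is_derive t 1 stabilized_weight (k0 * (lam * `|a t - ainf|)).
  exact: (is_deriveZ k0 hmin).
apply: (weighted_sdissipative (A := fun=> 1) (B := fun=> 0)
  (G := fun=> ainf ^+ 2 * ell) hsg _ _ _ hh) => //.
move=> p q; rewrite /rate.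
have /andP[at0 at1] := ha (ltW t0).
have -> : quad (0 + 2 * 0) (0 + ainf ^+ 2 * ell - 1 * (a t ^+ 2 * ell))
    (0 - 2 * 0 * (a t ^+ 2 * ell)) p q =
    - ((a t - ainf) * ((a t + ainf) / ainf * lam) * (2 * p * (ainf * lam * q))).
  by rewrite /quad -lam2; field; rewrite gt_eqF.
have -> : k0 * (lam * `|a t - ainf|) * quad 1 0 (ainf ^+ 2 * ell) p q =
    `|a t - ainf| * (k0 * lam) * (p ^+ 2 + (ainf * lam * q) ^+ 2).
  by rewrite /quad -lam2; ring.
rewrite normrN (normrM (_ * _)) (normrM (a t - ainf)).
have ap : 0 <= (a t + ainf) / ainf * lam.
  by rewrite mulr_ge0// divr_ge0 ?addr_ge0// ltW.
apply: ler_pM; rewrite ?mulr_ge0//.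
  rewrite ler_wpM2l// ger0_norm// ler_wpM2r// ler_wpM2r ?invr_ge0 ?(ltW ainf0)//.
  by rewrite lerD2r.
set r := ainf * lam * q.
have := sqr_ge0 (p + r); have := sqr_ge0 (p - r); rewrite sqrrB sqrrD ler_norml.
by move=> *; apply/andP; split; lra.
Qed.

End StabilizedForm.

End Stabilization.

(** * Stabilization and integrable oscillation *)

Section EasyConditions.
Variable R : realType.
Local Notation mu := (@lebesgue_measure R).
Implicit Types (a b : R -> R).

Lemma weight_bound (sg h H : R) : sign sg -> `|h| <= H ->
  expR (- H) <= expR (- sg * h) <= expR H.
Proof.
rewrite ler_norml => hsg /andP[h1 h2]; rewrite !ler_expR.
by case: hsg => ->; apply/andP; split; lra.
Qed.

Lemma scaled_quad_bound (E c C ell x y z p q H1 H2 : R) : 0 <= ell -> 0 <= c ->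
  0 <= H1 -> H1 <= E <= H2 ->
  c * (p ^+ 2 + ell * q ^+ 2) <= quad x y z p q <= C * (p ^+ 2 + ell * q ^+ 2) ->
  (H1 * c) * (p ^+ 2 + ell * q ^+ 2) <= quad (E * x) (E * y) (E * z) p q <=
  (H2 * C) * (p ^+ 2 + ell * q ^+ 2).
Proof.
move=> ell0 c0 H10 /andP[EH1 EH2] /andP[h1 h2].
have e0 : 0 <= p ^+ 2 + ell * q ^+ 2.
  by apply: addr_ge0; rewrite ?sqr_ge0// mulr_ge0 ?sqr_ge0.
have E0 : 0 <= E := le_trans H10 EH1.
have q0 : 0 <= quad x y z p q by apply: le_trans h1; rewrite mulr_ge0.
have -> : quad (E * x) (E * y) (E * z) p q = E * quad x y z p q.
  by rewrite /quad; ring.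
apply/andP; split; rewrite -mulrA; first by apply: ler_pM => //; rewrite mulr_ge0.
exact: ler_pM.
Qed.

Lemma stabilized_quad (ainf ell p q : R) : 0 <= ell ->
  Num.min 1 (ainf ^+ 2) * (p ^+ 2 + ell * q ^+ 2) <= quad 1 0 (ainf ^+ 2 * ell) p q <=
  Num.max 1 (ainf ^+ 2) * (p ^+ 2 + ell * q ^+ 2).
Proof.
move=> ell0; have p0 := sqr_ge0 p.
have q0 : 0 <= ell * q ^+ 2 by rewrite mulr_ge0 ?sqr_ge0.
have -> : quad 1 0 (ainf ^+ 2 * ell) p q = 1 * p ^+ 2 + ainf ^+ 2 * (ell * q ^+ 2).
  by rewrite /quad; ring.
by rewrite !mulrDr; apply/andP; split; apply: lerD; apply: ler_wpM2r => //;
  rewrite ?ge_min ?le_max lexx ?orbT.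
Qed.

Variables (a : R -> R) (a0 a1 : R).
Hypotheses (a00 : 0 < a0) (ha : forall t : R, 0 <= t -> a0 <= a t /\ a t <= a1).

Let ha' (t : R) : 0 <= t -> 0 < a t <= a1.
Proof. by move=> /ha[h1 ->]; rewrite (lt_le_trans a00 h1). Qed.

Lemma condition_i_lyapunov (Lam : R) : 0 <= Lam -> condition_i a -> uniformly_lyapunov a Lam.
Proof.
move=> Lam0 [b ab [ainf [ Theta [ainf0 [[_ _] [[Bd HBd] stab]]]]]].
have [G [GTheta [K K0 Glip] Gder]] := deviation_primitive ainf0 ha' ab stab.
have GBd (t : R) : 0 < t -> G t <= Bd.
  move=> t0; have /andP[_ h] := GTheta t t0; apply: le_trans h _.
  by apply: HBd; exists t => //; rewrite /halfline /= in_itv /= andbT ltW.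
have G0 (t : R) : 0 < t -> 0 <= G t by move=> /GTheta/andP[].
have Bd0 : 0 <= Bd := le_trans (G0 _ ltr01) (GBd _ ltr01).
pose N := Num.sqrt Lam * Bd + 1.
have N0 : 0 <= N by rewrite addr_ge0// mulr_ge0// sqrtr_ge0.
pose H := (a1 + ainf) / ainf * N.
exists (expR (- H) * Num.min 1 (ainf ^+ 2)), (expR H * Num.max 1 (ainf ^+ 2)).
have m0 : 0 < Num.min 1 (ainf ^+ 2) by rewrite lt_min ltr01 exprn_gt0.
split.
- by rewrite mulr_gt0 ?expR_gt0.
- by rewrite mulr_gt0 ?expR_gt0// lt_max ltr01.
move=> ell sg /andP[ell0 ellLam] hsg.
pose E := stabilized_factor G a1 ainf N ell sg.
pose A t := E t * 1; pose B t := E t * 0; pose F t := E t * (ainf ^+ 2 * ell).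
have bl (x : R) := stabilized_blip a1 ainf ell sg G0 K0 Glip N0 x.
have sgn : `|sg| <= 1 by case: hsg => ->; rewrite ?normrN normr1.
apply: (@glue_slyapunov _ (fun=> True) a ell sg _ _ A B F A B F) => //.
- move=> t p q t0 _; apply: scaled_quad_bound => //; [exact: ltW| |].
    apply: weight_bound => //.
    have /andP[h1 h2] := stabilized_weight_bound ell ainf0 ha' G0 N0 t0.
    by rewrite ger0_norm.
  exact: stabilized_quad.
- by move=> I; split; exact: bl.
- by move=> I; split; exists 0; split => // s t [].
- apply: ae_mono (stabilized_dissipative N ainf0 ha' Gder ell0 hsg) => t Ht t0 _.
  apply: Ht => //; rewrite /N ltr_pwDr//.
  by apply: ler_pM => //; rewrite ?sqrtr_ge0 ?G0 ?ler_wsqrtr// GBd.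
- by apply: aeW => t _ [].
Qed.

(** The logarithmic derivative of p^2 + a^2 ell q^2 is at most 2 |a'| / a,
    uniformly in the frequency. *)
Lemma condition_ii_lyapunov (Lam : R) : 0 <= Lam -> condition_ii a -> uniformly_lyapunov a Lam.
Proof.
move=> Lam0 [[Da _] [C1 [Xi [C10 [[Xi0 Ximono] [intXi bound]]]]]].
have {}Da (t : R) : 0 < t -> is_derive t 1 a (derive_hl a t).
  by move=> t0; apply: derive_hlP => //; apply: (Da 0%N) => //; exact: ltW.
have Xib (t : R) : 0 < t -> 0 <= (Xi t)^-1 <= (Xi 0)^-1.
  move=> t0; rewrite invr_ge0 (ltW (Xi0 _ (ltW t0)))/=.
  by rewrite lef_pV2 ?posrE ?Xi0 ?Ximono// ltW.
have [T [_ [H H0 TH] Tlip Tder]] := tail_primitive intXi Xib.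
pose k := 2 * C1 / a0.
have k0 : 0 <= k by rewrite divr_ge0 ?mulr_ge0// ltW.
have a10 : 0 < a1 by have [h1 h2] := ha (lexx 0); exact: lt_le_trans a00 (le_trans h1 h2).
exists (expR (- (k * H)) * Num.min 1 (a0 ^+ 2)), (expR (k * H) * Num.max 1 (a1 ^+ 2)).
have m0 : 0 < Num.min 1 (a0 ^+ 2) by rewrite lt_min ltr01 exprn_gt0.
split.
- by rewrite mulr_gt0 ?expR_gt0.
- by rewrite mulr_gt0 ?expR_gt0// lt_max ltr01.
move=> ell sg /andP[ell0 ellLam] hsg.
pose h (t : R) := - (k * T t); pose E t := expR (- sg * h t).
pose A t := E t * 1; pose B t := E t * 0; pose F t := E t * (a t ^+ 2 * ell).
have sgn : `|sg| <= 1 by case: hsg => ->; rewrite ?normrN normr1.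
have pos0 (t : R) : 0 < t -> 0 <= t by exact: ltW.
have ablip : blip (fun t : R => 0 < t) a.
  exists (a1 + C1 * (Xi 0)^-1).
  have X0 : 0 <= C1 * (Xi 0)^-1 by rewrite mulr_ge0 ?invr_ge0 ?(ltW C10)// ltW ?Xi0.
  split; first by rewrite addr_ge0// ltW.
  move=> s t s0 t0; have /andP[at0 at1] := ha' (ltW t0); split.
    by rewrite ger0_norm ?(ltW at0)// (le_trans at1)// lerDl.
  apply: le_trans (derive_bounded_lipschitz (K := C1 * (Xi 0)^-1) Da _ s0 t0) _.
    move=> r r0; apply: le_trans (bound r (ltW r0)) _.
    by rewrite ler_wpM2l ?(ltW C10)//; have /andP[] := Xib r r0.
  by rewrite ler_wpM2r// lerDr ltW.
have Eblip : blip (fun t : R => 0 < t) E.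
  apply: blip_expR; apply: blipM; first exact: blip_cst.
  apply: blipN; apply: blipM; first exact: blip_cst.
  exists (H + (Xi 0)^-1); have X0 : 0 <= (Xi 0)^-1 by rewrite invr_ge0 ltW ?Xi0.
  split; first exact: addr_ge0.
  move=> s t s0 t0; have /andP[T0 T1] := TH t t0; split.
    by rewrite ger0_norm// (le_trans T1)// lerDl.
  by apply: le_trans (Tlip s t s0 t0) _; rewrite ler_wpM2r// lerDr.
have Fblip : blip (fun t : R => 0 < t) F.
  apply: blipM => //; apply: blipM; last exact: blip_cst.
  by have := blipM ablip ablip; congr (blip _ _); apply/funext => t; rewrite expr2.
have ABblip (x : R) : blip (fun t : R => 0 < t) (fun t => E t * x).
  by apply: blipM => //; exact: blip_cst.
have weaken (f : R -> R) : blip (fun t : R => 0 < t) f -> blip (fun t : R => 0 < t /\ ~ False) f.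
  by move=> [L [L0 HL]]; exists L; split => // s t [s0 _] [t0 _]; exact: HL.
apply: (@glue_slyapunov _ (fun=> False) a ell sg _ _ A B F A B F) => //.
- move=> t p q t0 _; have [at0 at1] := ha (ltW t0).
  apply: scaled_quad_bound => //; [exact: ltW| |].
    apply: weight_bound => //; have /andP[T0 T1] := TH t t0.
    by rewrite /h normrN normrM !ger0_norm// ler_wpM2l.
  have p0 := sqr_ge0 p.
  have q0 : 0 <= ell * q ^+ 2 by rewrite mulr_ge0 ?sqr_ge0.
  have -> : quad 1 0 (a t ^+ 2 * ell) p q = 1 * p ^+ 2 + a t ^+ 2 * (ell * q ^+ 2).
    by rewrite /quad; ring.
  have a0n : 0 <= a0 := ltW a00; have atn : 0 <= a t := le_trans a0n at0.
  have a1n : 0 <= a1 := ltW a10.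
  have sq0 : a0 ^+ 2 <= a t ^+ 2 by rewrite lerXn2r ?nnegrE.
  have sq1 : a t ^+ 2 <= a1 ^+ 2 by rewrite lerXn2r ?nnegrE.
  rewrite !mulrDr; apply/andP; split; apply: lerD; apply: ler_wpM2r => //.
  + by rewrite ge_min lexx.
  + by rewrite ge_min sq0 orbT.
  + by rewrite le_max lexx.
  + by rewrite le_max sq1 orbT.
- by move=> I; split; [exact: ABblip|exact: ABblip|exact: Fblip].
- by move=> I; split; apply: weaken; [exact: ABblip|exact: ABblip|exact: Fblip].
- by apply: aeW.
apply: ae_mono Tder => t Ht t0 _; have [at0 at1] := ha (ltW t0).
have hh : is_derive t 1 h (k * (Xi t)^-1).
  have := is_deriveN (is_deriveZ k (Ht t0)).
  by rewrite /GRing.scale /= mulrN opprK.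
have ha2 : is_derive t 1 (fun t => a t ^+ 2 * ell) (2 * a t * derive_hl a t * ell).
  have -> : (fun t => a t ^+ 2 * ell) = ell *: (a * a).
    by apply/funext => r; rewrite expr2 mulrC.
  apply: is_derive_eq (is_deriveZ ell (is_deriveM (Da t t0) (Da t t0))) _.
  by rewrite /GRing.scale /=; ring.
apply: (weighted_sdissipative (A := fun=> 1) (B := fun=> 0)
  (G := fun t => a t ^+ 2 * ell) hsg _ _ ha2 hh) => //.
move=> p q; rewrite /rate.
have q0 : 0 <= ell * q ^+ 2 by rewrite mulr_ge0 ?sqr_ge0.
have -> : quad (0 + 2 * 0) (0 + a t ^+ 2 * ell - 1 * (a t ^+ 2 * ell))
    (2 * a t * derive_hl a t * ell - 2 * 0 * (a t ^+ 2 * ell)) p q =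
    derive_hl a t * (2 * a t * (ell * q ^+ 2)).
  by rewrite /quad; ring.
have ap : 0 < a t := lt_le_trans a00 at0.
have r0 : 0 <= 2 * a t * (ell * q ^+ 2) by rewrite mulr_ge0// mulr_ge0// ltW.
rewrite normrM (ger0_norm r0).
apply: (@le_trans _ _ (C1 * (Xi t)^-1 * (2 * a t * (ell * q ^+ 2)))).
  by apply: ler_wpM2r => //; apply: bound; exact: ltW.
have CX : 0 <= C1 * (Xi t)^-1 by rewrite mulr_ge0 ?(ltW C10)//; have /andP[] := Xib t t0.
have -> : k * (Xi t)^-1 * quad 1 0 (a t ^+ 2 * ell) p q =
   C1 * (Xi t)^-1 * (2 * (p ^+ 2 / a0 + (a t / a0) * a t * (ell * q ^+ 2))).
  by move: (Xi t)^-1 => y; rewrite /k /quad; field; rewrite gt_eqF.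
rewrite ler_wpM2l// -(mulrA 2) ler_wpM2l//.
have p0 : 0 <= p ^+ 2 / a0 by rewrite divr_ge0 ?sqr_ge0// ltW.
apply: ler_wpDl => //; rewrite ler_wpM2r// ler_peMl ?(ltW ap)//.
by rewrite ler_pdivlMr// mul1r.
Qed.

End EasyConditions.

(** * Symbol classes and WKB coefficients *)

Section Symbols.
Variable R : realType.
Variable x : R -> R.
Hypothesis x_ge0 : forall t : R, 0 < t -> 0 <= x t.
Implicit Types (f g : R -> R) (n i j : nat).

(** Functions of order x^j, with x = 1/Xi, with each of [n] derivatives gaining
    one more factor x.  The derivative is part of the data, which avoids iterated
    derivatives of products. *)
Fixpoint symbol n j f : Prop :=
  (exists C : R, forall t : R, 0 < t -> `|f t| <= C * x t ^+ j) /\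
  if n is n'.+1 then exists2 df : R -> R,
    (forall t : R, 0 < t -> is_derive t 1 f (df t)) & symbol n' j.+1 df
  else True.

Lemma symbol_bound n j f : symbol n j f ->
  exists2 C : R, 0 <= C & forall t : R, 0 < t -> `|f t| <= C * x t ^+ j.
Proof.
case: n => [|n] [[C HC] _]; exists `|C| => // t t0.
  by apply: le_trans (HC t t0) _; rewrite ler_wpM2r ?exprn_ge0 ?x_ge0// ler_norm.
by apply: le_trans (HC t t0) _; rewrite ler_wpM2r ?exprn_ge0 ?x_ge0// ler_norm.
Qed.

Lemma symbol_weaken n j f : symbol n.+1 j f -> symbol n j f.
Proof.
elim: n j f => [|n IH] j f [[C HC] [df Hdf sdf]]; split => //; first by exists C.
  by exists C.
by exists df => //; exact: IH.
Qed.

Lemma symbol_weaken_le n k j f : (n <= k)%N -> symbol k j f -> symbol n j f.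
Proof.
move=> nk; rewrite -(subnK nk); elim: (k - n)%N => // d IH.
by rewrite addSn => /symbol_weaken.
Qed.

Lemma symbolD n j f g : symbol n j f -> symbol n j g -> symbol n j (fun t => f t + g t).
Proof.
elim: n j f g => [|n IH] j f g [[C HC] Df] [[D HD] Dg].
  split => //; exists (C + D) => t t0; rewrite mulrDl.
  by apply: le_trans (ler_normD _ _) _; rewrite lerD ?HC ?HD.
split.
  exists (C + D) => t t0; rewrite mulrDl.
  by apply: le_trans (ler_normD _ _) _; rewrite lerD ?HC ?HD.
have [df Hf sf] := Df; have [dg Hg sg] := Dg.
exists (fun t => df t + dg t); last exact: IH.
by move=> t t0; exact: (is_deriveD (Hf t t0) (Hg t t0)).
Qed.

Lemma symbolM n i j f g :
  symbol n i f -> symbol n j g -> symbol n (i + j) (fun t => f t * g t).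
Proof.
have bound (f1 g1 : R -> R) i1 j1 (C D : R) :
    (forall t : R, 0 < t -> `|f1 t| <= C * x t ^+ i1) ->
    (forall t : R, 0 < t -> `|g1 t| <= D * x t ^+ j1) ->
    exists C : R, forall t : R, 0 < t -> `|f1 t * g1 t| <= C * x t ^+ (i1 + j1).
  move=> HC HD; exists (C * D) => t t0; rewrite normrM exprD.
  have -> : C * D * (x t ^+ i1 * x t ^+ j1) = (C * x t ^+ i1) * (D * x t ^+ j1) by ring.
  by apply: ler_pM => //; [exact: HC|exact: HD].
elim: n i j f g => [|n IH] i j f g sf sg.
  by case: sf sg => [[C HC] _] [[D HD] _]; split => //; exact: bound HC HD.
have sf' := symbol_weaken sf; have sg' := symbol_weaken sg.
case: sf sg => [[C HC] [df Hf sdf]] [[D HD] [dg Hg sdg]].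
split; first exact: bound HC HD.
exists (fun t => df t * g t + f t * dg t).
  move=> t t0; apply: is_derive_eq (is_deriveM (Hf t t0) (Hg t t0)) _.
  by rewrite /GRing.scale /=; ring.
apply: symbolD; first by rewrite -addSn; exact: IH.
by rewrite -addnS; exact: IH.
Qed.

Lemma symbol_cst n (c : R) : symbol n 0 (fun=> c).
Proof.
have zero k j : symbol k j (fun=> 0).
  elim: k j => [|k IH] j; (split; first by
    exists 0 => t t0; rewrite normr0 mul0r) => //.
  by exists (fun=> 0) => // t _; exact: is_derive_cst.
case: n => [|n]; (split; first by exists `|c| => t _; rewrite expr0 mulr1) => //.
by exists (fun=> 0) => // t _; exact: is_derive_cst.
Qed.

Lemma symbol_inv n (c : R) f : 0 < c -> (forall t : R, 0 < t -> c <= f t) ->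
  symbol n 0 f -> symbol n 0 (fun t => (f t)^-1).
Proof.
move=> c0 fc.
have bound : exists C : R, forall t : R, 0 < t -> `|(f t)^-1| <= C * x t ^+ 0.
  exists c^-1 => t t0; rewrite expr0 mulr1.
  have f0 : 0 < f t := lt_le_trans c0 (fc t t0).
  by rewrite gtr0_norm ?invr_gt0// lef_pV2 ?posrE// fc.
elim: n => [|n IH] sf; first by split.
have sinv := IH (symbol_weaken sf).
case: sf => _ [df Hf sdf]; split => //.
exists (fun t => -1 * ((f t)^-1 * (f t)^-1) * df t).
  move=> t t0; have f0 : f t != 0 by rewrite gt_eqF// (lt_le_trans c0)// fc.
  apply: is_derive_eq (is_deriveV f0 (Hf t t0)) _.
  by rewrite /GRing.scale /=; field.
apply: (@symbolM _ 0 1) => //; apply: (@symbolM _ 0 0); first exact: symbol_cst.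
exact: (@symbolM _ 0 0).
Qed.

Lemma symbol_sum n j (I : Type) (r : seq I) (F : I -> R -> R) :
  (forall l : I, symbol n j (F l)) -> symbol n j (fun t => \sum_(l <- r) F l t).
Proof.
move=> sF; elim: r => [|l r IH].
  have -> : (fun t => \sum_(l <- [::]) F l t) = (fun=> 0).
    by apply/funext => t; rewrite big_nil.
  elim: n j {sF} => [|n IH] j; (split; first by
    exists 0 => t t0; rewrite normr0 mul0r) => //.
  by exists (fun=> 0) => // t _; exact: is_derive_cst.
have -> : (fun t => \sum_(l' <- l :: r) F l' t) = (fun t => F l t + \sum_(l' <- r) F l' t).
  by apply/funext => t; rewrite big_cons.
exact: symbolD.
Qed.

Section WKB.
Variables (a : R -> R) (a0 : R) (m : nat).
Hypotheses (a00 : 0 < a0) (aa0 : forall t : R, 0 < t -> a0 <= a t)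
  (sa : symbol m 0 a).

(** Inserting i lam (z_0 + z_1/(i lam) + ...) in the Riccati equation and comparing
    powers of lam gives a recursion that determines z_(j+1) from z_0, ..., z_j and
    z_j'.  It loses one derivative and gains one factor x per step. *)
Lemma wkb_coefficients J : (J < m)%N -> exists z dz : nat -> R -> R, [/\
  z 0%N = a,
  forall j, (j <= J)%N -> symbol (m - j) j (z j),
  forall j (t : R), (j <= J)%N -> 0 < t -> is_derive t 1 (z j) (dz j t),
  forall j, (j <= J)%N -> symbol (m - j.+1) j.+1 (dz j) &
  forall j (t : R), (j < J)%N -> 0 < t ->
    dz j t + \sum_(i < j.+2) z i t * z (j.+1 - i)%N t = 0].
Proof.
have deriv j f : (j < m)%N -> symbol (m - j) j f -> exists2 df : R -> R,
    (forall t : R, 0 < t -> is_derive t 1 f (df t)) & symbol (m - j.+1) j.+1 df.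
  by move=> jm; rewrite -(subnSK jm) => -[_].
elim: J => [|J IH] Jm.
  have [da Ha sda] := deriv 0%N a Jm (eq_ind_r (fun k => symbol k 0 a) sa (subn0 m)).
  exists (fun=> a), (fun=> da); split => //.
  - by move=> j; rewrite leqn0 => /eqP->; rewrite subn0.
  - by move=> j t _; exact: Ha.
  - by move=> j; rewrite leqn0 => /eqP->.
have [z [dz [z0 sz Hz sdz rec]]] := IH (ltnW Jm).
pose y (t : R) := (- 1 * (2^-1 * (a t)^-1)) *
  (dz J t + \sum_(i < J) z i.+1 t * z (J - i)%N t).
have sy : symbol (m - J.+1) J.+1 y.
  apply: (@symbolM _ 0 J.+1).
    apply: (@symbolM _ 0 0); first exact: symbol_cst.
    apply: (@symbolM _ 0 0); first exact: symbol_cst.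
    apply: symbol_inv a00 aa0 _; apply: symbol_weaken_le sa; exact: leq_subr.
  apply: symbolD; first by apply: sdz.
  apply: symbol_sum => i.
  have iJ : (i <= J)%N := ltnW (ltn_ord i).
  have -> : J.+1 = (i.+1 + (J - i))%N by rewrite addSn subnKC.
  apply: symbolM.
    apply: symbol_weaken_le (sz i.+1 (ltn_ord i)).
    by rewrite addSn subnKC// leq_sub2l.
  apply: symbol_weaken_le (sz (J - i)%N (leq_subr _ _)).
  rewrite addSn subnKC// leq_sub2l//.
  exact: leq_trans (leq_subr _ _) _.
have [dy Hy sdy] := deriv J.+1 y Jm sy.
pose upd (u : nat -> R -> R) v i := if i == J.+1 then v else u i.
have updE u v i : (i <= J)%N -> upd u v i = u i.
  by rewrite /upd; case: eqP => // ->; rewrite ltnn.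
have updS u v : upd u v J.+1 = v by rewrite /upd eqxx.
exists (upd z y), (upd dz dy); split.
- by rewrite updE.
- move=> j; rewrite leq_eqVlt => /predU1P[->|]; first by rewrite updS.
  by rewrite ltnS => jJ; rewrite updE//; exact: sz.
- move=> j t; rewrite leq_eqVlt => /predU1P[->|]; first by rewrite !updS; exact: Hy.
  by rewrite ltnS => jJ t0; rewrite !updE//; exact: Hz.
- move=> j; rewrite leq_eqVlt => /predU1P[->|]; first by rewrite updS.
  by rewrite ltnS => jJ; rewrite updE//; exact: sdz.
move=> j t; rewrite ltnS leq_eqVlt => /predU1P[->|jJ] t0; last first.
  rewrite updE ?(ltnW jJ)//; have := rec j t jJ t0; congr (_ + _ = _).
  apply: eq_bigr => i _; rewrite !updE//.
    exact: leq_trans (leq_subr _ _) jJ.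
  by rewrite -ltnS (leq_trans (ltn_ord i)).
rewrite updE// big_ord_recl big_ord_recr /= subn0 updS subnn updE// z0.
rewrite (eq_bigr (fun i : 'I_J => z i.+1 t * z (J - i)%N t)); last first.
  move=> i _; rewrite /bump /= add1n subSS !updE//; exact: leq_subr.
have a0' : a t != 0 by rewrite gt_eqF// (lt_le_trans a00)// aa0.
by rewrite /y; field.
Qed.

End WKB.
End Symbols.

(** * The truncated Riccati solution at one time *)

Section ComplexFrequency.
Variables (R : realType) (lam : R).
Hypothesis lam0 : 0 < lam.
Local Notation normc := (@ComplexField.Normc.normc R).

(** (i lam)^(1-j). *)
Definition wkb_mode (j : nat) : R[i] := (0 +i* lam)%C * (0 +i* lam)%C^-1 ^+ j.

Lemma normc_Re (w : R[i]) : `|complex.Re w| <= normc w.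
Proof.
case: w => u v /=; rewrite -sqrtr_sqr ler_wsqrtr// lerDl; exact: sqr_ge0.
Qed.

Lemma normc_Im (w : R[i]) : `|complex.Im w| <= normc w.
Proof.
case: w => u v /=; rewrite -sqrtr_sqr ler_wsqrtr// lerDr; exact: sqr_ge0.
Qed.

Lemma normc_real (u : R) : normc u%:C%C = `|u|.
Proof. by rewrite /= expr0n /= addr0 sqrtr_sqr. Qed.

Lemma normc_freq : normc (0 +i* lam)%C = lam.
Proof. by rewrite /= expr0n /= add0r sqrtr_sqr gtr0_norm. Qed.

Lemma normcXn (w : R[i]) n : normc (w ^+ n) = normc w ^+ n.
Proof.
elim: n => [|n IH]; first by rewrite !expr0 ComplexField.Normc.normc1.
by rewrite !exprS ComplexField.Normc.normcM IH.
Qed.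

Lemma normc_sum (I : Type) (r : seq I) (F : I -> R[i]) :
  normc (\sum_(l <- r) F l) <= \sum_(l <- r) normc (F l).
Proof.
elim: r => [|l r IH]; first by rewrite !big_nil ComplexField.Normc.normc0.
by rewrite !big_cons; apply: le_trans (le_normcD _ _) _; rewrite lerD2l.
Qed.

Lemma normc_mode j : normc (wkb_mode j) = lam * lam^-1 ^+ j.
Proof.
by rewrite ComplexField.Normc.normcM normcXn ComplexField.Normc.normcV normc_freq.
Qed.

Section Coefficients.
Variable m : nat.

Definition wkb_sum (z : nat -> R) : R[i] := \sum_(j < m) (z j)%:C%C * wkb_mode j.

Lemma wkb_Re z : complex.Re (wkb_sum z) = \sum_(j < m) z j * complex.Re (wkb_mode j).
Proof.
rewrite /wkb_sum; elim/big_rec2: _ => //= j u v _ <-.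
by case: (wkb_mode j) v => [p q] [p' q'] /=; rewrite mul0r subr0.
Qed.

Lemma wkb_Im z : complex.Im (wkb_sum z) = \sum_(j < m) z j * complex.Im (wkb_mode j).
Proof.
rewrite /wkb_sum; elim/big_rec2: _ => //= j u v _ <-.
by case: (wkb_mode j) v => [p q] [p' q'] /=; rewrite mul0r addr0.
Qed.

Variables (z dz : nat -> R) (C x : R).
Hypotheses (m0 : (0 < m)%N) (C0 : 0 <= C) (x0 : 0 <= x) (xlam : x <= lam).
Hypothesis z_bound : forall j, (j < m)%N -> `|z j| <= C * x ^+ j.

Lemma wkb_leading :
  normc (wkb_sum z - (0 +i* (lam * z 0%N))%C) <= m%:R * C * x.
Proof.
rewrite /wkb_sum; case: m m0 z_bound => // m' _ zb.
rewrite big_ord_recl /=.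
have -> : (z 0%N)%:C%C * wkb_mode 0 = (0 +i* (lam * z 0%N))%C.
  by rewrite /wkb_mode expr0 mulr1 /=; congr (_ +i* _)%C; ring.
rewrite addrAC subrr add0r; apply: le_trans (normc_sum _ _) _.
apply: (@le_trans _ _ (\sum_(i < m') C * x)); last first.
  have Cx : 0 <= C * x by rewrite mulr_ge0.
  by rewrite sumr_const card_ord -(mulrA _ C x) mulr_natl ler_wpMn2l.
apply: ler_sum => j _; rewrite ComplexField.Normc.normcM normc_real normc_mode.
have zj := zb j.+1 (ltn_ord j).
have -> : lam * lam^-1 ^+ (lift ord0 j) = lam^-1 ^+ j.
  by rewrite lift0 exprS mulrA mulfV ?mul1r// gt_eqF.
apply: (@le_trans _ _ (C * x ^+ j.+1 * lam^-1 ^+ j)).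
  by rewrite ler_wpM2r ?exprn_ge0// invr_ge0 ltW.
rewrite exprS -!mulrA ler_wpM2l// -[X in _ <= X]mulr1 ler_wpM2l//.
rewrite -exprMn exprn_ile1//.
  by rewrite divr_ge0// ltW.
by rewrite ler_pdivrMr// mul1r.
Qed.

Hypothesis dz_bound : forall j, (j < m)%N -> `|dz j| <= C * x ^+ j.+1.
Hypothesis z_rec : forall j, (j.+1 < m)%N ->
  dz j + \sum_(i < j.+2) z i * z (j.+1 - i)%N = 0.

(** With X = 1/(i lam) the residual is (i lam)^2 Q(X) for the real polynomial
    Q = X P' + P^2 - z_0^2, where P has coefficients z_j and P' has coefficients
    dz_j.  The recursion says that the coefficients of Q below degree m vanish,
    and in degree k the coefficient is O(x^k). *)
Lemma wkb_residual :
  normc (wkb_sum dz + wkb_sum z ^+ 2 + (z 0%N ^+ 2 * lam ^+ 2)%:C%C) <=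
  (2 * m)%:R * (C + (2 * m)%:R * C ^+ 2) * lam ^+ 2 * (x / lam) ^+ m.
Proof.
pose om : R[i] := (0 +i* lam)%C; pose X := om^-1.
have om0 : om != 0 by rewrite eq_complex /= negb_and [lam == 0]gt_eqF// orbT.
have om2 : om ^+ 2 = - (lam ^+ 2)%:C%C.
  by rewrite expr2 /=; apply/eqP; rewrite eq_complex /=; apply/andP; split; apply/eqP; ring.
pose pz := \poly_(j < m) z j; pose pd := \poly_(j < m) dz j.
pose Q : {poly R} := 'X * pd + pz ^+ 2 - (z 0%N ^+ 2)%:P.
pose ev (p : {poly R}) := (map_poly (real_complex R) p).[X].
have evC (c : R) : ev c%:P = c%:C%C by rewrite /ev map_polyC hornerC.
have evX : ev 'X = X by rewrite /ev map_polyX hornerX.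
have evD (p q : {poly R}) : ev (p + q) = ev p + ev q by rewrite /ev rmorphD hornerD.
have evM (p q : {poly R}) : ev (p * q) = ev p * ev q by rewrite /ev rmorphM hornerM.
have evN (p : {poly R}) : ev (- p) = - ev p by rewrite /ev rmorphN hornerN.
have ev_wide (p : {poly R}) n : (size p <= n)%N -> ev p = \sum_(k < n) (p`_k)%:C%C * X ^+ k.
  move=> pn; rewrite /ev (@horner_coef_wide _ n).
    by apply: eq_bigr => k _; rewrite coef_map.
  by rewrite (leq_trans _ pn)// size_poly.
have evE (y : nat -> R) : wkb_sum y = om * ev (\poly_(j < m) y j).
  rewrite (ev_wide _ m) ?size_poly// mulr_sumr; apply: eq_bigr => j _.
  by rewrite coef_poly ltn_ord /wkb_mode -/om -/X mulrCA.
have -> : wkb_sum dz + wkb_sum z ^+ 2 + (z 0%N ^+ 2 * lam ^+ 2)%:C%C = om ^+ 2 * ev Q.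
  rewrite !evE -/pz -/pd /Q !evD evN evC evM evX expr2 evM rmorphM /=.
  have -> : (lam ^+ 2)%:C%C = - om ^+ 2 by rewrite om2 opprK.
  by rewrite /X; field.
rewrite ComplexField.Normc.normcM normcXn normc_freq.
have pzE k : pz`_k = if (k < m)%N then z k else 0 by exact: coef_poly.
have pdE k : pd`_k = if (k < m)%N then dz k else 0 by exact: coef_poly.
have coefz k : `|pz`_k| <= C * x ^+ k.
  by rewrite pzE; case: ifP => [/z_bound//|_]; rewrite normr0 mulr_ge0 ?exprn_ge0.
have coefd k : `|pd`_k| <= C * x ^+ k.+1.
  by rewrite pdE; case: ifP => [/dz_bound//|_]; rewrite normr0 mulr_ge0 ?exprn_ge0.
have sizeQ : (size Q <= 2 * m)%N.
  have sz : (size pz <= m)%N by exact: size_poly.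
  have sd : (size pd <= m)%N by exact: size_poly.
  rewrite /Q; apply: leq_trans (size_polyD _ _) _; rewrite size_polyN geq_max.
  rewrite (leq_trans (size_polyC_leq1 _)) ?muln_gt0// andbT.
  apply: leq_trans (size_polyD _ _) _; rewrite geq_max; apply/andP; split.
    apply: leq_trans (size_polyMleq _ _) _; rewrite size_polyX /=.
    by rewrite mul2n -addnn -add1n leq_add.
  rewrite expr2; apply: leq_trans (size_polyMleq _ _) _.
  rewrite mul2n -addnn; apply: leq_trans (leq_pred _) _; exact: leq_add.
have coefQ0 k : (k < m)%N -> Q`_k = 0.
  move=> km; rewrite /Q !coefD coefN coefXM coefC expr2 coefM.
  case: k km => [|k] km /=.
    by rewrite big_ord1 subn0 pzE m0; ring.
  rewrite subr0; apply: etrans (z_rec km); rewrite pdE (ltnW km); congr (_ + _).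
  apply: eq_bigr => i _; rewrite !pzE.
  rewrite (leq_ltn_trans _ km) ?(leq_ltn_trans _ km) ?leq_subr//.
  by rewrite -ltnS.
have coefQ k : (m <= k)%N -> (k < 2 * m)%N -> `|Q`_k| <= (C + (2 * m)%:R * C ^+ 2) * x ^+ k.
  move=> mk k2m; have k0 : (0 < k)%N by exact: leq_trans mk.
  rewrite /Q !coefD coefN coefXM coefC expr2 coefM.
  case: k k0 mk k2m => // k _ mk k2m /=; rewrite subr0.
  apply: le_trans (ler_normD _ _) _; rewrite mulrDl; apply: lerD; first exact: coefd.
  apply: le_trans (ler_norm_sum _ _ _) _.
  apply: (@le_trans _ _ (\sum_(i < k.+2) C ^+ 2 * x ^+ k.+1)).
    apply: ler_sum => i _; rewrite normrM.
    have -> : C ^+ 2 * x ^+ k.+1 = (C * x ^+ i) * (C * x ^+ (k.+1 - i)).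
      by rewrite mulrACA -exprD subnKC -?expr2// -ltnS.
    exact: ler_pM.
  rewrite sumr_const card_ord -[X in X <= _]mulr_natl.
  rewrite [X in X <= _]mulrA; apply: ler_wpM2r; first exact: exprn_ge0.
  by apply: ler_wpM2r; rewrite ?sqr_ge0// ler_nat.
have r0 : 0 <= x / lam by rewrite divr_ge0// ltW.
have r1 : x / lam <= 1 by rewrite ler_pdivrMr// mul1r.
have K0 : 0 <= C + (2 * m)%:R * C ^+ 2 by rewrite addr_ge0// mulr_ge0// sqr_ge0.
rewrite (ev_wide _ _ sizeQ).
apply: (@le_trans _ _ (lam ^+ 2 *
    \sum_(k < 2 * m) (C + (2 * m)%:R * C ^+ 2) * (x / lam) ^+ m)).
  rewrite ler_wpM2l ?sqr_ge0//; apply: le_trans (normc_sum _ _) _.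
  apply: ler_sum => k _; rewrite ComplexField.Normc.normcM normc_real normcXn.
  rewrite ComplexField.Normc.normcV normc_freq.
  have [km|mk] := ltnP k m.
    by rewrite coefQ0// normr0 mul0r mulr_ge0// exprn_ge0.
  apply: (@le_trans _ _ ((C + (2 * m)%:R * C ^+ 2) * x ^+ k * lam^-1 ^+ k)).
    by rewrite ler_wpM2r ?coefQ// exprn_ge0// invr_ge0 ltW.
  by rewrite -mulrA -exprMn ler_wpM2l// ler_wiXn2l.
rewrite sumr_const card_ord -[X in _ * X <= _]mulr_natl; set n := (2 * m)%:R.
by rewrite le_eqVlt; apply/orP; left; apply/eqP; ring.
Qed.

End Coefficients.
End ComplexFrequency.

(** * The WKB quadratic form *)

Section WKBForm.
Variable R : realType.
Implicit Types (al rho eta drho deta lam nu p q : R).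

(** The form is lam |p - z q|^2 / Im z with z = rho + i eta; the two hypotheses
    bound the real and imaginary parts of the Riccati residual.  If both vanished,
    the form would be exactly conserved. *)
Lemma wkb_form_rate al rho eta drho deta lam nu p q : 0 < eta -> 0 <= lam ->
  `|drho + rho ^+ 2 - eta ^+ 2 + al ^+ 2 * lam ^+ 2| <= nu ->
  `|deta + 2 * rho * eta| <= nu ->
  `|rate (al ^+ 2 * lam ^+ 2) (lam * eta^-1) (- lam * (rho * eta^-1))
      (lam * (rho * (rho * eta^-1) + eta))
      (lam * (- (deta * eta^-1 ^+ 2)))
      (- lam * (drho * eta^-1 - rho * (deta * eta^-1 ^+ 2)))
      (lam * (drho * (rho * eta^-1) + rho * (drho * eta^-1 - rho * (deta * eta^-1 ^+ 2))
         + deta)) p q|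
  <= (4 * nu / eta) * quad (lam * eta^-1) (- lam * (rho * eta^-1))
      (lam * (rho * (rho * eta^-1) + eta)) p q.
Proof.
move=> eta0 lam0; set r1 := drho + _ - _ + _; set r2 := deta + _ => h1 h2.
have en : eta != 0 by rewrite gt_eqF.
pose W := p - rho * q; pose S := W ^+ 2 / eta + eta * q ^+ 2.
have -> : rate (al ^+ 2 * lam ^+ 2) (lam * eta^-1) (- lam * (rho * eta^-1))
      (lam * (rho * (rho * eta^-1) + eta))
      (lam * (- (deta * eta^-1 ^+ 2)))
      (- lam * (drho * eta^-1 - rho * (deta * eta^-1 ^+ 2)))
      (lam * (drho * (rho * eta^-1) + rho * (drho * eta^-1 - rho * (deta * eta^-1 ^+ 2))
         + deta)) p q =
   lam / eta * (- (r2 * S) + (- (r1 * (2 * W * q)) + r2 * (2 * (eta * q ^+ 2)))).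
  by rewrite /rate /quad /S /W /r1 /r2; field.
have -> : quad (lam * eta^-1) (- lam * (rho * eta^-1))
      (lam * (rho * (rho * eta^-1) + eta)) p q = lam * S.
  by rewrite /quad /S /W; field.
have W0 : 0 <= W ^+ 2 / eta by rewrite divr_ge0 ?sqr_ge0// ltW.
have q0 : 0 <= eta * q ^+ 2 by rewrite mulr_ge0 ?sqr_ge0// ltW.
have S0 : 0 <= S by rewrite addr_ge0.
have Wq : `|2 * W * q| <= S.
  have e1 : 0 <= eta^-1 by rewrite invr_ge0 ltW.
  have := mulr_ge0 e1 (sqr_ge0 (W + eta * q)).
  have := mulr_ge0 e1 (sqr_ge0 (W - eta * q)).
  have -> : eta^-1 * (W - eta * q) ^+ 2 = S - 2 * W * q by rewrite /S; field.
  have -> : eta^-1 * (W + eta * q) ^+ 2 = S + 2 * W * q by rewrite /S; field.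
  by rewrite ler_norml => *; apply/andP; split; lra.
have le0 : 0 <= lam / eta by rewrite divr_ge0// ltW.
rewrite normrM (ger0_norm le0).
have -> : 4 * nu / eta * (lam * S) = lam / eta * (nu * S + (nu * S + nu * (2 * S))) by ring.
rewrite ler_wpM2l//; apply: le_trans (ler_normD _ _) _; apply: lerD.
  by rewrite normrN normrM (ger0_norm S0) ler_wpM2r.
apply: le_trans (ler_normD _ _) _; apply: lerD.
  by rewrite normrN normrM ler_pM.
rewrite normrM; apply: ler_pM => //.
rewrite ger0_norm; first by rewrite /S; lra.
by rewrite mulr_ge0.
Qed.

Lemma wkb_form_bound (a0 a1 al rho eta lam p q : R) : 0 < a0 -> 0 < lam ->
  a0 <= al -> al <= a1 -> `|rho| <= lam * (a0 / 2) -> `|eta - lam * al| <= lam * (a0 / 2) ->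
  (4 * a1 + 2 / a0 + a0)^-1 * (p ^+ 2 + lam ^+ 2 * q ^+ 2) <=
  quad (lam * eta^-1) (- lam * (rho * eta^-1)) (lam * (rho * (rho * eta^-1) + eta)) p q <=
  (4 / a0 + 3 * a1) * (p ^+ 2 + lam ^+ 2 * q ^+ 2).
Proof.
move=> a00 lam0 al0 al1 rhob etab.
have la : lam * a0 <= lam * al by rewrite ler_pM2l.
have la1 : lam * al <= lam * a1 by rewrite ler_pM2l.
have etal : lam * (a0 / 2) <= eta by move: etab; rewrite ler_norml; lra.
have etau : eta <= 2 * a1 * lam.
  move: etab; rewrite ler_norml => /andP[_ h].
  have : lam * a0 <= lam * a1 by exact: le_trans la1.
  have : 0 < lam * a0 by rewrite mulr_gt0.
  lra.
have hl0 : 0 < lam * (a0 / 2) by rewrite mulr_gt0// divr_gt0.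
have eta0 : 0 < eta by exact: lt_le_trans etal.
have en : eta != 0 by rewrite gt_eqF.
have a10 : 0 < a1 by exact: lt_le_trans (le_trans al0 al1).
pose W := p - rho * q; pose Y := lam / eta * W ^+ 2; pose Z := lam * eta * q ^+ 2.
have -> : quad (lam * eta^-1) (- lam * (rho * eta^-1))
    (lam * (rho * (rho * eta^-1) + eta)) p q = Y + Z.
  by rewrite /quad /Y /Z /W; field.
have W0 := sqr_ge0 W; have p0 := sqr_ge0 p; have q0 := sqr_ge0 q.
have l2q : 0 <= lam ^+ 2 * q ^+ 2 by rewrite mulr_ge0 ?sqr_ge0.
have rho2 : rho ^+ 2 * q ^+ 2 <= (a0 ^+ 2 / 4) * (lam ^+ 2 * q ^+ 2).
  have -> : (a0 ^+ 2 / 4) * (lam ^+ 2 * q ^+ 2) = (lam * (a0 / 2)) ^+ 2 * q ^+ 2 by field.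
  rewrite ler_wpM2r// -[X in X <= _]real_normK ?num_real// lerXn2r ?nnegrE//.
  exact: ltW.
have Y1 : Y <= 2 / a0 * W ^+ 2.
  rewrite /Y ler_wpM2r// ler_pdivrMr// -mulrA [X in _ <= X]mulrC.
  have -> : a0^-1 * eta * 2 = eta * (2 / a0) by ring.
  by rewrite -ler_pdivrMr ?divr_gt0// invf_div.
have Y2 : W ^+ 2 <= 2 * a1 * Y.
  rewrite /Y mulrA -[X in X <= _]mul1r ler_wpM2r//.
  by rewrite mulrA ler_pdivlMr// mul1r.
have Z1 : Z <= 2 * a1 * (lam ^+ 2 * q ^+ 2).
  have -> : 2 * a1 * (lam ^+ 2 * q ^+ 2) = lam * (2 * a1 * lam) * q ^+ 2 by ring.
  by rewrite /Z ler_wpM2r// ler_pM2l.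
have Z2 : a0 / 2 * (lam ^+ 2 * q ^+ 2) <= Z.
  have -> : a0 / 2 * (lam ^+ 2 * q ^+ 2) = lam * (lam * (a0 / 2)) * q ^+ 2 by ring.
  by rewrite /Z ler_wpM2r// ler_pM2l.
have sqD u v : (u + v) ^+ 2 <= 2 * u ^+ 2 + 2 * v ^+ 2 :> R.
  by have := sqr_ge0 (u - v); rewrite sqrrB sqrrD; lra.
have sq1 : W ^+ 2 <= 2 * p ^+ 2 + 2 * (rho ^+ 2 * q ^+ 2).
  by have := sqD p (- (rho * q)); rewrite sqrrN exprMn.
have sq2 : p ^+ 2 <= 2 * W ^+ 2 + 2 * (rho ^+ 2 * q ^+ 2).
  by have := sqD W (rho * q); rewrite subrK exprMn.
have a0i : 0 < 2 / a0 by rewrite divr_gt0.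
set L := lam ^+ 2 * q ^+ 2 in l2q rho2 Z1 Z2 *.
apply/andP; split.
  rewrite mulrC ler_pdivrMr; last by rewrite !addr_gt0// mulr_gt0.
  have YM : 4 * a1 * Y <= Y * (4 * a1 + 2 / a0 + a0).
    rewrite mulrC ler_wpM2l//; last by rewrite -addrA lerDl addr_ge0// ltW.
    by rewrite /Y mulr_ge0// divr_ge0// ltW.
  have Z0 : 0 <= Z by apply: le_trans Z2; rewrite mulr_ge0// divr_ge0// ltW.
  have a1Z : 0 <= a1 * Z by rewrite mulr_ge0// ltW.
  have L1 : L <= 2 / a0 * Z.
    have := ler_wpM2l (ltW a0i) Z2; rewrite mulrA.
    have -> : 2 / a0 * (a0 / 2) = 1 by field; rewrite gt_eqF.
    by rewrite mul1r.
  have L2 : a0 ^+ 2 / 4 * L <= a0 / 2 * Z.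
    have -> : a0 ^+ 2 / 4 * L = a0 / 2 * (a0 / 2 * L) by field.
    by rewrite ler_wpM2l// divr_ge0// ltW.
  lra.
have Y3 : 2 / a0 * W ^+ 2 <= 2 / a0 * (2 * p ^+ 2 + a0 ^+ 2 / 2 * L).
  apply: ler_wpM2l; [exact: ltW|lra].
have E : 2 / a0 * (2 * p ^+ 2 + a0 ^+ 2 / 2 * L) = 4 / a0 * p ^+ 2 + a0 * L.
  by field; rewrite gt_eqF.
have aL : a0 * L <= a1 * L by rewrite ler_wpM2r// (le_trans al0).
have ap : 0 <= a1 * p ^+ 2 by rewrite mulr_ge0// ltW.
have aiL : 0 <= a0^-1 * L by rewrite mulr_ge0// invr_ge0 ltW.
lra.
Qed.

End WKBForm.

(** * Symbol bounds for the speed *)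

Section ConditionIII.
Variable R : realType.
Local Notation mu := (@lebesgue_measure R).
Variables (a : R -> R) (a0 a1 : R).
Hypotheses (a00 : 0 < a0) (ha : forall t : R, 0 <= t -> a0 <= a t /\ a t <= a1).

Let ha' (t : R) : 0 <= t -> 0 < a t <= a1.
Proof. by move=> /ha[h1 ->]; rewrite (lt_le_trans a00 h1). Qed.

Lemma Cn_hl_symbol (Xi : R -> R) (m : nat) : (forall t : R, 0 <= t -> 0 < Xi t) ->
  Cn_hl m a ->
  (forall k, (1 <= k <= m)%N -> exists Ck : R, 0 < Ck /\
     forall t : R, 0 <= t -> `|deriven_hl k a t| <= Ck * Xi t ^- k) ->
  symbol (fun t => (Xi t)^-1) m 0 a.
Proof.
move=> Xi0 [Da _] bnd.
suff H n k : (n + k = m)%N -> symbol (fun t => (Xi t)^-1) n k (deriven_hl k a).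
  by apply: (H m 0%N); rewrite addn0.
have bound j : (j <= m)%N -> exists C : R, forall t : R, 0 < t ->
    `|deriven_hl j a t| <= C * (Xi t)^-1 ^+ j.
  case: j => [|j] jm.
    exists a1 => t t0; have /andP[at0 at1] := ha' (ltW t0).
    by rewrite expr0 mulr1 /= gtr0_norm.
  have [Ck [_ HCk]] := bnd j.+1 jm; exists Ck => t t0.
  by rewrite exprVn; exact: HCk (ltW t0).
elim: n k => [|n IH] k nk; first by split => //; apply: bound; rewrite -nk.
split; first by apply: bound; rewrite -nk leq_addl.
exists (deriven_hl k.+1 a); last by apply: IH; rewrite addnS -nk.
move=> t t0; apply: derive_hlP => //; apply: Da; last exact: ltW.
by rewrite -nk addSn ltnS leq_addl.
Qed.

Lemma derivable_measurable (da : R -> R) :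
  (forall t : R, 0 < t -> is_derive t 1 a (da t)) -> measurable_fun (halfline R) a.
Proof.
move=> Da.
have -> : halfline R = [set 0] `|` `]0%R, +oo[%classic.
  apply/seteqP; split => t; rewrite /halfline /= !in_itv /= !andbT.
    by rewrite le_eqVlt => /predU1P[<-|]; [left|right].
  by move=> [->|/ltW//]; rewrite lexx.
apply/measurable_funU => //; split; first exact: measurable_fun_set1.
apply: open_continuous_measurable_fun; first exact: interval_open.
move=> t; rewrite inE /= in_itv /= andbT => t0.
by have [/derivable1_diffP/differentiable_continuous] := Da t t0.
Qed.

End ConditionIII.

(** * The WKB form at large frequency *)

Section HighFrequency.
Variable R : realType.
Local Notation mu := (@lebesgue_measure R).
Variables (a x : R -> R) (a0 a1 X0 C lam N1 : R) (m : nat) (z dz : nat -> R -> R).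
Hypotheses (a00 : 0 < a0) (lam0 : 0 < lam) (m0 : (0 < m)%N) (C0 : 0 <= C)
  (ha : forall t : R, 0 < t -> a0 <= a t /\ a t <= a1)
  (hx : forall t : R, 0 < t -> 0 <= x t <= X0)
  (N1_ge1 : 1 <= N1) (N1_large : 2 * m%:R * C / a0 <= N1)
  (z0 : z 0%N = a)
  (z_bound : forall j (t : R), (j < m)%N -> 0 < t -> `|z j t| <= C * x t ^+ j)
  (dz_bound : forall j (t : R), (j < m)%N -> 0 < t -> `|dz j t| <= C * x t ^+ j.+1)
  (z_derive : forall j (t : R), (j < m)%N -> 0 < t -> is_derive t 1 (z j) (dz j t))
  (z_rec : forall j (t : R), (j.+1 < m)%N -> 0 < t ->
     dz j t + \sum_(i < j.+2) z i t * z (j.+1 - i)%N t = 0).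

Definition wkb_rho (t : R) := \sum_(j < m) z j t * complex.Re (wkb_mode lam j).
Definition wkb_eta (t : R) := \sum_(j < m) z j t * complex.Im (wkb_mode lam j).
Let drho (t : R) := \sum_(j < m) dz j t * complex.Re (wkb_mode lam j).
Let deta (t : R) := \sum_(j < m) dz j t * complex.Im (wkb_mode lam j).
Let Knu : R := (2 * m)%:R * (C + (2 * m)%:R * C ^+ 2).
Let nu (t : R) := Knu * lam ^+ 2 * (x t / lam) ^+ m.

(** lam / x(t) >= N1, written without dividing by x(t), which may vanish. *)
Definition high (t : R) := 0 < t /\ N1 * x t <= lam.

Let x_le t : high t -> x t <= lam.
Proof.
move=> [t0 h]; have /andP[xt _] := hx t0.
by apply: le_trans h; rewrite ler_peMl.
Qed.

Lemma wkb_phase_bound t : high t ->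
  `|wkb_rho t| <= lam * (a0 / 2) /\ `|wkb_eta t - lam * a t| <= lam * (a0 / 2).
Proof.
move=> ht; have [t0 h] := ht; have /andP[xt _] := hx t0.
have zb j : (j < m)%N -> `|z j t| <= C * x t ^+ j by move=> jm; exact: z_bound.
have := wkb_leading lam0 m0 C0 xt (x_le ht) zb.
set w := _ - _ => wb.
have small : m%:R * C * x t <= lam * (a0 / 2).
  have h1 : 2 * m%:R * C <= N1 * a0 by rewrite -ler_pdivrMr.
  have h2 : 2 * m%:R * C * x t <= N1 * a0 * x t by rewrite ler_wpM2r.
  have h3 : N1 * x t * a0 <= lam * a0 by rewrite ler_pM2r.
  lra.
have hRe := le_trans (normc_Re w) (le_trans wb small).
have hIm := le_trans (normc_Im w) (le_trans wb small).
have eRe : complex.Re w = wkb_rho t.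
  rewrite /w /wkb_rho -(wkb_Re lam m (fun j => z j t)).
  by case: (wkb_sum _ _ _) => ? ? /=; rewrite subr0.
have eIm : complex.Im w = wkb_eta t - lam * a t.
  rewrite /w /wkb_eta -(wkb_Im lam m (fun j => z j t)) z0.
  by case: (wkb_sum _ _ _) => ? ? /=.
by rewrite -eRe -eIm.
Qed.

Lemma wkb_phase_residual t : high t ->
  `|drho t + wkb_rho t ^+ 2 - wkb_eta t ^+ 2 + a t ^+ 2 * lam ^+ 2| <= nu t /\
  `|deta t + 2 * wkb_rho t * wkb_eta t| <= nu t.
Proof.
move=> ht; have [t0 h] := ht; have /andP[xt _] := hx t0.
have zb j : (j < m)%N -> `|z j t| <= C * x t ^+ j by move=> jm; exact: z_bound.
have dzb j : (j < m)%N -> `|dz j t| <= C * x t ^+ j.+1 by move=> jm; exact: dz_bound.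
have zr j : (j.+1 < m)%N -> dz j t + \sum_(i < j.+2) z i t * z (j.+1 - i)%N t = 0.
  by move=> jm; exact: z_rec.
have := @wkb_residual R lam lam0 m (fun j => z j t) (fun j => dz j t) C (x t)
  m0 C0 xt (x_le ht) zb dzb zr.
rewrite -/Knu -/(nu t); set w := _ + _ + _ => wb.
have hRe := le_trans (normc_Re w) wb.
have hIm := le_trans (normc_Im w) wb.
have sE (y : nat -> R) : wkb_sum lam m y =
   ((\sum_(j < m) y j * complex.Re (wkb_mode lam j))%R +i*
    (\sum_(j < m) y j * complex.Im (wkb_mode lam j))%R)%C.
  by rewrite -(wkb_Re lam m y) -(wkb_Im lam m y); case: (wkb_sum _ _ _).
have wE : w = ((drho t + wkb_rho t ^+ 2 - wkb_eta t ^+ 2 + a t ^+ 2 * lam ^+ 2) +i*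
    (deta t + 2 * wkb_rho t * wkb_eta t))%C.
  rewrite /w !sE -/(wkb_rho t) -/(wkb_eta t) -/(drho t) -/(deta t) z0 expr2 /=.
  by apply/eqP; rewrite eq_complex /=; apply/andP; split; apply/eqP; ring.
by move: hRe hIm; rewrite wE.
Qed.

Lemma wkb_eta_lower t : high t -> lam * (a0 / 2) <= wkb_eta t.
Proof.
move=> ht; have [_ h2] := wkb_phase_bound ht; have [at0 _] := ha ht.1.
have : lam * a0 <= lam * a t by rewrite ler_pM2l.
by move: h2; rewrite ler_norml; lra.
Qed.

Let hl0 : 0 < lam * (a0 / 2). Proof. by rewrite mulr_gt0// divr_gt0. Qed.

Definition wkb_A (t : R) := lam * (wkb_eta t)^-1.
Definition wkb_B (t : R) := - lam * (wkb_rho t * (wkb_eta t)^-1).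
Definition wkb_G (t : R) :=
  lam * (wkb_rho t * (wkb_rho t * (wkb_eta t)^-1) + wkb_eta t).

Lemma wkb_quad_bound (t p q : R) : high t ->
  (4 * a1 + 2 / a0 + a0)^-1 * (p ^+ 2 + lam ^+ 2 * q ^+ 2) <=
  quad (wkb_A t) (wkb_B t) (wkb_G t) p q <=
  (4 / a0 + 3 * a1) * (p ^+ 2 + lam ^+ 2 * q ^+ 2).
Proof.
move=> ht; have [h1 h2] := wkb_phase_bound ht; have [at0 at1] := ha ht.1.
exact: (wkb_form_bound _ _ a00 lam0 at0 at1 h1 h2).
Qed.

Let mode_derive (F : R[i] -> R) (t : R) : 0 < t -> is_derive t 1
  (fun s => \sum_(j < m) z j s * F (wkb_mode lam j))
  (\sum_(j < m) dz j t * F (wkb_mode lam j)).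
Proof.
move=> t0.
have -> : (fun s => \sum_(j < m) z j s * F (wkb_mode lam j)) =
    \sum_(j < m) (fun s => z j s * F (wkb_mode lam j)).
  by apply/funext => s; rewrite fct_sumE.
apply: is_derive_sum => j.
have -> : (fun s => z j s * F (wkb_mode lam j)) = F (wkb_mode lam j) *: z j.
  by apply/funext => s; rewrite /= mulrC.
apply: is_derive_eq (is_deriveZ _ (z_derive (ltn_ord j) t0)) _.
by rewrite /GRing.scale /= mulrC.
Qed.

Lemma wkb_coef_derive t : high t -> [/\
  is_derive t 1 wkb_A (lam * (- (deta t * (wkb_eta t)^-1 ^+ 2))),
  is_derive t 1 wkb_B (- lam * (drho t * (wkb_eta t)^-1
     - wkb_rho t * (deta t * (wkb_eta t)^-1 ^+ 2))) &
  is_derive t 1 wkb_G (lam * (drho t * (wkb_rho t * (wkb_eta t)^-1)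
     + wkb_rho t * (drho t * (wkb_eta t)^-1 - wkb_rho t * (deta t * (wkb_eta t)^-1 ^+ 2))
     + deta t))].
Proof.
move=> ht; have t0 := ht.1.
have Dr : is_derive t 1 wkb_rho (drho t) by exact: mode_derive.
have De : is_derive t 1 wkb_eta (deta t) by exact: mode_derive.
have e0 : wkb_eta t != 0 by rewrite gt_eqF// (lt_le_trans hl0)// wkb_eta_lower.
have Di : is_derive t 1 (fun s => (wkb_eta s)^-1) (- (deta t * (wkb_eta t)^-1 ^+ 2)).
  apply: is_derive_eq (is_deriveV e0 De) _.
  by rewrite /GRing.scale /=; field.
have Dri : is_derive t 1 (fun s => wkb_rho s * (wkb_eta s)^-1)
   (drho t * (wkb_eta t)^-1 - wkb_rho t * (deta t * (wkb_eta t)^-1 ^+ 2)).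
  apply: is_derive_eq (is_deriveM Dr Di) _.
  by rewrite /GRing.scale /=; ring.
split.
- exact: (is_deriveZ lam Di).
- exact: (is_deriveZ (- lam) Dri).
apply: is_derive_eq (is_deriveZ lam (is_deriveD (is_deriveM Dr Dri) De)) _.
by rewrite /GRing.scale /=; ring.
Qed.

Lemma wkb_blip (I : R -> Prop) : (forall t, I t -> high t) ->
  [/\ blip I wkb_A, blip I wkb_B & blip I wkb_G].
Proof.
move=> Ih.
have X00 : 0 <= X0 by have /andP[h1 h2] := hx ltr01; exact: le_trans h2.
have xX (t : R) k : 0 < t -> x t ^+ k <= X0 ^+ k.
  by move=> /hx/andP[h1 h2]; rewrite lerXn2r ?nnegrE.
have zblip (j : 'I_m) : blip I (z j).
  apply: (@blip_sub _ I (fun t => 0 < t)); first by move=> t /Ih[].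
  exists (C * X0 ^+ j + C * X0 ^+ j.+1).
  have e1 : 0 <= C * X0 ^+ j by rewrite mulr_ge0// exprn_ge0.
  have e2 : 0 <= C * X0 ^+ j.+1 by rewrite mulr_ge0// exprn_ge0.
  split; first exact: addr_ge0.
  move=> s t s0 t0; split.
    apply: le_trans (z_bound (ltn_ord j) t0) _.
    by apply: (@le_trans _ _ (C * X0 ^+ j)); rewrite ?lerDl// ler_wpM2l// xX.
  apply: le_trans (derive_bounded_lipschitz (K := C * X0 ^+ j.+1)
    (fun t => z_derive (ltn_ord j)) _ s0 t0) _; last by rewrite ler_wpM2r// lerDr.
  by move=> r r0; apply: le_trans (dz_bound (ltn_ord j) r0) _; rewrite ler_wpM2l// xX.
have rblip : blip I wkb_rho.
  by apply: blip_sum => j; apply: blipM; [exact: zblip|exact: blip_cst].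
have eblip : blip I wkb_eta.
  by apply: blip_sum => j; apply: blipM; [exact: zblip|exact: blip_cst].
have iblip : blip I (fun t => (wkb_eta t)^-1).
  by apply: (blip_inv hl0) => // t /Ih; exact: wkb_eta_lower.
have riblip : blip I (fun t => wkb_rho t * (wkb_eta t)^-1) by exact: blipM.
split.
- by apply: blipM => //; exact: blip_cst.
- by apply: blipM => //; exact: blip_cst.
by apply: blipM; [exact: blip_cst|apply: blipD => //; exact: blipM].
Qed.

Definition wkb_rate : R := 8 * Knu / a0 * lam * lam^-1 ^+ m.

Lemma wkb_rate_ge0 : 0 <= wkb_rate.
Proof.
have K0 : 0 <= Knu by rewrite mulr_ge0// addr_ge0// mulr_ge0// sqr_ge0.
have l1 : 0 <= lam^-1 ^+ m by rewrite exprn_ge0// invr_ge0 ltW.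
by rewrite mulr_ge0// mulr_ge0 ?(ltW lam0)// divr_ge0 ?(ltW a00)// mulr_ge0.
Qed.

Lemma wkb_dissipative (sg : R) (h : R -> R) (t : R) : sign sg -> high t ->
  is_derive t 1 h (wkb_rate * x t ^+ m) ->
  sdissipative a (lam ^+ 2) sg (fun t => expR (- sg * h t) * wkb_A t)
    (fun t => expR (- sg * h t) * wkb_B t) (fun t => expR (- sg * h t) * wkb_G t) t.
Proof.
move=> hsg ht hh; have [DA DB DG] := wkb_coef_derive ht.
apply: (weighted_sdissipative hsg DA DB DG hh) => p q.
have [r1 r2] := wkb_phase_residual ht.
have el := wkb_eta_lower ht; have e0 : 0 < wkb_eta t := lt_le_trans hl0 el.
apply: le_trans (wkb_form_rate p q e0 (ltW lam0) r1 r2) _.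
have /andP[q0 _] := wkb_quad_bound p q ht.
have qpos : 0 <= quad (wkb_A t) (wkb_B t) (wkb_G t) p q.
  apply: le_trans q0; have [at0 at1] := ha ht.1.
  have a10 : 0 < a1 := lt_le_trans a00 (le_trans at0 at1).
  rewrite mulr_ge0//; last by rewrite addr_ge0 ?sqr_ge0// mulr_ge0 ?sqr_ge0.
  by rewrite invr_ge0 !addr_ge0 ?(ltW a00)// ?divr_ge0 ?(ltW a00)// mulr_ge0 ?(ltW a10).
rewrite -/(wkb_A t) -/(wkb_B t) -/(wkb_G t) ler_wpM2r//.
have /andP[xt _] := hx ht.1.
have K0 : 0 <= Knu by rewrite mulr_ge0// addr_ge0// mulr_ge0// sqr_ge0.
have nu0 : 0 <= 4 * nu t.
  rewrite mulr_ge0// mulr_ge0//; first by rewrite mulr_ge0 ?sqr_ge0.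
  by rewrite exprn_ge0// divr_ge0// ltW.
apply: (@le_trans _ _ (4 * nu t / (lam * (a0 / 2)))).
  by rewrite ler_wpM2l// lef_pV2 ?posrE.
rewrite /nu /wkb_rate exprMn le_eqVlt; apply/orP; left; apply/eqP.
by move: (lam^-1 ^+ m) => y; field; rewrite !gt_eqF.
Qed.

End HighFrequency.

(** * Joining the two regimes *)

Section ConditionIIIMain.
Variable R : realType.
Local Notation mu := (@lebesgue_measure R).

Lemma uniform_constant (m : nat) (Q : nat -> R -> Prop) :
  (forall j (C D : R), (j < m)%N -> C <= D -> Q j C -> Q j D) ->
  (forall j, (j < m)%N -> exists2 C : R, 0 <= C & Q j C) ->
  exists2 C : R, 0 <= C & forall j, (j < m)%N -> Q j C.
Proof.
move=> mono ex.
have /choice[F HF] : forall j : 'I_m, exists C : R, 0 <= C /\ Q j C.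
  by move=> j; have [C ? ?] := ex j (ltn_ord j); exists C.
exists (\sum_j F j); first by apply: sumr_ge0 => j _; have [] := HF j.
move=> j jm; have [_ Qj] := HF (Ordinal jm).
apply: mono Qj => //; rewrite (bigD1 (Ordinal jm)) //= lerDl sumr_ge0// => i _.
by have [] := HF i.
Qed.

Variables (a : R -> R) (a0 a1 : R).
Hypotheses (a00 : 0 < a0) (ha : forall t : R, 0 <= t -> a0 <= a t /\ a t <= a1).

Let ha' (t : R) : 0 <= t -> 0 < a t <= a1.
Proof. by move=> /ha[h1 ->]; rewrite (lt_le_trans a00 h1). Qed.

(** The regimes are separated by lam Theta(t) = N.  Below, the deviation from ainf
    contributes at most lam Theta(t) < N to the weight.  Above, lam Xi(t) is large
    because Theta <= K0 Xi, and the weight lam^(1-m) T(t), with T the tail of Xi^-m,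
    is at most Theta(t)^(m-1) T(t) because 1/lam <= Theta(t). *)
Lemma condition_iii_lyapunov (Lam : R) : 0 <= Lam -> condition_iii a ->
  uniformly_lyapunov a Lam.
Proof.
move=> Lam0 [m [ Theta [Xi [m2 [[Th0 Thmono] [[Xi0 Ximono] [Cm rest]]]]]]].
move: rest => [[ainf [ainf0 stab]] [bnd [[K0 [K00 ThXi]] [intXi supb]]]].
have m0 : (0 < m)%N by exact: ltn_trans m2.
have a10 : 0 < a1 by have /andP[h1 h2] := ha' (lexx 0); exact: lt_le_trans h2.
have hapos (t : R) : 0 < t -> a0 <= a t /\ a t <= a1 by move=> /ltW; exact: ha.
pose x (t : R) := (Xi t)^-1.
pose X0 := (Xi 0)^-1.
have hx (t : R) : 0 < t -> 0 <= x t <= X0.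
  move=> t0; rewrite invr_ge0 (ltW (Xi0 _ (ltW t0)))/=.
  by rewrite lef_pV2 ?posrE ?Xi0 ?Ximono// ltW.
have x_ge0 (t : R) : 0 < t -> 0 <= x t by move=> /hx/andP[].
have X00 : 0 <= X0 by rewrite invr_ge0 ltW// Xi0.
have sa : symbol x m 0 a by exact: (Cn_hl_symbol a00 ha Xi0 Cm bnd).
have Jm : (m.-1 < m)%N by rewrite prednK.
have [z [dz [z0 sz Hz sdz rec]]] :=
  wkb_coefficients a00 (fun t t0 => (hapos t t0).1) sa Jm.
have jJ j : (j < m)%N -> (j <= m.-1)%N by move=> jm; rewrite -ltnS prednK.
have [C Cge0 HC] : exists2 C : R, 0 <= C & forall j, (j < m)%N ->
    forall t : R, 0 < t -> `|z j t| <= C * x t ^+ j /\ `|dz j t| <= C * x t ^+ j.+1.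
  apply: uniform_constant.
    move=> j C D _ CD H t t0; have [h1 h2] := H t t0.
    by split; [apply: le_trans h1 _|apply: le_trans h2 _];
      rewrite ler_wpM2r// exprn_ge0// x_ge0.
  move=> j jm; have [C1 C10 H1] := symbol_bound x_ge0 (sz j (jJ j jm)).
  have [C2 C20 H2] := symbol_bound x_ge0 (sdz j (jJ j jm)).
  exists (C1 + C2); first exact: addr_ge0.
  move=> t t0; split; [apply: le_trans (H1 t t0) _|apply: le_trans (H2 t t0) _];
    by rewrite ler_wpM2r ?exprn_ge0 ?x_ge0// ?lerDl ?lerDr.
have z_bound j (t : R) : (j < m)%N -> 0 < t -> `|z j t| <= C * x t ^+ j.
  by move=> jm t0; exact: (HC j jm t t0).1.
have dz_bound j (t : R) : (j < m)%N -> 0 < t -> `|dz j t| <= C * x t ^+ j.+1.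
  by move=> jm t0; exact: (HC j jm t t0).2.
have z_derive j (t : R) : (j < m)%N -> 0 < t -> is_derive t 1 (z j) (dz j t).
  by move=> jm; apply: Hz; exact: jJ.
have z_rec j (t : R) : (j.+1 < m)%N -> 0 < t ->
    dz j t + \sum_(i < j.+2) z i t * z (j.+1 - i)%N t = 0.
  by move=> jm; apply: rec; rewrite -ltnS prednK.
have brep : borel_representative a a.
  split; last by apply: aeW.
  apply: (@derivable_measurable _ a (dz 0%N)) => t t0.
  by rewrite -z0; exact: z_derive.
have [G [GTheta [KG KG0 Glip] Gder]] := deviation_primitive ainf0 ha' brep stab.
have G0 (t : R) : 0 < t -> 0 <= G t by move=> /GTheta/andP[].
pose g (t : R) := Xi t ^- m.
have g_bound (t : R) : 0 < t -> 0 <= g t <= X0 ^+ m.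
  move=> t0; have /andP[h1 h2] := hx t t0.
  by rewrite /g -exprVn -/(x t) exprn_ge0//= lerXn2r ?nnegrE.
have [T [TE [H H0 TH] Tlip Tder]] := tail_primitive (g := g) intXi g_bound.
have [S S0 HS] : exists2 S : R, 0 <= S & forall t : R, 0 < t ->
    Theta t ^+ m.-1 * T t <= S.
  move: supb; set s := ereal_sup _ => sfin.
  have ub (t : R) : 0 < t -> ((Theta t ^+ m.-1 * T t)%:E <= s)%E.
    move=> t0; rewrite EFinM TE//; apply: ereal_sup_ubound; exists t => //.
    by rewrite /halfline /= in_itv /= andbT ltW.
  have sfn : s \is a fin_num.
    rewrite fin_numE; apply/andP; split; last by rewrite lt_eqF.
    by rewrite gt_eqF// (lt_le_trans _ (ub 1 ltr01))// ltNyr.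
  have le (t : R) : 0 < t -> Theta t ^+ m.-1 * T t <= fine s.
    by move=> t0; rewrite -lee_fin fineK//; exact: ub.
  exists (fine s) => //; apply: le_trans (le 1 ltr01).
  rewrite mulr_ge0//; first by rewrite exprn_ge0// ltW// Th0.
  by have /andP[] := TH 1 ltr01.
(* N1 makes the WKB correction at most half of the leading term i lam a, and N is
   such that lam Theta >= N implies lam Xi >= N1. *)
pose N1 := Num.max 1 (2 * m%:R * C / a0).
have N1_ge1 : 1 <= N1 by rewrite le_max lexx.
have N1_large : 2 * m%:R * C / a0 <= N1 by rewrite le_max lexx orbT.
pose N := Num.max 1 (K0 * N1).
have N_ge1 : 1 <= N by rewrite le_max lexx.
have N0 : 0 <= N by exact: le_trans N_ge1.
pose H1 := (a1 + ainf) / ainf * N.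
pose k2 := 8 * ((2 * m)%:R * (C + (2 * m)%:R * C ^+ 2)) / a0.
pose H2 := k2 * S.
pose c1 := expR (- H1) * Num.min 1 (ainf ^+ 2).
pose C1 := expR H1 * Num.max 1 (ainf ^+ 2).
pose c2 := expR (- H2) * (4 * a1 + 2 / a0 + a0)^-1.
pose C2 := expR H2 * (4 / a0 + 3 * a1).
have minp : 0 < Num.min 1 (ainf ^+ 2) by rewrite lt_min ltr01 exprn_gt0.
have c1p : 0 < c1 by rewrite mulr_gt0 ?expR_gt0.
have M0 : 0 < 4 * a1 + 2 / a0 + a0 by rewrite !addr_gt0// ?divr_gt0// mulr_gt0.
have c2p : 0 < c2 by rewrite mulr_gt0 ?expR_gt0// invr_gt0.
have H10 : 0 <= H1 by rewrite mulr_ge0// divr_ge0 ?(ltW ainf0)// addr_ge0// ltW.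
have k20 : 0 <= k2.
  by rewrite divr_ge0 ?(ltW a00)// mulr_ge0// mulr_ge0// addr_ge0// mulr_ge0// sqr_ge0.
have H20 : 0 <= H2 by rewrite mulr_ge0.
have cC1 : c1 <= C1.
  apply: ler_pM; rewrite ?expR_ge0 ?(ltW minp)//.
    by rewrite ler_expR; lra.
  by rewrite ge_min le_max lexx.
have cC2 : c2 <= C2.
  apply: ler_pM; rewrite ?expR_ge0 ?invr_ge0 ?(ltW M0)//.
    by rewrite ler_expR; lra.
  apply: (@le_trans _ _ a0^-1).
    rewrite lef_pV2 ?posrE// lerDr addr_ge0// ?mulr_ge0 ?(ltW a10)//.
    by rewrite invr_ge0 ltW.
  have ai : 0 < a0^-1 by rewrite invr_gt0.
  by lra.
have C1p : 0 < C1 := lt_le_trans c1p cC1.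
have C2p : 0 < C2 := lt_le_trans c2p cC2.
exists (c2 * c1 / C1), (C2 * C1 / c1); split.
- by apply: divr_gt0 => //; exact: mulr_gt0.
- by apply: divr_gt0 => //; exact: mulr_gt0.
move=> ell sg /andP[ell0 ellLam] hsg.
pose lam := Num.sqrt ell.
have lam_ge0 : 0 <= lam by exact: sqrtr_ge0.
have lam2 : lam ^+ 2 = ell by rewrite sqr_sqrtr.
pose Z (t : R) := lam * Theta t < N : Prop.
have lam_pos (t : R) : ~ Z t -> 0 < lam.
  move=> /negP; rewrite -leNgt => h; rewrite lt_def lam_ge0 andbT.
  apply: contraTneq h => ->; rewrite mul0r -ltNge; exact: lt_le_trans N_ge1.
have Zhigh (t : R) : 0 < t -> ~ Z t -> high x lam N1 t.
  move=> t0 Zt; split => //; have l0 := lam_pos t Zt.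
  move/negP : Zt; rewrite -leNgt => h.
  have Xt : 0 < Xi t by apply: Xi0; exact: ltW.
  rewrite /x ler_pdivrMr//.
  have h1 : K0 * N1 <= lam * Theta t by apply: le_trans h; rewrite le_max lexx orbT.
  have h2 : lam * Theta t <= lam * (K0 * Xi t).
    by rewrite ler_pM2l// ThXi// ltW.
  by rewrite -(ler_pM2l K00) (le_trans h1)// (le_trans h2)// mulrCA.
pose h (t : R) := - (wkb_rate a0 C lam m * T t).
pose E (t : R) := expR (- sg * h t).
have hH (t : R) : 0 < t -> ~ Z t -> `|h t| <= H2.
  move=> t0 Zt; have l0 := lam_pos t Zt; have /andP[T0 _] := TH t t0.
  have r0 : 0 <= wkb_rate a0 C lam m by exact: wkb_rate_ge0.
  rewrite /h normrN ger0_norm; last exact: mulr_ge0.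
  rewrite /wkb_rate -/k2.
  have -> : lam^-1 ^+ m = lam^-1 * lam^-1 ^+ m.-1 by rewrite -exprS prednK.
  have -> : k2 * lam * (lam^-1 * lam^-1 ^+ m.-1) * T t = k2 * (lam^-1 ^+ m.-1 * T t).
    by move: (lam^-1 ^+ m.-1) => y; field; rewrite gt_eqF.
  rewrite /H2 ler_wpM2l//; apply: le_trans (HS t t0); rewrite ler_wpM2r//.
  have Tt : 0 < Theta t by apply: Th0; exact: ltW.
  rewrite lerXn2r ?nnegrE ?invr_ge0 ?(ltW Tt)//.
  rewrite -[X in X <= _]mul1r ler_pdivrMr// mulrC.
  by move/negP : Zt; rewrite -leNgt; exact: le_trans.
pose E1 := stabilized_factor G a1 ainf N ell sg.
have [bA bB bG] : [/\ blip (fun t : R => 0 < t /\ ~ Z t) (wkb_A lam m z),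
    blip (fun t : R => 0 < t /\ ~ Z t) (wkb_B lam m z) &
    blip (fun t : R => 0 < t /\ ~ Z t) (wkb_G lam m z)].
  have [nI|] := pselect (forall t : R, ~ (0 < t /\ ~ Z t)).
    by split; exact: blip_vacuous.
  move=> /existsNP[r /contrapT[_ Zr]].
  apply: (wkb_blip a00 (lam_pos r Zr) m0 Cge0 hapos hx N1_ge1 N1_large z0
    z_bound dz_bound z_derive) => s [s0 Zs]; exact: Zhigh.
have Eblip : blip (fun t : R => 0 < t /\ ~ Z t) E.
  apply: blip_expR; apply: blipM; first exact: blip_cst.
  apply: blipN; apply: blipM; first exact: blip_cst.
  exists (H + X0 ^+ m); have Xm : 0 <= X0 ^+ m by rewrite exprn_ge0.
  split; first exact: addr_ge0.
  move=> s t [s0 _] [t0 _]; have /andP[T0 T1] := TH t t0; split.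
    by rewrite ger0_norm// (le_trans T1)// lerDl.
  by apply: le_trans (Tlip s t s0 t0) _; rewrite ler_wpM2r// lerDr.
apply: (@glue_scaled _ Z a ell sg c1 C1 c2 C2
  (fun t => E1 t * 1) (fun t => E1 t * 0) (fun t => E1 t * (ainf ^+ 2 * ell))
  (fun t => E t * wkb_A lam m z t) (fun t => E t * wkb_B lam m z t)
  (fun t => E t * wkb_G lam m z t)) => //.
- move=> s t s0 st; rewrite /Z; apply: le_lt_trans.
  by rewrite ler_wpM2l// Thmono// ltW.
- move=> t p q t0; apply: scaled_quad_bound => //; [exact: ltW| |].
    apply: weight_bound => //.
    have /andP[h1 h2] := stabilized_weight_bound ell ainf0 ha' G0 N0 t0.
    by rewrite ger0_norm.
  exact: stabilized_quad.
- move=> t p q t0 Zt; apply: scaled_quad_bound => //; [|by apply: weight_bound => //; exact: hH|].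
    by rewrite invr_ge0 ltW.
  rewrite -lam2; exact: (wkb_quad_bound a00 (lam_pos t Zt) m0 Cge0 hapos hx N1_ge1
    N1_large z0 z_bound _ _ (Zhigh t t0 Zt)).
- by move=> I; split; exact: (stabilized_blip a1 ainf ell sg G0 KG0 Glip N0).
- by move=> I; split; exact: blipM.
- apply: ae_mono (stabilized_dissipative N ainf0 ha' Gder ell0 hsg) => t Ht t0 Zt.
  apply: Ht => //; apply: le_lt_trans Zt; rewrite ler_wpM2l//.
  by have /andP[] := GTheta t t0.
apply: ae_mono Tder => t Ht t0 Zt; rewrite -lam2.
apply: (wkb_dissipative a00 (lam_pos t Zt) m0 Cge0 hapos hx N1_ge1 N1_large z0
  z_bound dz_bound z_derive z_rec hsg (Zhigh t t0 Zt)).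
apply: is_derive_eq (is_deriveN (is_deriveZ (wkb_rate a0 C lam m) (Ht t0))) _.
by rewrite /GRing.scale /= mulrN opprK /g /x exprVn.
Qed.

End ConditionIIIMain.

(** * The Hilbert space of square-summable sequences *)

Section SquareSummableSpace.
Variables (R : realType) (d : nat).
Local Notation K := 'rV[int]_d.
Local Notation normc := (@ComplexField.Normc.normc R).
Implicit Types (f g : K -> R[i]) (k : K).

Lemma normc_sqr (w : R[i]) : normc w ^+ 2 = complex.Re w ^+ 2 + complex.Im w ^+ 2.
Proof. by case: w => p q /=; rewrite sqr_sqrtr// addr_ge0 ?sqr_ge0. Qed.

Lemma esumZl (c : R) (h : K -> \bar R) : 0 <= c -> (forall k, (0 <= h k)%E) ->
  (\esum_(k in [set: K]) (c%:E * h k) = c%:E * \esum_(k in [set: K]) h k)%E.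
Proof.
move=> c0 h0.
have le (b : R) (y : K -> \bar R) : 0 < b -> (forall k, (0 <= y k)%E) ->
    (\esum_(k in [set: K]) (b%:E * y k) <= b%:E * \esum_(k in [set: K]) y k)%E.
  move=> b0 y0; apply: ge_ereal_sup => _ [X XT <-].
  rewrite -ge0_mule_fsumr//; apply: lee_pmul => //.
  - by rewrite lee_fin ltW.
  - by apply: fsume_ge0.
  - by apply: ereal_sup_ubound; exists X.
have [->|cn] := eqVneq c 0.
  by rewrite mul0e esum1// => k _; rewrite mul0e.
have cp : 0 < c by rewrite lt_def cn.
apply/eqP; rewrite eq_le le//=.
have ch0 k : (0 <= c%:E * h k)%E by rewrite mule_ge0// lee_fin.
have ci : 0 < c^-1 by rewrite invr_gt0.
have := le c^-1 (fun k => (c%:E * h k)%E) ci ch0.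
rewrite (eq_esum (b := h)); last first.
  by move=> k _; rewrite muleA -EFinM mulVf// mul1e.
move=> H; have := lee_pmul (x1 := c%:E) _ _ (lexx c%:E) H.
rewrite muleA -EFinM mulfV// mul1e; apply; first by rewrite lee_fin.
exact: esum_ge0.
Qed.

Lemma l2sqnorm_ge0 f : (0 <= l2sqnorm f)%E.
Proof. by apply: esum_ge0 => k _; rewrite lee_fin sqr_ge0. Qed.

Lemma in_l2P f : in_l2 f <-> (l2sqnorm f < +oo)%E.
Proof.
rewrite /in_l2 /l2norm; have := l2sqnorm_ge0 f.
by case: (l2sqnorm f) => [r| |] //= _; rewrite !ltry.
Qed.

Lemma in_l2_fin f : in_l2 f -> l2sqnorm f \is a fin_num.
Proof. by move=> /in_l2P h; rewrite ge0_fin_numE// l2sqnorm_ge0. Qed.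

Lemma l2sqnorm_dominated f g h (b c : R) : 0 <= b -> 0 <= c ->
  (forall k, normc (h k) ^+ 2 <= b * normc (f k) ^+ 2 + c * normc (g k) ^+ 2) ->
  in_l2 f -> in_l2 g -> in_l2 h.
Proof.
move=> b0 c0 H /in_l2P hf /in_l2P hg; apply/in_l2P.
apply: (@le_lt_trans _ _ (b%:E * l2sqnorm f + c%:E * l2sqnorm g)%E).
  rewrite /l2sqnorm -!esumZl//; try by move=> k; rewrite lee_fin sqr_ge0.
  rewrite -esumD//; try by move=> k _; rewrite -EFinM lee_fin mulr_ge0 ?sqr_ge0.
  by apply: le_esum => k _; rewrite -!EFinM -EFinD lee_fin.
by rewrite lte_add_pinfty// lte_mul_pinfty// ?lee_fin.
Qed.

Lemma in_l20 : in_l2 (fun _ : K => 0 : R[i]).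
Proof.
apply/in_l2P; rewrite /l2sqnorm esum1//.
by move=> k _; rewrite ComplexField.Normc.normc0 expr0n.
Qed.

Lemma in_l2D f g : in_l2 f -> in_l2 g -> in_l2 (fun k => f k + g k).
Proof.
apply: (@l2sqnorm_dominated _ _ _ 2 2) => // k; rewrite !normc_sqr.
case: (f k) (g k) => [p q] [p' q'] /=.
have := sqr_ge0 (p - p'); have := sqr_ge0 (q - q'); rewrite !sqrrB !sqrrD; lra.
Qed.

Lemma in_l2Z (c : R) f : in_l2 f -> in_l2 (fun k => c%:C%C * f k).
Proof.
move=> hf; apply: (@l2sqnorm_dominated f f _ (c ^+ 2) 0) => //; first exact: sqr_ge0.
move=> k; rewrite !normc_sqr; case: (f k) => p q /=.
by rewrite !mul0r subr0 addr0 !exprMn addr0 -mulrDr.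
Qed.

Record l2 := L2 { l2val :> K -> R[i]; l2P : `[< in_l2 l2val >] }.

Lemma l2_ext (x y : l2) : l2val x = l2val y -> x = y.
Proof.
case: x y => [f hf] [g hg] /= E; subst g.
by congr L2; exact: bool_irrelevance.
Qed.

Definition mk_l2 f (hf : in_l2 f) : l2 := L2 (asboolT hf).

Lemma in_l2_val (x : l2) : in_l2 x. Proof. by case: x => f h; exact/asboolP. Qed.

HB.instance Definition _ := gen_eqMixin l2.
HB.instance Definition _ := gen_choiceMixin l2.

Definition l2_zero : l2 := mk_l2 in_l20.
Definition l2_add (x y : l2) : l2 := mk_l2 (in_l2D (in_l2_val x) (in_l2_val y)).
Definition l2_scale (c : R) (x : l2) : l2 := mk_l2 (in_l2Z c (in_l2_val x)).

Lemma l2_addA : associative l2_add.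
Proof. by move=> x y z; apply/l2_ext/funext => k /=; rewrite addrA. Qed.
Lemma l2_addC : commutative l2_add.
Proof. by move=> x y; apply/l2_ext/funext => k /=; rewrite addrC. Qed.
Lemma l2_add0 : left_id l2_zero l2_add.
Proof. by move=> x; apply/l2_ext/funext => k /=; rewrite add0r. Qed.
Lemma l2_addN : left_inverse l2_zero (l2_scale (-1)) l2_add.
Proof.
move=> x; apply/l2_ext/funext => k /=.
by rewrite rmorphN1 mulN1r addNr.
Qed.

HB.instance Definition _ :=
  GRing.isZmodule.Build l2 l2_addA l2_addC l2_add0 l2_addN.

Lemma l2_scaleA (b c : R) (x : l2) : l2_scale b (l2_scale c x) = l2_scale (b * c) x.
Proof. by apply/l2_ext/funext => k /=; rewrite mulrA -rmorphM. Qed.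
Lemma l2_scale1 : left_id 1 l2_scale.
Proof. by move=> x; apply/l2_ext/funext => k /=; rewrite mul1r. Qed.
Lemma l2_scaleDr : right_distributive l2_scale +%R.
Proof. by move=> c x y; apply/l2_ext/funext => k /=; rewrite mulrDr. Qed.
Lemma l2_scaleDl (x : l2) : {morph l2_scale^~ x : b c / b + c}.
Proof. by move=> b c; apply/l2_ext/funext => k /=; rewrite rmorphD mulrDl. Qed.

HB.instance Definition _ := GRing.Zmodule_isLmodule.Build R l2
  l2_scaleA l2_scale1 l2_scaleDr l2_scaleDl.

Definition l2sqr (x : l2) : R := fine (l2sqnorm x).

Lemma l2sqrE (x : l2) : (l2sqr x)%:E = l2sqnorm x.
Proof. by rewrite fineK// in_l2_fin//; exact: in_l2_val. Qed.

Lemma l2sqr_ge0 (x : l2) : 0 <= l2sqr x.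
Proof. by rewrite -lee_fin l2sqrE l2sqnorm_ge0. Qed.

(** Inequalities between linear combinations of squared norms can be checked
    pointwise.  With polarization this yields all properties of the inner product
    without summing signed families. *)
Lemma l2sqr_comb_ge0 (s : seq (R * l2)) :
  (forall k, 0 <= \sum_(p <- s) p.1 * normc (l2val p.2 k) ^+ 2) ->
  0 <= \sum_(p <- s) p.1 * l2sqr p.2.
Proof.
move=> H.
have part (u : R * l2 -> R) : (forall p, 0 <= u p) ->
    (\esum_(k in [set: K]) (\sum_(p <- s) u p * normc (l2val p.2 k) ^+ 2)%:E =
     (\sum_(p <- s) u p * l2sqr p.2)%:E)%E.
  move=> u0; under eq_esum => k _ do rewrite -sumEFin.
  rewrite esum_sum; last by move=> k p _ _; rewrite lee_fin mulr_ge0 ?sqr_ge0.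
  rewrite -sumEFin; apply: eq_bigr => p _; rewrite EFinM l2sqrE.
  under eq_esum => k _ do rewrite EFinM.
  by rewrite esumZl// => k; rewrite lee_fin sqr_ge0.
pose pos (p : R * l2) := Num.max p.1 0; pose neg (p : R * l2) := Num.max (- p.1) 0.
have posneg p : p.1 = pos p - neg p.
  by rewrite /pos /neg; case: (leP p.1 0) => ?; case: (leP (- p.1) 0) => ?; lra.
have pos0 p : 0 <= pos p by rewrite le_max lexx orbT.
have neg0 p : 0 <= neg p by rewrite le_max lexx orbT.
have split (y : l2 -> R) : \sum_(p <- s) p.1 * y p.2 =
    \sum_(p <- s) pos p * y p.2 - \sum_(p <- s) neg p * y p.2.
  by rewrite -sumrB; apply: eq_bigr => p _; rewrite [in LHS]posneg mulrBl.
rewrite split subr_ge0 -lee_fin -!part//; apply: le_esum => k _.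
by rewrite lee_fin -subr_ge0; have := H k; rewrite (split (fun x => normc (l2val x k) ^+ 2)).
Qed.

Lemma l2sqr_comb_eq0 (s : seq (R * l2)) :
  (forall k, \sum_(p <- s) p.1 * normc (l2val p.2 k) ^+ 2 = 0) ->
  \sum_(p <- s) p.1 * l2sqr p.2 = 0.
Proof.
move=> H; apply/eqP; rewrite eq_le l2sqr_comb_ge0 ?andbT; last by move=> k; rewrite H.
have := @l2sqr_comb_ge0 [seq (- p.1, p.2) | p <- s].
rewrite big_map /=; under eq_bigr do rewrite mulNr.
rewrite sumrN oppr_ge0; apply => k; rewrite big_map /=.
by under eq_bigr do rewrite mulNr; rewrite sumrN H oppr0.
Qed.

(** The real part of the usual Hermitian product: the equation has real
    coefficients, so the real structure is enough. *)
Definition l2ip (x y : l2) : R := (l2sqr (x + y) - l2sqr (x - y)) / 4.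

Lemma l2ip_semi_ip : semi_ip l2ip.
Proof.
split.
- move=> x y; rewrite /l2ip (addrC y).
  have := @l2sqr_comb_eq0 [:: (1, x - y); (-1, y - x)].
  rewrite !big_cons !big_nil /= => H; congr (_ / _); congr (_ - _); apply/eqP.
  rewrite -subr_eq0; apply/eqP; rewrite -[RHS]H; first by ring.
  move=> k; rewrite !big_cons !big_nil !normc_sqr /= rmorphN1 !mulN1r.
  by case: (x k) (y k) => [p q] [p' q'] /=; ring.
- move=> x y w; rewrite /l2ip.
  have := @l2sqr_comb_eq0 [:: (1, x + y + w); (-1, x + y - w); (-1, x + w);
    (1, x - w); (-1, y + w); (1, y - w)].
  rewrite !big_cons !big_nil /= => H; apply/eqP; rewrite -subr_eq0; apply/eqP.
  rewrite -[RHS](mul0r 4^-1) -[in RHS]H; first by field.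
  move=> k; rewrite !big_cons !big_nil !normc_sqr /= rmorphN1 !mulN1r.
  by case: (x k) (y k) (w k) => [p q] [p' q'] [p'' q''] /=; ring.
- move=> c x y; rewrite /l2ip.
  have := @l2sqr_comb_eq0 [:: (1, c *: x + y); (-1, c *: x - y); (- c, x + y);
    (c, x - y)].
  rewrite !big_cons !big_nil /= => H; apply/eqP; rewrite -subr_eq0; apply/eqP.
  rewrite -[RHS](mul0r 4^-1) -[in RHS]H; first by field.
  move=> k; rewrite !big_cons !big_nil !normc_sqr /= rmorphN1 !mulN1r.
  by case: (x k) (y k) => [p q] [p' q'] /=; ring.
move=> x; rewrite /l2ip subrr.
have -> : l2sqr 0 = 0.
  rewrite /l2sqr /l2sqnorm esum1// => k _.
  by rewrite (_ : l2val 0 k = 0)// ComplexField.Normc.normc0 expr0n.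
by rewrite subr0 divr_ge0 ?l2sqr_ge0.
Qed.

Lemma l2ip_sqr (x : l2) : l2ip x x = l2sqr x.
Proof.
rewrite /l2ip subrr.
have := @l2sqr_comb_eq0 [:: (1, x + x); (- 4, x); (-1, 0)].
rewrite !big_cons !big_nil /= => H; apply/eqP; rewrite -subr_eq0; apply/eqP.
rewrite -[RHS](mul0r 4^-1) -[in RHS]H; first by field.
move=> k; rewrite !big_cons !big_nil !normc_sqr /=.
by case: (x k) => [p q] /=; ring.
Qed.

End SquareSummableSpace.

(** * Positivity from factorizations *)

Section Factorization.
Variables (R : realType) (V : lmodType R) (ip : V -> V -> R).
Hypothesis hip : semi_ip ip.
Variables (P : {linear V -> V}) (d : nat) (c : R).
Hypothesis c0 : 0 <= c.
Implicit Types (f g h : V) (p : {poly R}).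

(** An abstract form of Q = c A^* A with A = (D_1, ..., D_d).  Commutation with P
    lets powers of P pass through the factors. *)
Definition factors (Q : V -> V) (D' D : 'I_d -> V -> V) : Prop :=
  [/\ forall f, Q f = c *: \sum_(j < d) D' j (D j f),
      forall j f g, ip (D' j f) g = ip f (D j g) &
      forall j f, D j (P f) = P (D j f)].

Lemma ip_factors Q D' D f g : factors Q D' D ->
  ip (Q f) g = c * \sum_(j < d) ip (D j f) (D j g).
Proof.
move=> [QE adj _]; rewrite QE (semi_ipZl hip); congr (_ * _).
have ip_sum (F : 'I_d -> V) : ip (\sum_(j < d) F j) g = \sum_(j < d) ip (F j) g.
  elim/big_rec2: _ => [|j x y _ <-]; first exact: semi_ip0l.
  by rewrite (semi_ipDl hip).
by rewrite ip_sum; apply: eq_bigr => j _; rewrite adj.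
Qed.

Lemma factors_selfadj D' D : factors P D' D -> forall f g, ip (P f) g = ip f (P g).
Proof.
move=> HP f g; rewrite (semi_ipC hip f) !(ip_factors _ _ HP); congr (_ * _).
by apply: eq_bigr => j _; rewrite (semi_ipC hip).
Qed.

Lemma ipoly_factors Q D' D f p : (forall f g, ip (P f) g = ip f (P g)) ->
  factors Q D' D ->
  ipoly ip P (Q f) f p = c * \sum_(j < d) ipoly ip P (D j f) (D j f) p.
Proof.
move=> P_selfadj [QE adj comm]; rewrite QE (ipoly_scalel hip); congr (_ * _).
have ipoly_suml (F : 'I_d -> V) :
    ipoly ip P (\sum_(j < d) F j) f p = \sum_(j < d) ipoly ip P (F j) f p.
  elim/big_rec2: _ => [|j x y _ <-]; last by rewrite (ipoly_addl hip).
  by rewrite -(scale0r 0) (ipoly_scalel hip) mul0r.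
rewrite ipoly_suml; apply: eq_bigr => j _; apply: eq_bigr => i _; congr (_ * _).
rewrite (iter_selfadj P_selfadj) adj (iter_selfadj P_selfadj); congr (ip _ _).
by elim: (i : nat) => //= n IH; rewrite comm IH.
Qed.

(** Each factor P or 1 - P is moved half to each side of the inner product, until
    only squared norms are left. *)
Lemma factors_monomials_ge0 D' D S' S : factors P D' D ->
  factors (fun f => f - P f) S' S ->
  forall k n f, 0 <= ipoly ip P f f ('X^k * (1 - 'X) ^+ n).
Proof.
move=> HD HS; have P_selfadj := factors_selfadj HD.
elim=> [|k IH] n f; last first.
  rewrite exprS -mulrA ipolyXM (ipoly_factors _ _ P_selfadj HD) mulr_ge0//.
  by apply: sumr_ge0 => j _.
elim: n f => [|n IH] f.
  by rewrite !expr0 mul1r ipoly1 (semi_ip_ge0 hip).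
have -> : 'X^0 * (1 - 'X) ^+ n.+1 =
    'X^0 * (1 - 'X) ^+ n - 'X * ('X^0 * (1 - 'X) ^+ n) :> {poly R}.
  by rewrite expr0 !mul1r exprS; ring.
rewrite ipolyD ipolyN ipolyXM.
have -> : ipoly ip P f f ('X^0 * (1 - 'X) ^+ n) - ipoly ip P (P f) f ('X^0 * (1 - 'X) ^+ n) =
    ipoly ip P (f - P f) f ('X^0 * (1 - 'X) ^+ n).
  by rewrite (ipoly_addl hip) -(scaleN1r (P f)) (ipoly_scalel hip) mulN1r.
rewrite (ipoly_factors _ _ P_selfadj HS) mulr_ge0//.
by apply: sumr_ge0 => j _.
Qed.

End Factorization.

(** * The normalised lattice Laplacian *)

Section Lattice.
Variables (R : realType) (d : nat).
Local Notation K := 'rV[int]_d.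
Local Notation l2 := (l2 R d).
Local Notation ip := (@l2ip R d).
Implicit Types (x y : l2) (e k : K).

Lemma l2sqnorm_shift e (f : K -> R[i]) : l2sqnorm (fun k => f (k + e)) = l2sqnorm f.
Proof.
rewrite /l2sqnorm -(@reindex_esum _ _ _ [set: K] [set: K] (fun k => k + e)
  (fun k => (ComplexField.Normc.normc (f k) ^+ 2)%:E))//.
split => //; first by move=> k k' _ _ /addIr.
by move=> k _; exists (k - e) => //; rewrite subrK.
Qed.

Lemma in_l2_shift e x : in_l2 (fun k => l2val x (k + e)).
Proof.
by apply/in_l2P; rewrite l2sqnorm_shift; apply/in_l2P; exact: in_l2_val.
Qed.

Definition shift e x : l2 := mk_l2 (in_l2_shift e x).

Lemma shift_linear e : linear (shift e).
Proof. by move=> c x y; apply/l2_ext/funext => k. Qed.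

HB.instance Definition _ e := GRing.isLinear.Build R l2 l2 *:%R (shift e) (shift_linear e).

Lemma shiftD e e' x : shift e (shift e' x) = shift (e + e') x.
Proof. by apply/l2_ext/funext => k /=; rewrite addrA. Qed.

Lemma shift0 x : shift 0 x = x.
Proof. by apply/l2_ext/funext => k /=; rewrite addr0. Qed.

Lemma l2sqr_shift e x : l2sqr (shift e x) = l2sqr x.
Proof. by rewrite /l2sqr l2sqnorm_shift. Qed.

Lemma shift_adj e x y : ip (shift (- e) x) y = ip x (shift e y).
Proof.
rewrite /l2ip -(l2sqr_shift (- e) (x + _)) -(l2sqr_shift (- e) (x - _)).
by rewrite linearD linearB /= shiftD addNr shift0.
Qed.

Definition unit_vec (j : 'I_d) : K := delta_mx 0 j.

(** Minus the discrete Laplacian divided by 4d, which brings its spectrum to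
    the unit interval. *)
Definition freq_op x : l2 := (4 * d%:R)^-1 *:
  \sum_(j < d) (x + x - shift (unit_vec j) x - shift (- unit_vec j) x).

Lemma freq_op_linear : linear freq_op.
Proof.
move=> c x y; rewrite /freq_op (scalerA c) (mulrC c) -(scalerA _ c) -scalerDr; congr (_ *: _).
rewrite scaler_sumr -big_split; apply: eq_bigr => j _ /=.
by apply/l2_ext/funext => k /=; rewrite ?rmorphN1; ring.
Qed.

HB.instance Definition _ := GRing.isLinear.Build R l2 l2 *:%R freq_op freq_op_linear.

Definition diff_up j x := shift (unit_vec j) x - x.
Definition diff_down j x := shift (- unit_vec j) x - x.
Definition sum_up j x := shift (unit_vec j) x + x.
Definition sum_down j x := shift (- unit_vec j) x + x.

Lemma shift_freq_op e x : shift e (freq_op x) = freq_op (shift e x).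
Proof.
rewrite /freq_op linearZ linear_sum; congr (_ *: _); apply: eq_bigr => j _ /=.
by rewrite !linearB linearD /= !shiftD ![e + _]addrC.
Qed.

Lemma freq_op_factors : factors ip freq_op (4 * d%:R)^-1 freq_op diff_down diff_up.
Proof.
split.
- move=> x; rewrite /freq_op; congr (_ *: _); apply: eq_bigr => j _.
  rewrite /diff_down /diff_up linearB /= shiftD addNr shift0.
  by apply/l2_ext/funext => k /=; rewrite !rmorphN1; ring.
- move=> j x y; rewrite /diff_down /diff_up.
  by rewrite !(semi_ipE (l2ip_semi_ip R d)) shift_adj.
- by move=> j x; rewrite /diff_up linearB /= shift_freq_op.
Qed.

Hypothesis d0 : (0 < d)%N.

(** |f(k+e) - f(k)|^2 + |f(k+e) + f(k)|^2 = 2 |f(k+e)|^2 + 2 |f(k)|^2, so the sums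
    complement the differences to 4d. *)
Lemma sum_factors :
  factors ip freq_op (4 * d%:R)^-1 (fun x => x - freq_op x) sum_down sum_up.
Proof.
have dn : d%:R != 0 :> R by rewrite pnatr_eq0 -lt0n.
split.
- move=> x; have xE : x = (4 * d%:R)^-1 *: \sum_(j < d) (4 : R) *: x.
    rewrite sumr_const card_ord -[X in _ *: X]scaler_nat !scalerA (mulrC d%:R).
    by rewrite mulVf ?scale1r// mulf_neq0.
  rewrite [X in X - _]xE /freq_op -scalerBr -sumrB; congr (_ *: _).
  apply: eq_bigr => j _; rewrite /sum_down /sum_up (linearD (shift (- unit_vec j))) /= shiftD addNr shift0.
  have -> : (4 : R) *: x = x + x + (x + x).
    by rewrite -!mulr2n -mulrnA scaler_nat.
  by apply/l2_ext/funext => k /=; rewrite !rmorphN1; ring.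
- move=> j x y; rewrite /sum_down /sum_up.
  by rewrite !(semi_ipE (l2ip_semi_ip R d)) shift_adj.
- by move=> j x; rewrite /sum_up linearD /= shift_freq_op.
Qed.

End Lattice.

(** * The solution as a curve in the Hilbert space *)

Section SolutionTrajectory.
Variables (R : realType) (d : nat).
Local Notation K := 'rV[int]_d.
Local Notation l2 := (l2 R d).
Local Notation ip := (@l2ip R d).
Local Notation nrm := (seminorm ip).
Local Notation mu := (@lebesgue_measure R).

Lemma l2norm_seminorm (x : l2) : l2norm (l2val x) = (nrm x)%:E.
Proof. by rewrite /l2norm -l2sqrE /seminorm l2ip_sqr. Qed.

Definition to_l2 (f : K -> R[i]) : l2 :=
  if pselect (in_l2 f) is left h then mk_l2 h else 0.

Lemma to_l2E f : in_l2 f -> l2val (to_l2 f) = f.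
Proof. by rewrite /to_l2; case: pselect. Qed.

Lemma cvg0_eps (G : set_system R) (f : R -> \bar R) (e : R) : 0 < e ->
  f s @[s --> within (halfline R) G] --> 0%E ->
  G (fun s => halfline R s -> (f s < e%:E)%E).
Proof.
move=> e0 /(_ [set y | (y < e%:E)%E]); apply.
by apply: open_nbhs_nbhs; split; [exact: open_ereal_lt_ereal|rewrite /= lte_fin].
Qed.

Lemma l2_derivativeP (w : R -> K -> R[i]) (t : R) (z : K -> R[i]) : 0 < t ->
  (forall s : R, 0 <= s -> in_l2 (w s)) -> l2_derivative w t z ->
  has_derivative ip (fun s => to_l2 (w s)) t (to_l2 z).
Proof.
move=> t0 hw [hz cv] e e0; have [b /= b0 H] := cvg0_eps e0 cv.
exists (Num.min b t); first by rewrite lt_min b0.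
move=> s; rewrite lt_min => /andP[sb st].
have [->|snt] := eqVneq s t.
  by rewrite !subrr scale0r subrr normr0 mulr0 seminorm0//; exact: l2ip_semi_ip.
have s0 : 0 < s by move: st; rewrite ltr_norml; lra.
have st0 : s - t != 0 by rewrite subr_eq0.
have := H s; rewrite /ball_ /= distrC => /(_ sb snt).
rewrite /halfline /= in_itv /= andbT (ltW s0) => /(_ isT).
have -> : (fun k => ((s - t)^-1)%:C%C * (w s k - w t k) - z k) =
    l2val ((s - t)^-1 *: (to_l2 (w s) - to_l2 (w t)) - to_l2 z).
  apply/funext => k /=; rewrite !to_l2E//; [|exact/hw/ltW|exact/hw/ltW].
  by rewrite !rmorphN1 !mulN1r.
rewrite l2norm_seminorm lte_fin => Hs.
have -> : to_l2 (w s) - to_l2 (w t) - (s - t) *: to_l2 z =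
    (s - t) *: ((s - t)^-1 *: (to_l2 (w s) - to_l2 (w t)) - to_l2 z).
  by rewrite scalerBr scalerA mulfV// scale1r.
rewrite (seminormZ (l2ip_semi_ip R d)) mulrC ler_wpM2r//; exact: ltW.
Qed.

Lemma l2_abs_continuousP (w : R -> K -> R[i]) :
  (forall s : R, 0 <= s -> in_l2 (w s)) -> l2_abs_continuous w ->
  forall T : R, 0 < T -> abs_cont (fun s t => nrm (to_l2 (w t) - to_l2 (w s))) 0 T.
Proof.
move=> hw acw T T0 e e0; have [b b0 H] := acw T e T0 e0; exists b => // s cs ls.
pose x (i : 'I_(size s)) := (nth (0, 0) s i).1.
pose y (i : 'I_(size s)) := (nth (0, 0) s i).2.
have := H _ x y; rewrite /x /y.
have xin i : 0 <= x i /\ x i < y i /\ y i <= T.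
  by apply: (chain_mem cs); exact: mem_nth.
move=> /(_ xin (chain_trivIset cs)); rewrite -(big_mkord xpredT
  (fun i => (nth (0, 0) s i).2 - (nth (0, 0) s i).1)).
rewrite -(big_nth (0, 0) xpredT (fun p => p.2 - p.1)) => /(_ ls) Hs.
rewrite -lee_fin; apply: ltW; apply: le_lt_trans Hs.
rewrite (big_nth (0, 0)) big_mkord -sumEFin le_eqVlt; apply/orP; left; apply/eqP.
apply: eq_bigr => i _; rewrite -l2norm_seminorm; congr l2norm; apply/funext => k /=.
have [x0 [xy yT]] := xin i.
have y0 : 0 <= y i by exact: le_trans (ltW xy).
rewrite !to_l2E; [|exact: hw|exact: hw].
by rewrite rmorphN1 mulN1r.
Qed.

Lemma l2_continuousP (w : R -> K -> R[i]) (e : R) :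
  (forall s : R, 0 <= s -> in_l2 (w s)) -> l2_continuous w -> 0 < e ->
  exists2 b : R, 0 < b & forall s : R, 0 <= s -> s < b ->
    nrm (to_l2 (w s) - to_l2 (w 0)) < e.
Proof.
move=> hw cw e0; have [b /= b0 H] := cvg0_eps e0 (cw 0 (lexx 0)).
exists b => // s s0 sb; have := H s; rewrite /ball_ /= sub0r normrN ger0_norm//.
rewrite /halfline /= in_itv /= andbT => /(_ sb s0).
have -> : (fun k => w s k - w 0 k) = l2val (to_l2 (w s) - to_l2 (w 0)).
  apply/funext => k /=; rewrite !to_l2E; [|exact: hw|exact: hw].
  by rewrite rmorphN1 mulN1r.
by rewrite l2norm_seminorm lte_fin.
Qed.

End SolutionTrajectory.

Section EnergyOfSolution.
Variables (R : realType) (d : nat).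
Local Notation K := 'rV[int]_d.
Local Notation ip := (@l2ip R d).
Local Notation P := (@freq_op R d).
Local Notation nrm := (seminorm ip).
Hypothesis d0 : (0 < d)%N.
Let Lam : R := 4 * d%:R.
Let hip := l2ip_semi_ip R d.

Let Lam0 : 0 < Lam. Proof. by rewrite mulr_gt0// ltr0n. Qed.
Let c0 : 0 <= (4 * d%:R)^-1 :> R. Proof. by rewrite invr_ge0 ltW. Qed.
Let P_selfadj := factors_selfadj hip (freq_op_factors R d).
Let monomials_ge0 := factors_monomials_ge0 hip c0 (freq_op_factors R d) (sum_factors R d0).

(** The energy at unit speed: unlike the energy with coefficient a(t)^2 it is
    continuous in time even if a is only measurable. *)
Definition form_energy (x y : l2 R d) : R := ip y y + Lam * ip (P x) x.

Lemma form_energyE x y :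
  form_energy x y = l2sqr y + \sum_(j < d) l2sqr (diff_up j x).
Proof.
rewrite /form_energy l2ip_sqr (ip_factors hip _ _ (freq_op_factors R d)) mulrA.
rewrite mulfV ?gt_eqF// mul1r; congr (_ + _); apply: eq_bigr => j _.
by rewrite l2ip_sqr.
Qed.

Lemma form_energy_incr (x y x' y' : l2 R d) :
  form_energy (x + x') (y + y') - form_energy x' y' =
  (ip y y + 2 * ip y y') + Lam * (ip (P x) x + 2 * ip (P x) x').
Proof.
rewrite /form_energy linearD /= !(semi_ipDl hip) !(semi_ipDr hip) (semi_ipC hip y' y).
by rewrite (P_selfadj x' x) (semi_ipC hip x' (P x)); ring.
Qed.

Lemma form_energy_ge0 x y : 0 <= form_energy x y.
Proof. by rewrite form_energyE addr_ge0 ?l2sqr_ge0// sumr_ge0// => j _; exact: l2sqr_ge0. Qed.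

Variables (a : R -> R) (a0 a1 : R).
Hypotheses (a00 : 0 < a0) (ha : forall t : R, 0 <= t -> a0 <= a t /\ a t <= a1).
Variables (u0 u1 : K -> R[i]) (u v : R -> K -> R[i]).
Hypothesis sol : is_solution a u0 u1 u v.

Let U (t : R) : l2 R d := to_l2 (u t).
Let W (t : R) : l2 R d := to_l2 (v t).
Let hu (t : R) : 0 <= t -> in_l2 (u t).
Proof. by case: sol => h _ /h[]. Qed.
Let hv (t : R) : 0 <= t -> in_l2 (v t).
Proof. by case: sol => h _ /h[]. Qed.

Lemma energy_bounds (t : R) : 0 <= t ->
  ((Num.min 1 (a0 ^+ 2) * form_energy (U t) (W t))%:E <= energy a u v t <=
   (Num.max 1 (a1 ^+ 2) * form_energy (U t) (W t))%:E)%E.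
Proof.
move=> t0; have [at0 at1] := ha t0.
have -> : energy a u v t =
    (l2sqr (W t) + a t ^+ 2 * \sum_(j < d) l2sqr (diff_up j (U t)))%:E.
  rewrite /energy EFinD (EFinM (a t ^+ 2)) -sumEFin; congr (_ + _ * _)%E.
    by rewrite l2sqrE /W to_l2E//; exact: hv.
  apply: eq_bigr => j _; rewrite l2sqrE; congr l2sqnorm; apply/funext => k /=.
  rewrite /U to_l2E; last exact: hu.
  by rewrite /fwd_diff rmorphN1 mulN1r.
have D0 : 0 <= \sum_(j < d) l2sqr (diff_up j (U t)).
  by apply: sumr_ge0 => j _; exact: l2sqr_ge0.
have N0 := l2sqr_ge0 (W t).
have a0n : 0 <= a0 := ltW a00; have atn : 0 <= a t := le_trans a0n at0.
have a1n : 0 <= a1 := le_trans atn at1.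
have sq0 : a0 ^+ 2 <= a t ^+ 2 by rewrite lerXn2r ?nnegrE.
have sq1 : a t ^+ 2 <= a1 ^+ 2 by rewrite lerXn2r ?nnegrE.
rewrite !lee_fin form_energyE !mulrDr -[X in _ <= X + _ <= _]mul1r.
apply/andP; split; apply: lerD; apply: ler_wpM2r => //.
- by rewrite ge_min lexx.
- by rewrite ge_min sq0 orbT.
- by rewrite le_max lexx.
- by rewrite le_max sq1 orbT.
Qed.

Lemma form_energy_continuous0 (e : R) : 0 < e -> exists2 b : R, 0 < b &
  forall s : R, 0 <= s -> s < b ->
    `|form_energy (U s) (W s) - form_energy (U 0) (W 0)| <= e.
Proof.
move=> e0; have [_ [cu [cv _]]] := sol.
pose M := nrm (U 0) + nrm (W 0).
have M0 : 0 <= M by rewrite addr_ge0 ?seminorm_ge0.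
have q0 : 0 < (1 + Lam) * (1 + 2 * M).
  by rewrite mulr_gt0// ltr_pwDl ?mulr_ge0 ?(ltW Lam0).
pose eta := Num.min 1 (e / ((1 + Lam) * (1 + 2 * M))).
have eta0 : 0 < eta by rewrite lt_min ltr01 divr_gt0.
have eta1 : eta <= 1 by rewrite ge_min lexx.
have etae : (1 + Lam) * (1 + 2 * M) * eta <= e.
  by rewrite mulrC -ler_pdivlMr// ge_min lexx orbT.
have [b1 b10 H1] := l2_continuousP hu cu eta0.
have [b2 b20 H2] := l2_continuousP hv cv eta0.
exists (Num.min b1 b2); first by rewrite lt_min b10.
move=> s s0; rewrite lt_min => /andP[sb1 sb2].
have {H1}X1 := ltW (H1 s s0 sb1); have {H2}Y1 := ltW (H2 s s0 sb2).
rewrite -/(U s) -/(U 0) in X1; rewrite -/(W s) -/(W 0) in Y1.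
pose X := U s - U 0; pose Y := W s - W 0.
have -> : form_energy (U s) (W s) - form_energy (U 0) (W 0) =
    (ip Y Y + 2 * ip Y (W 0)) + Lam * (ip (P X) X + 2 * ip (P X) (U 0)).
  by rewrite -form_energy_incr /X /Y !subrK.
have bnd (f g : l2 R d) (Mf Mg : R) : nrm f <= Mf -> nrm g <= Mg -> `|ip f g| <= Mf * Mg.
  move=> h1 h2; apply: le_trans (semi_ip_norm hip f g) _.
  by apply: ler_pM; rewrite ?seminorm_ge0.
have PX : nrm (P X) <= eta.
  apply: le_trans X1; rewrite /seminorm ler_wsqrtr//.
  exact: (ip_contraction P_selfadj monomials_ge0 X).
have U0M : nrm (U 0) <= M by rewrite lerDl seminorm_ge0.
have W0M : nrm (W 0) <= M by rewrite lerDr seminorm_ge0.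
have term (f g h : l2 R d) : nrm f <= eta -> nrm g <= eta -> nrm h <= M ->
    `|ip f g + 2 * ip f h| <= (1 + 2 * M) * eta.
  move=> hf hg hh; apply: le_trans (ler_normD _ _) _; rewrite (normrM 2) (@ger0_norm _ 2)//.
  have := bnd _ _ _ _ hf hg; have := bnd _ _ _ _ hf hh.
  have : eta * eta <= eta * 1 by rewrite ler_wpM2l// ltW.
  lra.
apply: le_trans etae; apply: le_trans (ler_normD _ _) _.
rewrite (normrM Lam) (ger0_norm (ltW Lam0)).
have h1 := term _ _ _ Y1 Y1 W0M; have h2 := term _ _ _ PX X1 U0M.
have := ler_wpM2l (ltW Lam0) h2.
have -> : (1 + Lam) * (1 + 2 * M) * eta =
    (1 + 2 * M) * eta + Lam * ((1 + 2 * M) * eta) by ring.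
lra.
Qed.

(** [energy_transfer] starts at positive times; let the starting time tend
    to 0. *)
Lemma form_energy_transfer (c1 c2 T : R) : 0 < T ->
  (forall x : R, 0 <= x <= 1 -> exists A B G, lyapunov a (Lam * x) c1 c2 A B G) ->
  c1 * form_energy (U T) (W T) <= c2 * form_energy (U 0) (W 0).
Proof.
move=> T0 H; have [_ [_ [_ [du [acv [ode _]]]]]] := sol.
have a_bound (t : R) : 0 < t -> `|a t| <= a1.
  move=> /ltW/ha[h1 h2]; rewrite ger0_norm//; exact: le_trans (ltW a00) h1.
have u_derive (t : R) : 0 < t -> has_derivative ip U t (W t).
  by move=> t0; apply: l2_derivativeP => //; apply: du; exact: ltW.
have w_derive : {ae @lebesgue_measure R, forall t : R, 0 < t ->
    has_derivative ip W t (- (a t ^+ 2 * Lam) *: P (U t))}.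
  apply: ae_mono ode => t Ht t0; have [w dw wE] := Ht (ltW t0).
  have -> : - (a t ^+ 2 * Lam) *: P (U t) = to_l2 w.
    have [hw _] := dw; apply/l2_ext/funext => k; rewrite to_l2E//.
    have -> : w k = (a t ^+ 2)%:C%C * laplacian (u t) k.
      by apply/eqP; rewrite -subr_eq0 wE.
    rewrite /freq_op scalerA.
    have -> : - (a t ^+ 2 * Lam) * (4 * d%:R)^-1 = - a t ^+ 2.
      by rewrite -/Lam mulNr mulfK// gt_eqF.
    rewrite scaleNr -scalerN -sumrN /= /laplacian; congr (_ * _).
    have l2val_sum (F : 'I_d -> l2 R d) : l2val (\sum_(j < d) F j) k = \sum_(j < d) l2val (F j) k.
      by elim/big_rec2: _ => //= j x y _ <-.
    rewrite l2val_sum; apply: eq_bigr => j _ /=; rewrite /U to_l2E; last exact/hu/ltW.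
    by rewrite !rmorphN1; ring.
  by apply: l2_derivativeP.
have w_ac := l2_abs_continuousP hv acv.
have step (s : R) : 0 < s -> s <= T ->
    c1 * form_energy (U T) (W T) <= c2 * form_energy (U s) (W s).
  move=> s0 sT; exact: (energy_transfer hip P_selfadj monomials_ge0 a_bound
    (ltW Lam0) u_derive w_ac w_derive s0 sT H).
apply/ler_addgt0Pr => e e0.
have e10 : 0 < e / (`|c2| + 1) by rewrite divr_gt0// ltr_wpDl.
have [b b0 Hb] := form_energy_continuous0 e10.
pose s := Num.min T (b / 2).
have s0 : 0 < s by rewrite lt_min T0 divr_gt0.
have sb : s < b by rewrite gt_min; apply/orP; right; lra.
have sT : s <= T by rewrite ge_min lexx.
apply: le_trans (step s s0 sT) _; rewrite -lerBlDl -mulrBr.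
apply: le_trans (ler_norm _) _; rewrite normrM.
apply: (@le_trans _ _ ((`|c2| + 1) * (e / (`|c2| + 1)))).
  by apply: ler_pM; rewrite ?lerDl//; apply: Hb => //; exact: ltW.
by rewrite mulrC divfK// gt_eqF// ltr_wpDl.
Qed.

End EnergyOfSolution.

Theorem theorem3p1 (R : realType) (d : nat) (hd : (1 <= d)%N)
    (a : R -> R) (a0 a1 : R) (ha0 : 0 < a0) (ha01 : a0 <= a1)
    (ha : forall t : R, 0 <= t -> a0 <= a t /\ a t <= a1)
    (hcond : condition_i a \/ condition_ii a \/ condition_iii a) :
  exists C : R, 1 <= C /\
    forall (u0 u1 : 'rV[int]_d -> R[i]) (u v : R -> 'rV[int]_d -> R[i]),
      in_l2 u0 -> in_l2 u1 -> is_solution a u0 u1 u v ->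
      forall t : R, 0 <= t ->
        ((C^-1)%:E * energy a u v 0 <= energy a u v t /\
         energy a u v t <= C%:E * energy a u v 0)%E.
Proof.
pose Lam : R := 4 * d%:R.
have Lam0 : 0 <= Lam by rewrite mulr_ge0.
have [c [C [c0 C0 lyap]]] : uniformly_lyapunov a Lam.
  case: hcond => [h|[h|h]]; [exact: (condition_i_lyapunov ha0 ha)
    |exact: (condition_ii_lyapunov ha0 ha)|exact: (condition_iii_lyapunov ha0 ha)].
have lamx (x : R) : 0 <= x <= 1 -> 0 <= Lam * x <= Lam.
  by move=> /andP[x0 x1]; rewrite mulr_ge0//= ler_piMr.
(* k compares the energies at unit speed; m and M restore the factor a(t)^2. *)
pose m := Num.min 1 (a0 ^+ 2); pose M := Num.max 1 (a1 ^+ 2).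
have m0 : 0 < m by rewrite lt_min ltr01 exprn_gt0.
have M0 : 0 < M by rewrite lt_max ltr01.
pose k := Num.max 1 (C / c).
have k0 : 0 < k by rewrite lt_max ltr01.
have k1 : 1 <= k by rewrite le_max lexx.
have mM : m <= M by rewrite ge_min le_max lexx.
exists (M * k / m); split.
  by rewrite ler_pdivlMr// mul1r (le_trans mM)// ler_peMr// ltW.
move=> u0 u1 u v hu0 hu1 sol t t0.
pose E (s : R) := form_energy (to_l2 (u s)) (to_l2 (v s)).
have [up lo] : E t <= k * E 0 /\ E 0 <= k * E t.
  have E0 s : 0 <= E s by exact: form_energy_ge0.
  have kge (x y : R) : 0 <= y -> c * x <= C * y -> x <= k * y.
    move=> y0 h; apply: (@le_trans _ _ (C / c * y)).
      by rewrite mulrAC ler_pdivlMr// mulrC.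
    by rewrite ler_wpM2r// le_max lexx orbT.
  move: t0; rewrite le_eqVlt => /predU1P[<-|t0]; first by split; rewrite ler_peMl.
  split; apply: kge => //.
    apply: (form_energy_transfer hd ha0 ha sol t0) => x x01.
    have [A [B [G h]]] := lyap _ 1 (lamx x x01) (or_introl erefl).
    by exists A, B, G; exact: slyapunov_decreasing.
  rewrite -lerN2 -!mulNr; apply: (form_energy_transfer hd ha0 ha sol t0) => x x01.
  have [A [B [G h]]] := lyap _ (-1) (lamx x x01) (or_intror erefl).
  by exists (fun t => - A t), (fun t => - B t), (fun t => - G t);
    exact: slyapunov_increasing.
have /andP[l0 h0] := energy_bounds hd ha0 ha sol (lexx 0).
have /andP[lt ht] := energy_bounds hd ha0 ha sol t0.
rewrite -/(E 0) -/m -/M in l0 h0; rewrite -/(E t) -/m -/M in lt ht.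
have q0 : 0 < M * k / m by rewrite divr_gt0// mulr_gt0.
split.
  apply: le_trans lt; apply: (@le_trans _ _ (((M * k / m)^-1)%:E * (M * E 0)%:E)%E).
    by apply: lee_wpmul2l => //; rewrite lee_fin invr_ge0 ltW.
  rewrite -EFinM lee_fin ler_pdivrMl//.
  have -> : M * k / m * (m * E t) = M * (k * E t) by field; rewrite gt_eqF.
  by rewrite ler_pM2l.
apply: le_trans ht _; apply: (@le_trans _ _ ((M * k / m)%:E * (m * E 0)%:E)%E).
  rewrite -EFinM lee_fin.
  have -> : M * k / m * (m * E 0) = M * (k * E 0) by field; rewrite gt_eqF.
  by rewrite ler_pM2l.
by apply: lee_wpmul2l => //; rewrite lee_fin ltW.
Qed.
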